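(* (Functorial Banach-$*$-strict deformation quantization.) Let $\varsigma$ be a semi-norm on $E$ such that $|\sigma(f,g)|\le c\,\varsigma(f)\,\varsigma(g)$ for all $f,g\in E$, for some constant $c>0$. (i) (von Neumann's condition) $\lim_{\hbar\to0}\|\mu\star_\hbar\nu-\mu\star_0\nu\|_1=0$ for all $\mu,\nu\in\mathcal{M}(E)$. (ii) (Dirac's condition) $\lim_{\hbar\to0}\|\{\mu,\nu\}_\hbar-\{\mu,\nu\}_0\|_1=0$ for all $\mu,\nu\in\mathcal{M}^1_\varsigma(E)$. (iii) (Rieffel's condition) Rieffel's condition is trivially fulfilled, since on all the Banach-$*$-algebras $(\mathcal{M}(E),\star_\hbar)$, $\hbar\in\mathbb{R}$, one has the same norm, namely the total variation norm $\|\cdot\|_1$. (iv) Let $(\mathcal{P},\star_0,\{\cdot,\cdot\}_0)$ be an arbitrary one of the Poisson algebras listed under (I)–(IV) in the context, and for each $\hbar\in\mathbb{R}$ define as quantization map the identical (thus injective) embedding $Q^B_\hbar:\mathcal{P}\to(\mathcal{M}(E),\star_\hbar)$, $\mu\mapsto\mu$. Then the image $Q^B_\hbar(\mathcal{P})$ is a sub-$*$-algebra of $(\mathcal{M}(E),\star_\hbar)$ for every $\hbar\in\mathbb{R}$. Summarizing, $(Q^B_\hbar)_{\hbar\in\mathbb{R}}$ constitutes a strict deformation quantization of Banach-$*$-type (of $(\mathcal{P},\star_0,\{\cdot,\cdot\}_0)$), which depends functorially on the pre-symplectic space $(E,\sigma)$, provided the semi-norms are chosen which characterize the enlarged measure Poisson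 algebras.
   Context: Setting. $E$ is an infinite dimensional real vector space and $\sigma$ is a pre-symplectic form on $E$ (an $\mathbb{R}$-bilinear antisymmetric form, possibly degenerate, $\sigma\neq0$). All topologies are Hausdorff. $\{E_\alpha\mid\alpha\in I\}$ is the family of all finite dimensional subspaces of $E$, each with its unique vector space topology; $\mathcal{M}(E_\alpha)$ denotes the finite complex (regular) Borel measures on $E_\alpha$. $\tau_{\mathrm{il}}$ is the finest locally convex topology on $E$ and $\mathsf{B}^{\mathrm{il}}(E)$ its Borel $\sigma$-algebra. Finite complex measures $\mu$ on $\mathsf{B}^{\mathrm{il}}(E)$ are normed by total variation $\|\mu\|_1=|\mu|(E)$. Each $\mu\in\mathcal{M}(E_\alpha)$ is regarded as a measure on $E$ concentrated on $E_\alpha$, and $\mathcal{M}(E)$ is the $\|\cdot\|_1$-closure of $\bigcup_{\alpha\in I}\mathcal{M}(E_\alpha)$. $\mathbf 1_\Lambda$ is the characteristic function of $\Lambda$. For $\hbar\in\mathbb{R}$, $(\mathcal{M}(E),\star_\hbar)$ is the unital Banach-$*$-algebra with $*$-operation $\mu^*(\Lambda)=\overline{\mu(-\Lambda)}$ and product $\mu\star_\hbar\nu(\Lambda)=\int_E d\mu(f)\int_E d\nu(g)\,e^{-\frac i2\hbar\sigma(f,g)}\,\mathbf 1_\Lambda(f+g)$ (defined by this formula on each $\mathcal{M}(E_\alpha)$ and extended $\|\cdot\|_1$-continuously). For $\hbar\ne0$, $\{\mu,\nu\}_\hbar:=\frac i\hbar(\mu\star_\hbar\nu-\nu\star_\hbar\mu)$.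 For $\mu,\nu\in\mathcal{M}^1_\varsigma(E)$, $\{\mu,\nu\}_0\in\mathcal{M}(E)$ is the measure $\{\mu,\nu\}_0(\Lambda)=\int_E d\mu(f)\int_E d\nu(g)\,\sigma(f,g)\,\mathbf 1_\Lambda(f+g)$. For a semi-norm $\kappa$ on $E$ and $n\in\mathbb{N}\cup\{0,\infty\}$, $\mathcal{M}^n_\kappa(E):=\{\mu\in\mathcal{M}(E)\mid\int_E\kappa(f)^m\,d|\mu|(f)<\infty\text{ for all finite }0\le m\le n\}$. A semi-norm $\eta$ is stronger than $\kappa$ if $\kappa\le k\,\eta$ for some constant $k\ge0$; they are equivalent if $k_1\eta\le\kappa\le k_2\eta$ for some $0<k_1\le k_2$. $\mathcal{M}(E)_d$ and $\mathcal{M}(E)_c$ are the $\|\cdot\|_1$-closures of $\bigcup_\alpha\mathcal{M}(E_\alpha)_d$ (discrete measures) and $\bigcup_\alpha\mathcal{M}(E_\alpha)_c$ (continuous, i.e. atomless, measures); $\mathcal{M}(E_\alpha)_a$ are the measures on $E_\alpha$ absolutely continuous with respect to Haar measure; $\mathcal{M}(E)_{df}$ is the set of finite complex linear combinations of point measures $\delta(f)$, $f\in E$. Poisson algebras $\mathcal{P}\subseteq\mathcal{M}^\infty_\varsigma(E)$: (I) $\mathcal{P}=\mathcal{M}^\infty_\kappa(E)$ for a semi-norm $\kappa$ stronger than, or equivalent to, $\varsigma$; (II) $\mathcal{P}=\bigcap_{\beta\in B}\mathcal{M}^\infty_{\kappa_\beta}(E)$ for semi-norms $\kappa_\beta$,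 $\beta\in B$, with $\varsigma\le\sum_{\beta\in\Gamma}c_\beta\kappa_\beta$ for some finite $\Gamma\subseteq B$ and constants $c_\beta>0$; (III) the intersection of $\mathcal{M}(E)_d$, or of $\mathcal{M}(E)_c$, or of $\mathcal{M}(E_\alpha)_a$ for a finite dimensional subspace $E_\alpha$, with a space from (I) or (II); (IV) $\mathcal{P}=\mathcal{M}(E)_{df}$. A Poisson algebra is a commutative complex $*$-algebra with a bilinear, anticommutative, real ($\{A,B\}^*=\{A^*,B^*\}$) bracket satisfying the Jacobi identity and the Leibniz rule. A strict deformation quantization of Banach-$*$-type of a Poisson algebra $(\mathcal{P},\{\cdot,\cdot\})$ is a family of linear, $*$-preserving maps $Q_\hbar:\mathcal{P}\to\mathcal{A}^\hbar$, $\hbar\in\mathbb{R}$, into Banach-$*$-algebras $\mathcal{A}^\hbar$ (norm $\|\cdot\|_\hbar$, $\hbar$-scaled commutator $\{A,B\}_\hbar=\frac i\hbar(AB-BA)$ for $\hbar\ne0$), with $Q_0$ the identical embedding, such that for all $A,B\in\mathcal{P}$: $\lim_{\hbar\to0}\|\{Q_\hbar(A),Q_\hbar(B)\}_\hbar-Q_\hbar(\{A,B\})\|_\hbar=0$ (Dirac); $\lim_{\hbar\to0}\|Q_\hbar(A)Q_\hbar(B)-Q_\hbar(AB)\|_\hbar=0$ (von Neumann); $\hbar\mapsto\|Q_\hbar(A)\|_\hbar$ is continuous (Rieffel); and each $Q_\hbar$ is injective with $Q_\hbar(\mathcal{P})$ a sub-$*$-algebra of $\mathcal{A}^\hbar$.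 Here $\mathcal{A}^\hbar=(\mathcal{M}(E),\star_\hbar)$ with norm $\|\cdot\|_1$ for every $\hbar$. *)

(* Defs.v *)
From HB Require Import structures.
From mathcomp Require Import all_boot all_order all_algebra.
From mathcomp Require Import all_classical all_reals all_analysis.
From mathcomp Require Import complex sesquilinear.

Set Implicit Arguments.
Unset Strict Implicit.
Unset Printing Implicit Defensive.

Import Order.TTheory GRing.Theory Num.Theory numFieldNormedType.Exports.

Local Open Scope classical_set_scope.
Local Open Scope complex_scope.
Local Open Scope ring_scope.

Definition lin_span (R : realType) (E : lmodType R) (n : nat) (e : 'I_n -> E) :
    set E :=
  [set x | exists t : 'I_n -> R, x = \sum_(i < n) t i *: e i].

Definition findim_subspace (R : realType) (E : lmodType R) (V : set E) : Prop :=
  exists (n : nat) (e : 'I_n -> E), V = lin_span e.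

Definition infinite_dimensional (R : realType) (E : lmodType R) : Prop :=
  ~ findim_subspace [set: E].

Definition presymplectic (R : realType) (E : lmodType R)
    (sigma : {biscalar E}) : Prop :=
  (forall f g, sigma f g = - sigma g f) /\ (exists f g, sigma f g != 0).

Definition seminorm (R : realType) (E : lmodType R) (p : E -> R) : Prop :=
  [/\ forall x, 0 <= p x,
      forall (a : R) x, p (a *: x) = `|a| * p x &
      forall x y, p (x + y) <= p x + p y].

Definition stronger (R : realType) (E : lmodType R) (eta kappa : E -> R) : Prop :=
  exists2 k : R, 0 <= k & forall f, kappa f <= k * eta f.

Definition equivalent_seminorms (R : realType) (E : lmodType R)
    (eta kappa : E -> R) : Prop :=
  exists k1 k2 : R, [/\ 0 < k1, k1 <= k2 &
    forall f, k1 * eta f <= kappa f /\ kappa f <= k2 * eta f].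

(* The finest locally convex topology is the one defined by the family of all
   semi-norms; as this family is directed, the unit semi-balls form a base. *)
Definition il_open (R : realType) (E : lmodType R) : set (set E) :=
  [set U | forall x, U x ->
    exists2 p : E -> R, seminorm p & forall y, p (y - x) < 1 -> U y].

(* [E] pointed by [0], as required by [g_sigma_algebraType]. *)
Definition il_type (R : realType) (E : lmodType R) : Type := E.
HB.instance Definition _ (R : realType) (E : lmodType R) :=
  Choice.on (il_type E).
HB.instance Definition _ (R : realType) (E : lmodType R) :=
  isPointed.Build (il_type E) (0 : E).

Definition ilBorel (R : realType) (E : lmodType R) :=
  g_sigma_algebraType (@il_open R E : set (set (il_type E))).

Definition il_measurable (R : realType) (E : lmodType R) (A : set E) : Prop :=
  @measurable _ (ilBorel E) A.

(* A complex measure is a function [set E -> R[i]], normalized to vanish off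
   the Borel sigma-algebra so that equality of measures is Leibniz equality and
   the vector space operations are those of the function space. *)
Definition cmeasure (R : realType) (E : lmodType R) (mu : set E -> R[i]) : Prop :=
  [/\ mu set0 = 0,
      forall A, ~ il_measurable A -> mu A = 0 &
      forall F : nat -> set E, (forall i, il_measurable (F i)) ->
        trivIset setT F ->
        (fun n => Normc.normc (\sum_(0 <= i < n) mu (F i) - mu (\bigcup_i F i)))
          @ \oo --> (0 : R)].

(* Total variation; partitions of [A] are replaced by disjoint families of
   subsets of [A], so that |mu| is nonnegative on non-measurable sets too. *)
Definition tv (R : realType) (E : lmodType R) (mu : set E -> R[i])
    (A : set (ilBorel E)) : \bar R :=
  ereal_sup [set x | exists (n : nat) (F : 'I_n -> set E),
    [/\ forall i, il_measurable (F i) /\ F i `<=` A,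
        trivIset setT F &
        x = (\sum_(i < n) Normc.normc (mu (F i)))%:E]].

Definition tvnorm (R : realType) (E : lmodType R) (mu : set E -> R[i]) : R :=
  fine (tv mu setT).

(* Positive part of the Jordan decomposition of a signed measure. *)
Definition pos_part (R : realType) (E : lmodType R) (nu : set E -> R)
    (A : set (ilBorel E)) : \bar R :=
  ereal_sup [set (nu B)%:E | B in [set B | il_measurable B /\ B `<=` A]].

(* Integral against a real signed measure, via its Jordan decomposition; [cint]
   extends it to complex measures and complex integrands. *)
Definition rint (R : realType) (E : lmodType R) (nu : set E -> R) (h : E -> R) : R :=
  let nun := fun A => - nu A in
  fine (\int[pos_part nu]_x (h x)%:E) - fine (\int[pos_part nun]_x (h x)%:E).

Definition cint (R : realType) (E : lmodType R) (mu : set E -> R[i])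
    (h : E -> R[i]) : R[i] :=
  let mur := fun A => complex.Re (mu A) in
  let mui := fun A => complex.Im (mu A) in
  let hr := fun x => complex.Re (h x) in
  let hi := fun x => complex.Im (h x) in
  (rint mur hr - rint mui hi) +i* (rint mur hi + rint mui hr).

Definition point_measure (R : realType) (E : lmodType R) (f : E) (A : set E) : R[i] :=
  if `[< il_measurable A /\ A f >] then 1 else 0.

Definition measure_star (R : realType) (E : lmodType R) (mu : set E -> R[i])
    (A : set E) : R[i] :=
  (mu [set x | A (- x)])^*.

Definition push (R : realType) (E E' : lmodType R) (T : E -> E')
    (mu : set E -> R[i]) (A : set E') : R[i] :=
  if `[< il_measurable A >] then mu (T @^-1` A) else 0.

(* Measures on [V], regarded as measures on [E] concentrated on [V]; for [V]
   finite dimensional, the trace on [V] of the Borel sigma-algebra of [E] is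
   the usual Borel sigma-algebra of [V]. *)
Definition meas_on (R : realType) (E : lmodType R) (V : set E) :
    set (set E -> R[i]) :=
  [set mu | cmeasure mu /\
    forall A, il_measurable A -> mu A = mu (A `&` V)].

Definition discrete (R : realType) (E : lmodType R) (mu : set E -> R[i]) : Prop :=
  exists2 D : set E, countable D &
    forall A, il_measurable A -> mu A = mu (A `&` D).

Definition atomless (R : realType) (E : lmodType R) (mu : set E -> R[i]) : Prop :=
  forall f : E, mu [set f] = 0.

(* Haar measures of the additive group [V], seen as measures on [E]. *)
Definition haar_on (R : realType) (E : lmodType R) (V : set E)
    (lam : {measure set (ilBorel E) -> \bar R}) : Prop :=
  [/\ lam (~` V) = 0%E,
      (0 < lam V)%E,
      exists U : set E, [/\ il_open U, U 0 & (lam U < +oo)%E] &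
      forall v A, V v -> il_measurable A ->
        lam [set x : E | A (v + x)] = lam A].

Definition abs_continuous (R : realType) (E : lmodType R) (V : set E)
    (mu : set E -> R[i]) : Prop :=
  forall lam : {measure set (ilBorel E) -> \bar R}, haar_on V lam ->
    forall A, il_measurable A -> lam A = 0%E -> mu A = 0.

Definition tv_closure (R : realType) (E : lmodType R)
    (S : set (set E -> R[i])) : set (set E -> R[i]) :=
  [set mu | cmeasure mu /\
    forall e : R, 0 < e -> exists2 nu, S nu & tvnorm (mu - nu) < e].

Definition M_fin (R : realType) (E : lmodType R) : set (set E -> R[i]) :=
  \bigcup_(V in @findim_subspace R E) meas_on V.

Definition ME (R : realType) (E : lmodType R) : set (set E -> R[i]) :=
  tv_closure (@M_fin R E).

Definition ME_d (R : realType) (E : lmodType R) : set (set E -> R[i]) :=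
  tv_closure (\bigcup_(V in @findim_subspace R E)
    (meas_on V `&` @discrete R E)).

Definition ME_c (R : realType) (E : lmodType R) : set (set E -> R[i]) :=
  tv_closure (\bigcup_(V in @findim_subspace R E)
    (meas_on V `&` @atomless R E)).

Definition M_a (R : realType) (E : lmodType R) (V : set E) :
    set (set E -> R[i]) :=
  meas_on V `&` abs_continuous V.

Definition ME_df (R : realType) (E : lmodType R) : set (set E -> R[i]) :=
  [set mu | exists (n : nat) (a : 'I_n -> R[i]) (f : 'I_n -> E),
    mu = \sum_(i < n) a i *: @point_measure R E (f i)].

Definition M_moment (R : realType) (E : lmodType R) (kappa : E -> R) (n : nat) :
    set (set E -> R[i]) :=
  [set mu | ME mu /\ forall m, (m <= n)%N ->
    (\int[tv mu]_f (kappa f ^+ m)%:E < +oo)%E].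

Definition M_moment_infty (R : realType) (E : lmodType R) (kappa : E -> R) :
    set (set E -> R[i]) :=
  [set mu | ME mu /\ forall m : nat,
    (\int[tv mu]_f (kappa f ^+ m)%:E < +oo)%E].

(* A |-> int dmu(f) int dnu(g) w(f,g) 1_A(f+g) *)
Definition twisted_conv (R : realType) (E : lmodType R) (w : E -> E -> R[i])
    (mu nu : set E -> R[i]) (A : set E) : R[i] :=
  if `[< il_measurable A >] then
    cint mu (fun f => cint nu (fun g => w f g * (\1_A (f + g) : R)%:C))
  else 0.

Definition expi (R : realType) (t : R) : R[i] := cos t +i* sin t.

Definition star_fin (R : realType) (E : lmodType R) (sigma : {biscalar E})
    (h : R) (mu nu : set E -> R[i]) : set E -> R[i] :=
  twisted_conv (fun f g => expi (- (h / 2 * sigma f g))) mu nu.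

Definition tv_cvg (R : realType) (E : lmodType R) (u : nat -> set E -> R[i])
    (mu : set E -> R[i]) : Prop :=
  (fun n => tvnorm (u n - mu)) @ \oo --> (0 : R).

(* The continuous extension of [star_fin] from [M_fin E] to [ME E]. *)
Definition star (R : realType) (E : lmodType R) (sigma : {biscalar E})
    (h : R) (mu nu : set E -> R[i]) : set E -> R[i] :=
  xget 0 [set rho | ME rho /\
    forall u v : nat -> set E -> R[i],
      (forall n, M_fin (u n)) -> (forall n, M_fin (v n)) ->
      tv_cvg u mu -> tv_cvg v nu ->
      tv_cvg (fun n => star_fin sigma h (u n) (v n)) rho].

Definition bracket0 (R : realType) (E : lmodType R) (sigma : {biscalar E})
    (mu nu : set E -> R[i]) : set E -> R[i] :=
  twisted_conv (fun f g => (sigma f g)%:C) mu nu.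

Definition csubspace (R : realType) (V : lmodType R[i]) (S : set V) : Prop :=
  S 0 /\ forall (a : R[i]) x y, S x -> S y -> S (a *: x + y).

Record star_algebra_axioms (R : realType) (V : lmodType R[i]) (S : set V)
    (mul : V -> V -> V) (inv : V -> V) : Prop := StarAlgebraAxioms {
  sa_subspace : csubspace S;
  sa_mul : forall x y, S x -> S y -> S (mul x y);
  sa_inv : forall x, S x -> S (inv x);
  sa_mulA : forall x y z, S x -> S y -> S z ->
    mul x (mul y z) = mul (mul x y) z;
  sa_mull : forall (a : R[i]) x y z, S x -> S y -> S z ->
    mul (a *: x + y) z = a *: mul x z + mul y z;
  sa_mulr : forall (a : R[i]) x y z, S x -> S y -> S z ->
    mul z (a *: x + y) = a *: mul z x + mul z y;
  sa_invK : forall x, S x -> inv (inv x) = x;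
  sa_inv_lin : forall (a : R[i]) x y, S x -> S y ->
    inv (a *: x + y) = a^* *: inv x + inv y;
  sa_invM : forall x y, S x -> S y -> inv (mul x y) = mul (inv y) (inv x) }.

(* Raw data of a normed *-algebra carried by a subset of a vector space. *)
Record normed_star_data (R : realType) (V : lmodType R[i]) := NormedStarData {
  ns_carrier : set V;
  ns_mul : V -> V -> V;
  ns_star : V -> V;
  ns_norm : V -> R }.

Record banach_star_algebra (R : realType) (V : lmodType R[i])
    (X : normed_star_data V) : Prop := BanachStarAlgebra {
  bs_alg : star_algebra_axioms (ns_carrier X) (ns_mul X) (ns_star X);
  bs_norm_ge0 : forall x, ns_carrier X x -> 0 <= ns_norm X x;
  bs_norm_eq0 : forall x, ns_carrier X x -> ns_norm X x = 0 -> x = 0;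
  bs_normZ : forall (a : R[i]) x, ns_carrier X x ->
    ns_norm X (a *: x) = Normc.normc a * ns_norm X x;
  bs_normD : forall x y, ns_carrier X x -> ns_carrier X y ->
    ns_norm X (x + y) <= ns_norm X x + ns_norm X y;
  bs_normM : forall x y, ns_carrier X x -> ns_carrier X y ->
    ns_norm X (ns_mul X x y) <= ns_norm X x * ns_norm X y;
  bs_norm_star : forall x, ns_carrier X x ->
    ns_norm X (ns_star X x) = ns_norm X x;
  bs_complete : forall u : nat -> V, (forall n, ns_carrier X (u n)) ->
    (forall e : R, 0 < e -> exists N, forall m n, (N <= m)%N -> (N <= n)%N ->
      ns_norm X (u m - u n) < e) ->
    exists2 x, ns_carrier X x &
      (fun n => ns_norm X (u n - x)) @ \oo --> (0 : R) }.

Definition sub_star_algebra (R : realType) (V : lmodType R[i])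
    (X : normed_star_data V) (S : set V) : Prop :=
  [/\ S `<=` ns_carrier X, csubspace S,
      forall x y, S x -> S y -> S (ns_mul X x y) &
      forall x, S x -> S (ns_star X x)].

Definition scaled_commutator (R : realType) (V : lmodType R[i])
    (X : normed_star_data V) (h : R) (x y : V) : V :=
  ('i / h%:C) *: (ns_mul X x y - ns_mul X y x).

Record poisson_data (R : realType) (V : lmodType R[i]) := PoissonData {
  pd_carrier : set V;
  pd_mul : V -> V -> V;
  pd_star : V -> V;
  pd_bracket : V -> V -> V }.

Record poisson_algebra (R : realType) (V : lmodType R[i])
    (P : poisson_data V) : Prop := PoissonAlgebra {
  pa_alg : star_algebra_axioms (pd_carrier P) (pd_mul P) (pd_star P);
  pa_mulC : forall x y, pd_carrier P x -> pd_carrier P y ->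
    pd_mul P x y = pd_mul P y x;
  pa_bracket : forall x y, pd_carrier P x -> pd_carrier P y ->
    pd_carrier P (pd_bracket P x y);
  pa_bracket_lin : forall (a : R[i]) x y z,
    pd_carrier P x -> pd_carrier P y -> pd_carrier P z ->
    pd_bracket P (a *: x + y) z = a *: pd_bracket P x z + pd_bracket P y z;
  pa_bracketC : forall x y, pd_carrier P x -> pd_carrier P y ->
    pd_bracket P x y = - pd_bracket P y x;
  pa_bracket_real : forall x y, pd_carrier P x -> pd_carrier P y ->
    pd_star P (pd_bracket P x y) = pd_bracket P (pd_star P x) (pd_star P y);
  pa_jacobi : forall x y z,
    pd_carrier P x -> pd_carrier P y -> pd_carrier P z ->
    pd_bracket P x (pd_bracket P y z) + pd_bracket P y (pd_bracket P z x)
      + pd_bracket P z (pd_bracket P x y) = 0;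
  pa_leibniz : forall x y z,
    pd_carrier P x -> pd_carrier P y -> pd_carrier P z ->
    pd_bracket P x (pd_mul P y z)
      = pd_mul P (pd_bracket P x y) z + pd_mul P y (pd_bracket P x z) }.

(* [sdq_Q0] and [sdq_Q0_alg] say that [Q 0] is the identical embedding of the
   *-algebra [P] into the algebra at [h = 0]. *)
Record strict_deformation_quantization (R : realType) (W : R -> lmodType R[i])
    (P : poisson_data (W 0)) (A : forall h : R, normed_star_data (W h))
    (Q : forall h : R, W 0 -> W h) : Prop := StrictDeformationQuantization {
  sdq_poisson : poisson_algebra P;
  sdq_banach : forall h, banach_star_algebra (A h);
  sdq_maps : forall h x, pd_carrier P x -> ns_carrier (A h) (Q h x);
  sdq_linear : forall h (a : R[i]) x y, pd_carrier P x -> pd_carrier P y ->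
    Q h (a *: x + y) = a *: Q h x + Q h y;
  sdq_star : forall h x, pd_carrier P x ->
    Q h (pd_star P x) = ns_star (A h) (Q h x);
  sdq_Q0 : forall x, pd_carrier P x -> Q 0 x = x;
  sdq_Q0_alg : forall x y, pd_carrier P x -> pd_carrier P y ->
    pd_mul P x y = ns_mul (A 0) x y;
  sdq_dirac : forall x y, pd_carrier P x -> pd_carrier P y ->
    ns_norm (A h) (scaled_commutator (A h) h (Q h x) (Q h y)
                   - Q h (pd_bracket P x y)) @[h --> 0^'] --> (0 : R);
  sdq_von_neumann : forall x y, pd_carrier P x -> pd_carrier P y ->
    ns_norm (A h) (ns_mul (A h) (Q h x) (Q h y) - Q h (pd_mul P x y))
      @[h --> 0^'] --> (0 : R);
  sdq_rieffel : forall x, pd_carrier P x ->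
    continuous (fun h : R => ns_norm (A h) (Q h x));
  sdq_injective : forall h x y, pd_carrier P x -> pd_carrier P y ->
    Q h x = Q h y -> x = y;
  sdq_image : forall h, sub_star_algebra (A h) (Q h @` pd_carrier P) }.

Record poisson_morphism (R : realType) (V V' : lmodType R[i])
    (P : poisson_data V) (P' : poisson_data V') (phi : V -> V') : Prop :=
  PoissonMorphism {
  pm_maps : forall x, pd_carrier P x -> pd_carrier P' (phi x);
  pm_linear : forall (a : R[i]) x y, pd_carrier P x -> pd_carrier P y ->
    phi (a *: x + y) = a *: phi x + phi y;
  pm_star : forall x, pd_carrier P x -> phi (pd_star P x) = pd_star P' (phi x);
  pm_mul : forall x y, pd_carrier P x -> pd_carrier P y ->
    phi (pd_mul P x y) = pd_mul P' (phi x) (phi y);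
  pm_bracket : forall x y, pd_carrier P x -> pd_carrier P y ->
    phi (pd_bracket P x y) = pd_bracket P' (phi x) (phi y) }.

Record banach_star_morphism (R : realType) (V V' : lmodType R[i])
    (X : normed_star_data V) (X' : normed_star_data V') (phi : V -> V') : Prop :=
  BanachStarMorphism {
  bm_maps : forall x, ns_carrier X x -> ns_carrier X' (phi x);
  bm_linear : forall (a : R[i]) x y, ns_carrier X x -> ns_carrier X y ->
    phi (a *: x + y) = a *: phi x + phi y;
  bm_star : forall x, ns_carrier X x -> phi (ns_star X x) = ns_star X' (phi x);
  bm_mul : forall x y, ns_carrier X x -> ns_carrier X y ->
    phi (ns_mul X x y) = ns_mul X' (phi x) (phi y);
  bm_norm : forall x, ns_carrier X x -> ns_norm X' (phi x) <= ns_norm X x }.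

Record quantization_morphism (R : realType) (W W' : R -> lmodType R[i])
    (P : poisson_data (W 0)) (A : forall h : R, normed_star_data (W h))
    (Q : forall h : R, W 0 -> W h)
    (P' : poisson_data (W' 0)) (A' : forall h : R, normed_star_data (W' h))
    (Q' : forall h : R, W' 0 -> W' h)
    (phi : forall h : R, W h -> W' h) : Prop := QuantizationMorphism {
  qm_poisson : poisson_morphism P P' (phi 0);
  qm_banach : forall h, banach_star_morphism (A h) (A' h) (phi h);
  qm_Q : forall h x, pd_carrier P x -> phi h (Q h x) = Q' h (phi 0 x) }.

Definition measure_space (R : realType) (E : lmodType R) : lmodType R[i] :=
  (set E -> R[i]) : lmodType R[i].

Definition measure_algebra (R : realType) (E : lmodType R)
    (sigma : {biscalar E}) (h : R) : normed_star_data (measure_space E) :=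
  @NormedStarData R (measure_space E) (@ME R E) (star sigma h)
    (@measure_star R E) (@tvnorm R E).

Definition measure_poisson (R : realType) (E : lmodType R)
    (sigma : {biscalar E}) (P : set (set E -> R[i])) :
    poisson_data (measure_space E) :=
  @PoissonData R (measure_space E) P (star sigma 0)
    (@measure_star R E) (bracket0 sigma).

Definition QB (R : realType) (E : lmodType R) (h : R) :
    measure_space E -> measure_space E := idfun.

Inductive seminorm_choice (R : realType) (E : lmodType R) : Type :=
| SingleSeminorm (kappa : E -> R)
| SeminormFamily (B : Type) (kappa : B -> E -> R).

Definition choice_index (R : realType) (E : lmodType R)
    (s : seminorm_choice E) : Type :=
  match s with SingleSeminorm _ => unit | @SeminormFamily _ _ B _ => B end.

Definition choice_family (R : realType) (E : lmodType R)
    (s : seminorm_choice E) : choice_index s -> E -> R :=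
  match s return choice_index s -> E -> R with
  | SingleSeminorm kappa => fun _ => kappa
  | SeminormFamily _ kappa => kappa
  end.

Definition choice_space (R : realType) (E : lmodType R)
    (s : seminorm_choice E) : set (set E -> R[i]) :=
  match s with
  | SingleSeminorm kappa => M_moment_infty kappa
  | SeminormFamily _ kappa => \bigcap_b M_moment_infty (kappa b)
  end.

(* A repetition in the finite list [G] only changes the constants [c]. *)
Definition choice_admissible (R : realType) (E : lmodType R)
    (vs : E -> R) (s : seminorm_choice E) : Prop :=
  match s with
  | SingleSeminorm kappa =>
      seminorm kappa /\ (stronger kappa vs \/ equivalent_seminorms kappa vs)
  | @SeminormFamily _ _ B kappa =>
      (forall b, seminorm (kappa b)) /\
      exists (G : seq B) (c : B -> R), (forall b, 0 < c b) /\
        forall f, vs f <= \sum_(b <- G) c b * kappa b f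
  end.

Inductive poisson_type (R : realType) (E : lmodType R) : Type :=
| TypeBase (s : seminorm_choice E)
| TypeDiscrete (s : seminorm_choice E)
| TypeContinuous (s : seminorm_choice E)
| TypeAbsCont (V : set E) (s : seminorm_choice E)
| TypeFinite.

Definition poisson_space (R : realType) (E : lmodType R)
    (t : poisson_type E) : set (set E -> R[i]) :=
  match t with
  | TypeBase s => choice_space s
  | TypeDiscrete s => @ME_d R E `&` choice_space s
  | TypeContinuous s => @ME_c R E `&` choice_space s
  | TypeAbsCont V s => M_a V `&` choice_space s
  | TypeFinite => @ME_df R E
  end.

Definition type_admissible (R : realType) (E : lmodType R)
    (vs : E -> R) (t : poisson_type E) : Prop :=
  match t with
  | TypeBase s | TypeDiscrete s | TypeContinuous s => choice_admissible vs s
  | TypeAbsCont V s => findim_subspace V /\ choice_admissible vs s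
  | TypeFinite => True
  end.

Definition bounded_for (R : realType) (E E' : lmodType R) (T : E -> E')
    (s : seminorm_choice E) (s' : seminorm_choice E') : Prop :=
  forall b' : choice_index s',
    exists (G : seq (choice_index s)) (c : choice_index s -> R),
      (forall b, 0 <= c b) /\
      forall f, choice_family b' (T f) <= \sum_(b <- G) c b * choice_family b f.

(* Morphisms of pre-symplectic spaces with chosen Poisson algebras. Injectivity
   is what keeps push-forwards of atomless measures atomless. *)
Definition type_map (R : realType) (E E' : lmodType R) (T : E -> E')
    (t : poisson_type E) (t' : poisson_type E') : Prop :=
  match t, t' with
  | TypeBase s, TypeBase s' => bounded_for T s s'
  | TypeDiscrete s, TypeDiscrete s' => bounded_for T s s'
  | TypeContinuous s, TypeContinuous s' => injective T /\ bounded_for T s s'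
  | TypeAbsCont V s, TypeAbsCont V' s' => T @` V = V' /\ bounded_for T s s'
  | TypeFinite, TypeFinite => True
  | _, _ => False
  end.

(* Main.v *)
(* A measure in [ME] is concentrated on the span [cspan e] of a sequence: it is
   a limit of a sequence of measures on finite dimensional subspaces, and
   conversely a measure on [cspan e] is approximated by its restrictions to the
   spans of the first vectors. On such a span the finest locally convex topology
   is tame enough for addition and [sigma] to be jointly measurable, so measures
   can be written as densities with respect to finite positive measures
   (Radon-Nikodym), twisted convolutions as densities with respect to product
   measures, and all identities of the algebras follow from Fubini's theorem.
   Kernels bounded by submultiplicative weights take care of the moments.

   The kernel of [star h] has modulus one; hence [star_fin] is already
   continuous on [ME], where it coincides with its extension [star]. The kernel
   of the scaled commutator is [(2 / h) sin (h sigma / 2)], which is dominated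
   by [|sigma|] and tends to [sigma]; both limits [h -> 0] are therefore
   instances of dominated convergence.

   For the functoriality of the absolutely continuous measures one lifts a Haar
   measure on [T @` V] to [V]: transport it by a linear section of [T], then
   adjoin vectors of the kernel one by one, taking products with Lebesgue
   measure. *)

Require Import Defs.
From HB Require Import structures.
From mathcomp Require Import all_boot all_order all_algebra.
From mathcomp Require Import all_classical all_reals all_analysis.
From mathcomp Require Import measurable_realfun.
From mathcomp Require Import complex sesquilinear.
From mathcomp Require Import ring lra zify.

Import Order.TTheory GRing.Theory Num.Theory numFieldNormedType.Exports.

Set Implicit Arguments.
Unset Strict Implicit.
Unset Printing Implicit Defensive.

Local Open Scope classical_set_scope.
Local Open Scope complex_scope.
Local Open Scope ring_scope.

(** Two features of the statement shape the proof. Its integrals are taken against the set functions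
    [tv] and [pos_part], which agree with measures only on measurable sets, and the integrands are
    often inner integrals, which are controlled only on a countable span. Integrals are therefore
    compared without any measurability of the integrand off the span.

    Densities live on an auxiliary space with a map into [E]: twisted convolutions, involution and
    push-forward then have explicit representations. Such a representation bounds the total
    variation from above only, because mass may cancel along the fibres of the map. For the lower
    bound one returns to a density [u] on [E] itself, where the variation has density [|u|].

    Under a common triple integral, associativity is the cocycle identity of [sigma], the Leibniz
    rule its additivity, and the Jacobi identity a consequence of antisymmetry. The Poisson algebras
    are treated uniformly by separating moment conditions from conditions on carriers and null sets,
    the latter being stable under every admissible kernel. *)

Local Notation normc := Normc.normc.

(** * Complex-valued integrals *)

Section ComplexParts.
Context (R : realType).
Implicit Types x y z : R[i].

Lemma eq_ReIm x y : complex.Re x = complex.Re y -> complex.Im x = complex.Im y -> x = y.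
Proof. by case: x => a b; case: y => c d /= -> ->. Qed.

Lemma ReCD x y : complex.Re (x + y) = complex.Re x + complex.Re y.
Proof. by case: x; case: y. Qed.
Lemma ImCD x y : complex.Im (x + y) = complex.Im x + complex.Im y.
Proof. by case: x; case: y. Qed.
Lemma ReCN x : complex.Re (- x) = - complex.Re x. Proof. by case: x. Qed.
Lemma ImCN x : complex.Im (- x) = - complex.Im x. Proof. by case: x. Qed.
Lemma ReCM x y : complex.Re (x * y) =
  complex.Re x * complex.Re y - complex.Im x * complex.Im y.
Proof. by case: x; case: y. Qed.
Lemma ImCM x y : complex.Im (x * y) =
  complex.Re x * complex.Im y + complex.Im x * complex.Re y.
Proof. by case: x; case: y. Qed.
Lemma ReCJ x : complex.Re x^* = complex.Re x. Proof. by case: x. Qed.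
Lemma ImCJ x : complex.Im x^* = - complex.Im x. Proof. by case: x. Qed.
Definition reimE := (ReCD, ImCD, ReCN, ImCN, ReCM, ImCM, ReCJ, ImCJ).

Lemma normcE2 x : normc x = Num.sqrt (complex.Re x ^+ 2 + complex.Im x ^+ 2).
Proof. by case: x. Qed.
Lemma normc_ge0 x : 0 <= normc x. Proof. by rewrite normcE2 sqrtr_ge0. Qed.
Lemma normcR (a : R) : normc a%:C = `|a|.
Proof. by rewrite normcE2 /= expr0n addr0 sqrtr_sqr. Qed.
Lemma normcJ_ x : normc x^* = normc x.
Proof. by rewrite !normcE2 !reimE sqrrN. Qed.
Lemma normcD x y : normc (x + y) <= normc x + normc y.
Proof. exact: le_normcD. Qed.
Lemma normcNN x : normc (- x) = normc x.
Proof. exact: (@normcN _ (x : Rcomplex R)). Qed.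
Lemma normcBC x y : normc (x - y) = normc (y - x).
Proof. by rewrite -normcNN opprB. Qed.
Lemma normc_Re x : `|complex.Re x| <= normc x.
Proof.
by rewrite -sqrtr_sqr normcE2 ler_sqrt ?addr_ge0 ?sqr_ge0// lerDl sqr_ge0.
Qed.
Lemma normc_Im x : `|complex.Im x| <= normc x.
Proof.
by rewrite -sqrtr_sqr normcE2 ler_sqrt ?addr_ge0 ?sqr_ge0// lerDr sqr_ge0.
Qed.
Lemma normc_le x : normc x <= `|complex.Re x| + `|complex.Im x|.
Proof.
rewrite normcE2 -[leRHS]ger0_norm ?addr_ge0// -sqrtr_sqr ler_sqrt ?sqr_ge0//.
rewrite sqrrD !real_normK ?num_real// lerD2r lerDl.
by rewrite mulrn_wge0// mulr_ge0.
Qed.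
Lemma normc_eq0P x : normc x = 0 -> x = 0.
Proof. exact: Normc.eq0_normc. Qed.
Lemma normc_sum I (r : seq I) (F : I -> R[i]) :
  normc (\sum_(i <- r) F i) <= \sum_(i <- r) normc (F i).
Proof.
elim: r => [|i r IH]; first by rewrite !big_nil Normc.normc0.
by rewrite !big_cons (le_trans (normcD _ _))// lerD2l.
Qed.
Lemma Re_sumC I (r : seq I) (F : I -> R[i]) :
  complex.Re (\sum_(i <- r) F i) = \sum_(i <- r) complex.Re (F i).
Proof.
elim: r => [|i r IH]; first by rewrite !big_nil.
by rewrite !big_cons ReCD IH.
Qed.
Lemma Im_sumC I (r : seq I) (F : I -> R[i]) :
  complex.Im (\sum_(i <- r) F i) = \sum_(i <- r) complex.Im (F i).
Proof.
elim: r => [|i r IH]; first by rewrite !big_nil.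
by rewrite !big_cons ImCD IH.
Qed.
End ComplexParts.

Section ComplexMeasurable.
Context d (T : measurableType d) (R : realType).
Implicit Types h k : T -> R[i].

Definition cmf h := measurable_fun setT (fun t => complex.Re (h t)) /\
  measurable_fun setT (fun t => complex.Im (h t)).

Lemma cmf_cst c : cmf (fun=> c).
Proof. by split; exact: measurable_cst. Qed.
Lemma cmfD h k : cmf h -> cmf k -> cmf (fun t => h t + k t).
Proof.
move=> [h1 h2] [k1 k2]; split.
  by under eq_fun do rewrite ReCD; exact: measurable_funD.
by under eq_fun do rewrite ImCD; exact: measurable_funD.
Qed.
Lemma cmfN h : cmf h -> cmf (fun t => - h t).
Proof.
move=> [h1 h2]; split.
  by under eq_fun do rewrite ReCN; exact: measurableT_comp.
by under eq_fun do rewrite ImCN; exact: measurableT_comp.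
Qed.
Lemma cmfB h k : cmf h -> cmf k -> cmf (fun t => h t - k t).
Proof. by move=> hm km; apply: cmfD => //; exact: cmfN. Qed.
Lemma cmfM h k : cmf h -> cmf k -> cmf (fun t => h t * k t).
Proof.
move=> [h1 h2] [k1 k2]; split.
  under eq_fun do rewrite ReCM.
  by apply: measurable_funB; exact: measurable_funM.
under eq_fun do rewrite ImCM.
by apply: measurable_funD; exact: measurable_funM.
Qed.
Lemma cmfJ h : cmf h -> cmf (fun t => (h t)^*).
Proof.
move=> [h1 h2]; split.
  by under eq_fun do rewrite ReCJ.
by under eq_fun do rewrite ImCJ; exact: measurableT_comp.
Qed.
Lemma cmf_real (f : T -> R) : measurable_fun setT f -> cmf (fun t => (f t)%:C).
Proof. by move=> mf; split => //=; exact: measurable_cst. Qed.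
Lemma cmf_normc h : cmf h -> measurable_fun setT (fun t => normc (h t)).
Proof.
move=> [h1 h2]; under eq_fun do rewrite normcE2.
apply: (@measurableT_comp _ _ _ _ _ _ (Num.sqrt : R -> R)).
  by apply: continuous_measurable_fun; exact: sqrt_continuous.
by apply: measurable_funD; exact: measurable_funX.
Qed.
End ComplexMeasurable.

Lemma cmf_comp d (T : measurableType d) d' (T' : measurableType d')
    (R : realType) (h : T' -> R[i]) (phi : T -> T') :
  cmf h -> measurable_fun setT phi -> cmf (fun t => h (phi t)).
Proof.
by move=> [h1 h2] mphi; split;
  [exact: (measurableT_comp h1 mphi)|exact: (measurableT_comp h2 mphi)].
Qed.

Section ComplexIntegral.
Context d (T : measurableType d) (R : realType).
Variable pi : {measure set T -> \bar R}.
Implicit Types (h k : T -> R[i]) (g : T -> R).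

Definition cintegrable h := pi.-integrable setT (fun t => (complex.Re (h t))%:E) /\
  pi.-integrable setT (fun t => (complex.Im (h t))%:E).

Definition Cint h : R[i] := (Rintegral pi setT (fun t => complex.Re (h t))) +i*
  (Rintegral pi setT (fun t => complex.Im (h t))).

Definition rintegrable g := pi.-integrable setT (fun t => (g t)%:E).

Lemma cintegrable_cmf h : cintegrable h -> cmf h.
Proof. by move=> [/measurable_int/measurable_EFinP ? /measurable_int/measurable_EFinP ?]. Qed.

Lemma rintegrable_mf g : rintegrable g -> measurable_fun setT g.
Proof. by move=> /measurable_int/measurable_EFinP. Qed.

Lemma rintegrable_le g g' : measurable_fun setT g -> rintegrable g' ->
  (forall t, `|g t| <= g' t) -> rintegrable g.
Proof.
move=> mg ig' gg'; apply: le_integrable ig' => //; first exact/measurable_EFinP.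
by move=> t _; rewrite /= lee_fin (le_trans (gg' t))// ler_norm.
Qed.

Lemma rintegrableD g g' : rintegrable g -> rintegrable g' ->
  rintegrable (fun t => g t + g' t).
Proof. by move=> ig ig'; have := integrableD measurableT ig ig'. Qed.

Lemma rintegrableZ c g : rintegrable g -> rintegrable (fun t => c * g t).
Proof. by move=> ig; have := integrableZl measurableT c ig. Qed.

Lemma cintegrable_le h g : cmf h -> rintegrable g ->
  (forall t, normc (h t) <= g t) -> cintegrable h.
Proof.
move=> [h1 h2] ig hg; split; apply: (rintegrable_le _ ig) => // t.
  exact: le_trans (normc_Re _) (hg t).
exact: le_trans (normc_Im _) (hg t).
Qed.

Lemma cintegrable_normc h : cintegrable h -> rintegrable (fun t => normc (h t)).
Proof.
move=> hi; have hm := cintegrable_cmf hi; case: hi => h1 h2.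
have := rintegrableD (integrable_norm h1) (integrable_norm h2).
move=> /(rintegrable_le (cmf_normc hm)); apply => t.
by rewrite ger0_norm ?normc_ge0//; exact: normc_le.
Qed.

Lemma cintegrableD h k : cintegrable h -> cintegrable k ->
  cintegrable (fun t => h t + k t).
Proof.
move=> hi ki; apply: (@cintegrable_le _ (fun t => normc (h t) + normc (k t))).
- by apply: cmfD; exact: cintegrable_cmf.
- by apply: rintegrableD; exact: cintegrable_normc.
- by move=> t; exact: normcD.
Qed.

Lemma cintegrableZ c h : cintegrable h -> cintegrable (fun t => c * h t).
Proof.
move=> hi; apply: (@cintegrable_le _ (fun t => normc c * normc (h t))).
- by apply: cmfM; [exact: cmf_cst|exact: cintegrable_cmf].
- by apply: rintegrableZ; exact: cintegrable_normc.
- by move=> t; rewrite Normc.normcM.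
Qed.

Lemma eq_Cint h k : (forall t, h t = k t) -> Cint h = Cint k.
Proof. by move=> /funext ->. Qed.

Lemma Cint0 : Cint (fun=> 0) = 0.
Proof. by rewrite /Cint /= /Rintegral integral0. Qed.

Lemma CintD h k : cintegrable h -> cintegrable k ->
  Cint (fun t => h t + k t) = Cint h + Cint k.
Proof.
move=> [h1 h2] [k1 k2]; apply: eq_ReIm; rewrite !reimE /=.
  by under eq_Rintegral do rewrite ReCD; rewrite RintegralD.
by under eq_Rintegral do rewrite ImCD; rewrite RintegralD.
Qed.

Lemma CintZ c h : cintegrable h -> Cint (fun t => c * h t) = c * Cint h.
Proof.
move=> [h1 h2]; apply: eq_ReIm; rewrite !reimE /=.
  under eq_Rintegral do rewrite ReCM.
  by rewrite RintegralB ?RintegralZl//;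
    [exact: (rintegrableZ _ h1)|exact: (rintegrableZ _ h2)].
under eq_Rintegral do rewrite ImCM.
by rewrite RintegralD ?RintegralZl//;
  [exact: (rintegrableZ _ h2)|exact: (rintegrableZ _ h1)].
Qed.

Lemma CintJ h : cintegrable h -> Cint (fun t => (h t)^*) = (Cint h)^*.
Proof.
move=> [h1 h2]; apply: eq_ReIm; rewrite !reimE /=.
  by under eq_Rintegral do rewrite ReCJ.
under eq_Rintegral do rewrite ImCJ -mulN1r.
by rewrite RintegralZl// mulN1r.
Qed.

(* With [z] the integral and [n = |z|], [n ^ 2 = int (Re z Re h + Im z Im h)],
   which is at most [int n |h|] by Cauchy-Schwarz. *)
Lemma normc_Cint h : cintegrable h ->
  normc (Cint h) <= Rintegral pi setT (fun t => normc (h t)).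
Proof.
move=> hi; have [h1 h2] := hi; set z := Cint h.
have [->|z0] := eqVneq (normc z) 0; first exact/Rintegral_ge0/(fun t _ => normc_ge0 _).
have zp : 0 < normc z by rewrite lt_neqAle eq_sym z0 normc_ge0.
have i1 : rintegrable (fun t => complex.Re z * complex.Re (h t)).
  exact: (rintegrableZ _ h1).
have i2 : rintegrable (fun t => complex.Im z * complex.Im (h t)).
  exact: (rintegrableZ _ h2).
have i3 := cintegrable_normc hi.
have E : normc z ^+ 2 = Rintegral pi setT (fun t =>
    complex.Re z * complex.Re (h t) + complex.Im z * complex.Im (h t)).
  by rewrite RintegralD// !RintegralZl// normcE2 sqr_sqrtr ?addr_ge0 ?sqr_ge0// !expr2.
rewrite -(ler_pM2l zp) -expr2 E -RintegralZl//.
apply: le_Rintegral => //; first exact: (rintegrableD i1 i2).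
  exact: (rintegrableZ _ i3).
move=> t _; apply: (@le_trans _ _ (complex.Re (z^* * h t))).
  by rewrite !reimE mulNr opprK.
apply: le_trans (ler_norm _) _; apply: le_trans (normc_Re _) _.
by rewrite Normc.normcM normcJ_.
Qed.

Lemma rintegrable_lty g : (forall t, 0 <= g t) -> measurable_fun setT g ->
  (\int[pi]_t (g t)%:E < +oo)%E -> rintegrable g.
Proof.
move=> g0 mg ig; apply/integrableP; split; first exact/measurable_EFinP.
by under eq_integral do rewrite gee0_abs ?lee_fin//.
Qed.

End ComplexIntegral.

Arguments Cint {d T R} pi h.
Arguments cintegrable {d T R} pi h.
Arguments rintegrable {d T R} pi g.

(** * Fubini's theorem for complex kernels dominated by products *)

Section ComplexFubini.
Context d1 d2 (T1 : measurableType d1) (T2 : measurableType d2) (R : realType).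
Variables (pi : {sigma_finite_measure set T1 -> \bar R})
  (rho : {sigma_finite_measure set T2 -> \bar R}).

(** By Tonelli the double integral factors. Such products serve as dominating functions whenever
    Fubini's theorem is applied below. *)
Lemma rintegrable_prod (a : T1 -> R) (b : T2 -> R) :
  (forall t, 0 <= a t) -> (forall t, 0 <= b t) ->
  rintegrable pi a -> rintegrable rho b ->
  rintegrable (pi \x rho)%E (fun t => a t.1 * b t.2).
Proof.
move=> a0 b0 ia ib; have ma := rintegrable_mf ia; have mb := rintegrable_mf ib.
have mab : measurable_fun [set: T1 * T2] (fun t => a t.1 * b t.2).
  by apply: measurable_funM;
    [exact: (measurableT_comp ma measurable_fst)|exact: (measurableT_comp mb measurable_snd)].
apply: rintegrable_lty => //; first by move=> t; rewrite mulr_ge0.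
rewrite fubini_tonelli1//; last 2 first.
- exact/measurable_EFinP.
- by move=> t; rewrite lee_fin mulr_ge0.
rewrite /fubini_F /=.
under eq_integral => x _.
  under eq_integral do rewrite EFinM.
  rewrite ge0_integralZl//; first over.
  - exact/measurable_EFinP.
  - by move=> y _; rewrite lee_fin.
  - by rewrite lee_fin.
rewrite ge0_integralZr//.
- have := integrable_lty measurableT ia; have := integrable_lty measurableT ib => /= fb fa.
  rewrite lte_mul_pinfty//; first by apply: integral_ge0 => t _; rewrite lee_fin.
  by rewrite ge0_fin_numE//; apply: integral_ge0 => t _; rewrite lee_fin.
- exact/measurable_EFinP.
- by move=> y _; rewrite lee_fin.
- by apply: integral_ge0 => y _; rewrite lee_fin.
Qed.

Variables (h : T1 * T2 -> R[i]) (a : T1 -> R) (b : T2 -> R).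
Hypotheses (hm : cmf h) (ia : rintegrable pi a) (ib : rintegrable rho b)
  (hab : forall x y, normc (h (x, y)) <= a x * b y)
  (a0 : forall t, 0 <= a t) (b0 : forall t, 0 <= b t).

Lemma cintegrable_prod : cintegrable (pi \x rho)%E h.
Proof.
apply: (cintegrable_le hm (rintegrable_prod a0 b0 ia ib)).
by case.
Qed.

Lemma cintegrable_pair1 x : cintegrable rho (fun y => h (x, y)).
Proof.
apply: (cintegrable_le _ (rintegrableZ (a x) ib)) => //.
exact: (cmf_comp (phi := pair x) hm).
Qed.

Lemma cintegrable_pair2 y : cintegrable pi (fun x => h (x, y)).
Proof.
apply: (cintegrable_le _ (rintegrableZ (b y) ia)) => // [|t].
  exact: (cmf_comp (phi := fun x => (x, y)) hm).
by rewrite mulrC.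
Qed.

Lemma Cint_fubini1 :
  Cint (pi \x rho)%E h = Cint pi (fun x => Cint rho (fun y => h (x, y))).
Proof.
have [h1 h2] := cintegrable_prod.
apply: eq_ReIm => /=; rewrite /Rintegral; congr fine.
  rewrite -fubini1//; apply: eq_integral => x _.
  rewrite /fubini_F fineK//; apply: integrable_fin_num => //.
  by have [] := cintegrable_pair1 x.
rewrite -fubini1//; apply: eq_integral => x _.
rewrite /fubini_F fineK//; apply: integrable_fin_num => //.
by have [] := cintegrable_pair1 x.
Qed.

Lemma Cint_fubini2 :
  Cint (pi \x rho)%E h = Cint rho (fun y => Cint pi (fun x => h (x, y))).
Proof.
have [h1 h2] := cintegrable_prod.
apply: eq_ReIm => /=; rewrite /Rintegral; congr fine.
  rewrite -fubini2//; apply: eq_integral => x _.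
  rewrite /fubini_G fineK//; apply: integrable_fin_num => //.
  by have [] := cintegrable_pair2 x.
rewrite -fubini2//; apply: eq_integral => x _.
rewrite /fubini_G fineK//; apply: integrable_fin_num => //.
by have [] := cintegrable_pair2 x.
Qed.

Lemma cintegrable_inner1 : cintegrable pi (fun x => Cint rho (fun y => h (x, y))).
Proof.
have [h1 h2] := cintegrable_prod.
split.
  apply: eq_integrable (integrable_fubini_F h1) => //= x _.
  rewrite fineK//; apply: integrable_fin_num => //.
  by have [] := cintegrable_pair1 x.
apply: eq_integrable (integrable_fubini_F h2) => //= x _.
rewrite fineK//; apply: integrable_fin_num => //.
by have [] := cintegrable_pair1 x.
Qed.

End ComplexFubini.

(** * Subspaces, semi-norms and the finest locally convex topology *)

Section Subspaces.
Context (R : realType) (E : lmodType R).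
Implicit Types (V : set E) (x y : E) (a : R).

Definition is_subspace V := V 0 /\ forall a x y, V x -> V y -> V (a *: x + y).

Definition is_scalar (phi : E -> R) := forall a x y, phi (a *: x + y) = a * phi x + phi y.

Lemma is_subspaceD V x y : is_subspace V -> V x -> V y -> V (x + y).
Proof. by move=> [_ h] Vx Vy; have := h 1 _ _ Vx Vy; rewrite scale1r. Qed.
Lemma is_subspaceZ V a x : is_subspace V -> V x -> V (a *: x).
Proof. by move=> [V0 h] Vx; have := h a _ _ Vx V0; rewrite addr0. Qed.
Lemma is_subspaceN V x : is_subspace V -> V x -> V (- x).
Proof. by move=> Vs Vx; rewrite -scaleN1r; exact: is_subspaceZ. Qed.
Lemma is_subspaceB V x y : is_subspace V -> V x -> V y -> V (x - y).
Proof. by move=> Vs Vx Vy; apply: is_subspaceD => //; exact: is_subspaceN. Qed.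
Lemma is_subspace_sum V I (r : seq I) (P : pred I) (F : I -> E) : is_subspace V ->
  (forall i, P i -> V (F i)) -> V (\sum_(i <- r | P i) F i).
Proof.
move=> Vs VF; elim/big_ind: _ => //; first by case: Vs.
by move=> x y; exact: is_subspaceD.
Qed.

Lemma is_scalar0 phi : is_scalar phi -> phi 0 = 0.
Proof. by move=> h; have := h (-1) 0 0; rewrite scaler0 addr0 mulN1r addNr. Qed.
Lemma is_scalarD phi x y : is_scalar phi -> phi (x + y) = phi x + phi y.
Proof. by move=> h; have := h 1 x y; rewrite scale1r mul1r. Qed.
Lemma is_scalarZ phi a x : is_scalar phi -> phi (a *: x) = a * phi x.
Proof. by move=> h; have := h a x 0; rewrite !addr0 (is_scalar0 h) addr0. Qed.
Lemma is_scalarN phi x : is_scalar phi -> phi (- x) = - phi x.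
Proof. by move=> h; rewrite -scaleN1r is_scalarZ// mulN1r. Qed.
Lemma is_scalarB phi x y : is_scalar phi -> phi (x - y) = phi x - phi y.
Proof. by move=> h; rewrite is_scalarD// is_scalarN. Qed.

(** Zorn's lemma yields a subspace [M] containing [V] that is maximal among those missing [k]. Then
    [E] is the direct sum of [M] and the line of [k], and [psi] is the coordinate on that line.
    Continuity is automatic: the absolute value of any linear functional is a semi-norm. *)
Lemma separating_functional V k : is_subspace V -> ~ V k ->
  exists psi, [/\ is_scalar psi, forall x, V x -> psi x = 0 & psi k = 1].
Proof.
move=> Vs Vk.
(* The subspaces are written as [A] united with [V] so that the union of the empty chain is
   admissible too. *)
pose P (A : set E) := is_subspace (A `|` V) /\ ~ (A `|` V) k.
have [F FP Ftot|A [[As Ak] Amax]] := @Zorn_bigcup E P.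
  split; last first.
    by move=> [[A FA Ak]|//]; have [_] := FP _ FA; apply; left.
  split; first by right; case: Vs.
  move=> a x y xU yU.
  suff [[Vx Vy]|[A [FA Ax Ay]]] : (V x /\ V y) \/
      exists A, [/\ F A, (A `|` V) x & (A `|` V) y].
  - by right; case: Vs => _; exact.
  - have [[_ As] _] := FP _ FA.
    by have [Axy|Vxy] := As a _ _ Ax Ay; [left; exists A|right].
  case: xU yU => [[A FA Ax]|Vx] [[B FB By]|Vy].
  - right; have [AB|BA] := Ftot _ _ FA FB.
      by exists B; split=> //; left => //; exact: AB.
    by exists A; split=> //; left => //; exact: BA.
  - by right; exists A; split=> //; [left|right].
  - by right; exists B; split=> //; [right|left].
  - by left.
set M := A `|` V in As Ak.
(* If [x] is not in [M], the span [B] of [M] and [x] must contain [k] by maximality; as [k] is not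
   in [M], its coefficient at [x] is invertible. *)
have ex x : exists s, M (x - s *: k).
  have [Mx|Mx] := pselect (M x); first by exists 0; rewrite scale0r subr0.
  pose B := [set z | exists m t, M m /\ z = m + t *: x].
  have Bs : is_subspace B.
    split; first by exists 0, 0; split; [case: As|rewrite scale0r addr0].
    move=> a _ _ [m [t [Mm ->]]] [m' [t' [Mm' ->]]].
    exists (a *: m + m'), (a * t + t'); split; first by case: As => _; exact.
    by rewrite scalerDr scalerDl scalerA addrACA.
  have MB : M `<=` B by move=> m Mm; exists m, 0; rewrite scale0r addr0.
  have BV : B `|` V = B by apply: setUidl => v Vv; apply: MB; right.
  have AB : A `<` B.
    split=> [|BA]; first by move=> z Az; apply: MB; left.
    apply: Mx; left; apply: BA; exists 0, 1; rewrite add0r scale1r.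
    by split=> //; case: As.
  have := Amax _ AB; rewrite /P BV => /not_andP[//|/contrapT].
  move=> [m [t [Mm kE]]].
  have t0 : t != 0.
    by apply/eqP => t0; apply: Ak; rewrite kE t0 scale0r addr0.
  exists t^-1; rewrite kE scalerDr scalerA mulVf// scale1r opprD addrCA subrr addr0.
  by apply: is_subspaceN => //; exact: is_subspaceZ.
have uniq x s t : M (x - s *: k) -> M (x - t *: k) -> s = t.
  move=> Ms Mt; apply: contrapT => st; apply: Ak.
  have st0 : t - s != 0 by rewrite subr_eq0 eq_sym; exact/eqP.
  have := is_subspaceZ (t - s)^-1 As (is_subspaceB As Ms Mt).
  rewrite (_ : x - s *: k - (x - t *: k) = (t - s) *: k).
    by rewrite scalerA mulVf// scale1r.
  by rewrite opprB addrC addrA subrK scalerBl.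
pose psi x := sval (cid (ex x)).
have psiP x : M (x - psi x *: k) by rewrite /psi; case: cid.
have psiE x s : M (x - s *: k) -> psi x = s by move=> h; exact: uniq (psiP x) h.
exists psi; split.
- move=> a x y; apply: psiE.
  rewrite (_ : _ - _ = a *: (x - psi x *: k) + (y - psi y *: k)).
    by case: As => _; apply.
  by rewrite scalerBr scalerA addrACA -opprD -scalerDl.
- by move=> x Vx; apply: psiE; rewrite scale0r subr0; right.
- by apply: psiE; rewrite scale1r subrr; case: As.
Qed.

Lemma lin_span_subspace n (e : 'I_n -> E) : is_subspace (lin_span e).
Proof.
split; first by exists (fun=> 0); rewrite big1// => i _; rewrite scale0r.
move=> a _ _ [t ->] [s ->]; exists (fun i => a * t i + s i).
rewrite scaler_sumr -big_split /=; apply: eq_bigr => i _.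
by rewrite scalerDl scalerA.
Qed.

Lemma lin_span_gen n (e : 'I_n -> E) i : lin_span e (e i).
Proof.
exists (fun j => (j == i)%:R); rewrite (bigD1 i)//= eqxx scale1r big1 ?addr0//.
by move=> j /negbTE ->; rewrite scale0r.
Qed.

Lemma lin_span_sub n (e : 'I_n -> E) V : is_subspace V -> (forall i, V (e i)) ->
  lin_span e `<=` V.
Proof.
move=> Vs Ve _ [t ->]; apply: is_subspace_sum => // i _.
exact: is_subspaceZ.
Qed.

Lemma findim_is_subspace V : findim_subspace V -> is_subspace V.
Proof. by move=> [n [e ->]]; exact: lin_span_subspace. Qed.

(** The coordinates are functionals on all of [E], so that they define semi-norms of [E]. By
    induction on the number of generators, a generator outside the span of the others is split off
    by [separating_functional]. *)
Lemma findim_coord V : findim_subspace V ->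
  exists n (e : nat -> E) (phi : nat -> E -> R),
  [/\ forall i, V (e i), forall i, is_scalar (phi i) &
      forall x, V x -> x = \sum_(i < n) phi i x *: e i].
Proof.
move=> [m [b ->]]; elim: m b => [|m IH] b.
  exists 0%N, (fun=> 0), (fun _ _ => 0); split.
  - by move=> _; case: (lin_span_subspace b).
  - by move=> _ a x y; rewrite mulr0 addr0.
  - by move=> x [t ->]; rewrite !big_ord0.
pose b' i := b (widen_ord (leqnSn m) i); pose k := b ord_max.
have [n [e [phi [eV phil phiE]]]] := IH b'.
have Vs' := lin_span_subspace b'; have Vs := lin_span_subspace b.
have V'V : lin_span b' `<=` lin_span b.
  by apply: lin_span_sub => // i; exact: lin_span_gen.
have VE x : lin_span b x -> exists v s, lin_span b' v /\ x = v + s *: k.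
  move=> [t ->]; rewrite big_ord_recr /=.
  by exists (\sum_(i < m) t (widen_ord (leqnSn m) i) *: b' i), (t ord_max); split=> //; eexists.
have [kV'|kV'] := pselect (lin_span b' k).
  exists n, e, phi; split=> //; first by move=> i; exact: V'V.
  move=> x /VE[v [s [vV' ->]]]; apply: phiE; apply: is_subspaceD => //.
  exact: is_subspaceZ.
have [psi [psil psi0 psik]] := separating_functional Vs' kV'.
(* The old coordinates are precomposed with the projection along [k], since nothing is known of
   their values at [k]. *)
exists n.+1, (fun i => if i == n then k else e i),
  (fun i => if i == n then psi else fun x => phi i (x - psi x *: k)); split.
- by move=> i; case: ifP => _; [exact: lin_span_gen|exact: V'V].
- move=> i; case: ifP => _ // a x y; rewrite psil -phil; congr phi.
  by rewrite scalerBr scalerA addrACA -opprD -scalerDl.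
- move=> x /VE[v [s [vV' ->]]].
  have psix : psi (v + s *: k) = s.
    by rewrite is_scalarD// is_scalarZ// psi0// psik add0r mulr1.
  rewrite big_ord_recr /= eqxx psix; congr (_ + _).
  rewrite [LHS](phiE _ vV'); apply: eq_bigr => i _.
  by rewrite ltn_eqF ?ltn_ord//= psix addrK.
Qed.

End Subspaces.

Section Seminorms.
Context (R : realType) (E : lmodType R).
Implicit Types (p q : E -> R).

Lemma seminorm0 p : seminorm p -> p 0 = 0.
Proof. by move=> [_ h _]; rewrite -(scale0r 0) h normr0 mul0r. Qed.
Lemma seminormN p x : seminorm p -> p (- x) = p x.
Proof. by move=> [_ h _]; rewrite -scaleN1r h normrN1 mul1r. Qed.
Lemma seminormBC p x y : seminorm p -> p (x - y) = p (y - x).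
Proof. by move=> ps; rewrite -opprB seminormN. Qed.
Lemma seminorm_dist p x y : seminorm p -> `|p x - p y| <= p (x - y).
Proof.
move=> ps; have [_ _ h] := ps; rewrite ler_norml.
have := h (x - y) y; have := h (y - x) x; rewrite !subrK (seminormBC y x ps).
by move=> h1 h2; apply/andP; split; lra.
Qed.
Lemma seminormZl p (c : R) : 0 <= c -> seminorm p -> seminorm (fun x => c * p x).
Proof.
move=> c0 [h1 h2 h3]; split=> [x|a x|x y]; first by rewrite mulr_ge0.
  by rewrite h2 mulrCA.
by rewrite -mulrDr ler_wpM2l.
Qed.
Lemma seminormD p q : seminorm p -> seminorm q -> seminorm (fun x => p x + q x).
Proof.
move=> [h1 h2 h3] [k1 k2 k3]; split=> [x|a x|x y]; first by rewrite addr_ge0.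
  by rewrite h2 k2 mulrDr.
by rewrite addrACA lerD.
Qed.
Lemma seminorm_cst0 : seminorm (fun _ : E => 0 : R).
Proof. by split=> *; rewrite ?mulr0 ?addr0. Qed.
Lemma seminorm_sum I (r : seq I) (F : I -> E -> R) :
  (forall i, seminorm (F i)) -> seminorm (fun x => \sum_(i <- r) F i x).
Proof.
move=> h; elim: r => [|i r IH].
  by under eq_fun do rewrite big_nil; exact: seminorm_cst0.
by under eq_fun do rewrite big_cons; exact: seminormD.
Qed.
Lemma seminorm_scalar phi : is_scalar phi -> seminorm (fun x : E => `|phi x|).
Proof.
move=> h; split=> // [a x|x y]; first by rewrite is_scalarZ// normrM.
by rewrite is_scalarD// ler_normD.
Qed.
End Seminorms.

Lemma seminorm_comp (R : realType) (E E' : lmodType R) (T : {linear E -> E'})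
  (p : E' -> R) : seminorm p -> seminorm (fun x => p (T x)).
Proof.
move=> [h1 h2 h3]; split=> [x|a x|x y]; first exact: h1.
  by rewrite linearZ h2.
by rewrite linearD h3.
Qed.

Section ILTopology.
Context (R : realType) (E : lmodType R).
Implicit Types (p q : E -> R).

Lemma il_open_measurable (U : set E) : il_open U -> il_measurable U.
Proof. by move=> Uo; exact: sub_sigma_algebra. Qed.

Lemma il_open_ball p x (r : R) : seminorm p -> il_open [set y | p (y - x) < r].
Proof.
move=> ps y /= yr; set e := r - p (y - x).
have e0 : 0 < e by rewrite subr_gt0.
exists (fun z => e^-1 * p z); first by apply: seminormZl => //; rewrite invr_ge0 ltW.
move=> z; rewrite mulrC ltr_pdivrMr// mul1r => zy.
have [_ _ h] := ps; have := h (z - y) (y - x); rewrite addrA subrK => /le_lt_trans; apply.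
by move: zy; rewrite /e ltrBrDr.
Qed.

Definition il_continuous (f : E -> R) := forall x e, 0 < e ->
  exists2 q, seminorm q & forall y, q (y - x) < 1 -> `|f y - f x| < e.

Lemma il_continuous_measurable f : il_continuous f ->
  measurable_fun setT (f : ilBorel E -> R).
Proof.
move=> fc; apply: (measurability (@RGenOInfty.G R)); first exact: RGenOInfty.measurableE.
move=> _ [_ [a ->] <-]; rewrite setTI; apply: il_open_measurable => x /=.
rewrite in_itv /= andbT -subr_gt0 => /(fc x)[q qs h]; exists q => // y /h.
rewrite ltr_norml => /andP[+ _]; rewrite in_itv /= andbT; lra.
Qed.

Lemma seminorm_il_continuous p : seminorm p -> il_continuous p.
Proof.
move=> ps x e e0; exists (fun z => e^-1 * p z).
  by apply: seminormZl => //; rewrite invr_ge0 ltW.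
move=> y; rewrite mulrC ltr_pdivrMr// mul1r; apply: le_lt_trans.
exact: seminorm_dist.
Qed.

Lemma seminorm_measurable p : seminorm p -> measurable_fun setT (p : ilBorel E -> R).
Proof. by move=> ps; apply: il_continuous_measurable; exact: seminorm_il_continuous. Qed.

(** A functional that vanishes on [V] and equals 1 at [x] takes the value -1 at [y - x] for every
    [y] in [V], so its unit semi-ball around [x] misses [V]. *)
Lemma findim_closed (V : set E) : findim_subspace V -> il_open (~` V).
Proof.
move=> Vf x Vx; have Vs := findim_is_subspace Vf.
have [psi [psil psi0 psix]] := separating_functional Vs Vx.
exists (fun z => `|psi z|); first exact: seminorm_scalar.
move=> y /= + Vy; rewrite is_scalarB// (psi0 _ Vy) psix sub0r normrN1.
by rewrite ltxx.
Qed.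

Lemma findim_measurable (V : set E) : findim_subspace V -> il_measurable V.
Proof.
move=> Vf; rewrite -(setCK V).
exact: (@measurableC _ (ilBorel E)) (il_open_measurable (findim_closed Vf)).
Qed.

Lemma findim0 : findim_subspace [set (0 : E)].
Proof.
exists 0%N, (fun=> 0); apply/seteqP; split=> [_ ->|x [t ->]]; last by rewrite big_ord0.
by exists (fun=> 0); rewrite big_ord0.
Qed.

End ILTopology.

Lemma il_open_preimage (R : realType) (E E' : lmodType R) (f : E -> E') (U : set E') :
  (forall p : E' -> R, seminorm p -> forall x, exists2 q : E -> R, seminorm q &
     forall y, q (y - x) < 1 -> p (f y - f x) < 1) ->
  il_open U -> il_open (f @^-1` U).
Proof.
move=> fc Uo x /= /Uo[p ps h]; have [q qs k] := fc _ ps x.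
by exists q => // y /k /h.
Qed.

Lemma il_measurable_fun (R : realType) (E E' : lmodType R) d (T : measurableType d)
  (f : T -> E') : (forall U : set E', il_open U -> measurable (f @^-1` U)) ->
  measurable_fun setT (f : T -> ilBorel E').
Proof.
move=> h; apply: (@measurability _ _ T (ilBorel E') setT f (@il_open R E')) => //.
by move=> _ [U Uo <-]; rewrite setTI; exact: h.
Qed.

Lemma linear_measurable (R : realType) (E E' : lmodType R) (T : {linear E -> E'}) :
  measurable_fun setT (T : ilBorel E -> ilBorel E').
Proof.
apply: il_measurable_fun => // U Uo; apply: il_open_measurable.
apply: il_open_preimage Uo => p ps x; exists (fun z => p (T z)).
  exact: seminorm_comp.
by move=> y; rewrite linearB.
Qed.

Section ILMaps.
Context (R : realType) (E : lmodType R).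

Lemma translation_measurable (v : E) :
  measurable_fun setT ((fun x => v + x) : ilBorel E -> ilBorel E).
Proof.
apply: il_measurable_fun => // U Uo; apply: il_open_measurable.
apply: il_open_preimage Uo => p ps x; exists p => // y.
by rewrite opprD addrACA subrr add0r.
Qed.

Lemma opp_measurable : measurable_fun setT ((fun x => - x) : ilBorel E -> ilBorel E).
Proof.
apply: il_measurable_fun => // U Uo; apply: il_open_measurable.
apply: il_open_preimage Uo => p ps x; exists p => // y.
by rewrite -opprD seminormN.
Qed.

Lemma set1_measurable (x : E) : il_measurable [set x].
Proof.
rewrite (_ : [set x] = (fun z => - x + z) @^-1` [set 0]).
  by rewrite -[X in il_measurable X]setTI; apply: translation_measurable => //;
    exact: findim_measurable (findim0 E).
apply/seteqP; split=> y /=; first by move=> ->; rewrite addNr.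
by move/eqP; rewrite addrC subr_eq0 => /eqP.
Qed.
End ILMaps.

(** * Countably spanned subspaces and joint measurability *)

Section CountableSpan.
Context (R : realType) (E : lmodType R).
Implicit Types (e : nat -> E).

Definition spann e n : set E := lin_span (fun i : 'I_n => e i).
Definition cspan e : set E := \bigcup_n spann e n.

Lemma spann_findim e n : findim_subspace (spann e n).
Proof. by exists n, (fun i : 'I_n => e i). Qed.

Lemma spann_subspace e n : is_subspace (spann e n).
Proof. exact: lin_span_subspace. Qed.

Lemma spann_gen e n i : (i < n)%N -> spann e n (e i).
Proof. by move=> ilt; have := lin_span_gen (fun i : 'I_n => e i) (Ordinal ilt). Qed.

Lemma spann_mono e m n : (m <= n)%N -> spann e m `<=` spann e n.
Proof.
move=> mn; apply: lin_span_sub; first exact: spann_subspace.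
by move=> i; apply: spann_gen; exact: leq_trans (ltn_ord i) mn.
Qed.

Lemma cspan_subspace e : is_subspace (cspan e).
Proof.
split; first by exists 0%N => //; case: (spann_subspace e 0).
move=> a x y [m _ xm] [n _ yn]; exists (maxn m n) => //.
have [_ h] := spann_subspace e (maxn m n); apply: h.
  exact: spann_mono (leq_maxl _ _) _ xm.
exact: spann_mono (leq_maxr _ _) _ yn.
Qed.

Lemma cspan_gen e i : cspan e (e i).
Proof. by exists i.+1 => //; exact: spann_gen. Qed.

Lemma cspan_sub e V : is_subspace V -> (forall i, V (e i)) -> cspan e `<=` V.
Proof. by move=> Vs Ve x [n _]; apply: lin_span_sub. Qed.

Lemma cspan_measurable e : il_measurable (cspan e).
Proof.
apply: (@bigcupT_measurable _ (ilBorel E)) => n.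
exact: findim_measurable (spann_findim e n).
Qed.

Lemma findim_cspan (V : set E) : findim_subspace V -> exists e, V `<=` cspan e.
Proof.
move=> [n [b ->]].
exists (fun i => if insub i is Some j then b j else 0).
apply: lin_span_sub; first exact: cspan_subspace.
move=> i; have := cspan_gen (fun i => if insub i is Some j then b j else 0) i.
by rewrite valK.
Qed.

(** A double sequence read along a coding of pairs; codes of no pair give 0. Its span contains the
    span of every row, so countably many carriers fit into one countable span. *)
Definition joined (u : nat -> nat -> E) (k : nat) : E :=
  if unpickle k is Some ij then u ij.1 ij.2 else 0.

Lemma cspan_joined u i : cspan (u i) `<=` cspan (joined u).
Proof.
apply: cspan_sub; first exact: cspan_subspace.
move=> j; have := cspan_gen (joined u) (pickle (i, j)).
by rewrite /joined pickleK.
Qed.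

Lemma cspan_join2 e e' : exists e2, cspan e `<=` cspan e2 /\ cspan e' `<=` cspan e2.
Proof.
pose u (i : nat) := if i is 0%N then e else e'.
by exists (joined u); split; [exact: (@cspan_joined u 0)|exact: (@cspan_joined u 1)].
Qed.

(* Addition is not known to be measurable for the product of the Borel
   sigma-algebras when [E] is not separable, but it becomes so after composition
   with [retr e], which does not affect measures concentrated on [cspan e]. *)
Definition retr e (x : E) : E := if `[< cspan e x >] then x else 0.

Lemma retr_id e x : cspan e x -> retr e x = x.
Proof. by rewrite /retr => /asboolT ->. Qed.

Lemma retr_in e x : cspan e (retr e x).
Proof. by rewrite /retr; case: asboolP => // _; case: (cspan_subspace e). Qed.

Lemma retr_measurable e : measurable_fun setT (retr e : ilBorel E -> ilBorel E).
Proof.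
move=> _ A mA; rewrite setTI.
have mW := cspan_measurable e.
have [A0|A0] := pselect (A 0).
  rewrite (_ : _ @^-1` _ = (A `&` cspan e) `|` ~` cspan e).
    apply: measurableU; first exact: measurableI.
    exact: measurableC.
  apply/seteqP; split=> x /=; rewrite /retr; case: asboolP => Wx.
  - by move=> Ax; left.
  - by move=> _; right.
  - by move=> [[]|].
  - by [].
rewrite (_ : _ @^-1` _ = A `&` cspan e); first exact: measurableI.
apply/seteqP; split=> x /=; rewrite /retr; case: asboolP => Wx.
- by [].
- by move/A0.
- by case.
- by case.
Qed.

End CountableSpan.

Section JointMeasurability.
Context (R : realType) (E : lmodType R).
Implicit Types (O : set (E * E)).

(** Openness in the product topology; a single semi-norm for both variables suffices because
    semi-norms can be added. *)
Definition il_open2 O := forall x y, O (x, y) ->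
  exists2 q : E -> R, seminorm q &
    forall x' y', q (x' - x) < 1 -> q (y' - y) < 1 -> O (x', y').

(* [p] is the sum of the absolute values of the coordinates, [D] enumerates the
   rational combinations of a basis. *)
Lemma findim_norm (V : set E) : findim_subspace V ->
  exists (p : E -> R) (J : countType) (D : J -> E), [/\ seminorm p, forall j, V (D j),
    forall q : E -> R, seminorm q ->
      exists2 C : R, 0 < C & forall x, V x -> q x <= C * p x &
    forall x e, V x -> 0 < e -> exists j, p (x - D j) < e].
Proof.
move=> Vf; have Vs := findim_is_subspace Vf.
have [n [b [phi [bV phil phiE]]]] := findim_coord Vf.
pose p x := \sum_(i < n) `|phi i x|.
have ps : seminorm p by apply: seminorm_sum => i; exact: seminorm_scalar.
pose comb (t : {ffun 'I_n -> rat}) := \sum_(i < n) (ratr (t i) : R) *: b i.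
exists p, {ffun 'I_n -> rat}, comb; split => //.
- move=> t; apply: is_subspace_sum => // i _; exact: is_subspaceZ.
- move=> q qs; have [q0 qZ qD] := qs.
  exists (\sum_(i < n) q (b i) + 1); first by rewrite ltr_wpDl// sumr_ge0.
  move=> x /phiE xE; rewrite [X in q X]xE.
  apply: (@le_trans _ _ (\sum_(i < n) `|phi i x| * q (b i))).
    elim/big_ind2 : _ => //; first by rewrite seminorm0.
      by move=> y1 y2 z1 z2 h1 h2; rewrite (le_trans (qD _ _))// lerD.
    by move=> i _; rewrite qZ.
  rewrite /p mulr_sumr; apply: ler_sum => i _; rewrite mulrC.
  rewrite ler_wpM2r// (bigD1 i)//= -addrA lerDl addr_ge0// sumr_ge0//.
- move=> x e /phiE xE e0; have [p0 pZ pD] := ps.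
  pose S := \sum_(i < n) p (b i) + 1.
  have S0 : 0 < S by rewrite ltr_wpDl// sumr_ge0.
  have ex (i : 'I_n) : exists r : rat, `|phi i x - ratr r| < e / S.
    have lt : phi i x - e / S < phi i x + e / S.
      by rewrite ltrD2l gtrN// divr_gt0.
    have [r] := rat_in_itvoo lt; rewrite in_itv /= => /andP[h1 h2].
    by exists r; rewrite ltr_norml; apply/andP; split; lra.
  pose t := [ffun i : 'I_n => sval (cid (ex i))].
  exists t.
  rewrite [X in p (X - _)]xE /comb -sumrB.
  apply: (@le_lt_trans _ _ (\sum_(i < n) (e / S) * p (b i))).
    elim/big_ind2 : _ => //; first by rewrite seminorm0.
      by move=> y1 y2 z1 z2 h1 h2; rewrite (le_trans (pD _ _))// lerD.
    move=> i _; rewrite -scalerBl pZ ler_wpM2r// /t ffunE ltW//.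
    exact: svalP (cid (ex i)).
  rewrite -mulr_sumr -mulrA gtr_pMr// mulrC ltr_pdivrMr// mul1r /S.
  by rewrite ltrDl.
Qed.

Let EE := (ilBorel E * ilBorel E)%type.

(** A finite dimensional space is second countable: the part of [O] in the square of [V] is the
    union of those boxes, of radius [1 / (m + 1)] around points of a countable dense set, that are
    contained in [O]. Boxes are measurable for the product of the Borel sigma-algebras. *)
Lemma il_open2_findim (V : set E) O : findim_subspace V -> il_open2 O ->
  measurable ((V `*` V) `&` O : set EE).
Proof.
move=> Vf Oo; have Vs := findim_is_subspace Vf; have Vm := findim_measurable Vf.
have [p [J [D [ps DV pq dens]]]] := findim_norm Vf.
pose B (d : E) (m : nat) : set E := V `&` [set y | p (y - d) < m.+1%:R^-1].
have mB d m : il_measurable (B d m).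
  by apply: (@measurableI _ (ilBorel E)) => //; apply: il_open_measurable; exact: il_open_ball.
pose P (i : J * J * nat) := B (D i.1.1) i.2 `*` B (D i.1.2) i.2.
rewrite (_ : _ `&` O = \bigcup_(i : J * J * nat) (if `[< P i `<=` O >] then P i else set0)).
  apply: countable_bigcupT_measurable; first exact: countableP.
  by move=> i; case: ifP => // _; apply: measurableX; exact: mB.
apply/seteqP; split=> [[x y] [/= [Vx Vy] /Oo[q qs h]]|[x y] [[[d d'] m] _]]; last first.
  case: asboolP => // sub [/= xB yB]; split; last exact: sub.
  by split; [case: xB|case: yB].
have [C C0 qC] := pq _ qs.
(* The factor 2: two points of one ball are at [p]-distance less than twice its radius, and [q] is
   at most [C] times [p]. *)
have [m mC] : exists m : nat, 2 * C * m.+1%:R^-1 < 1.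
  have [m hm] : exists m : nat, 2 * C < m%:R.
    by exists (Num.truncn (2 * C)).+1; rewrite truncnS_gt.
  exists m; rewrite ltr_pdivrMr// mul1r (lt_trans hm)// ltr_nat//.
have m0 : 0 < m.+1%:R^-1 :> R by rewrite invr_gt0.
have [d xd] := dens _ _ Vx m0; have [d' yd'] := dens _ _ Vy m0.
have near z w (c : E) : V z -> V w -> p (z - c) < m.+1%:R^-1 -> p (w - c) < m.+1%:R^-1 ->
    q (w - z) < 1.
  move: (m.+1%:R^-1) mC => r rC Vz Vw zc wc; apply: le_lt_trans (qC _ (is_subspaceB Vs Vw Vz)) _.
  apply: le_lt_trans rC; rewrite -mulrA mulrCA ler_pM2l//.
  have [_ _ pD] := ps; have := pD (w - c) (c - z).
  rewrite addrA subrK (seminormBC c z ps); lra.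
exists (d, d', m) => //; case: asboolP => [_|]; first by split; split.
case=> -[x' y'] [/= [Vx' xd2] [Vy' yd2]].
by apply: h; [exact: (near _ _ (D d))|exact: (near _ _ (D d'))].
Qed.

Variable e : nat -> E.

Lemma il_open2_cspan O : il_open2 O -> measurable ((cspan e `*` cspan e) `&` O : set EE).
Proof.
move=> Oo; rewrite (_ : _ `&` _ = \bigcup_n ((spann e n `*` spann e n) `&` O)).
  by apply: bigcupT_measurable => n; apply: il_open2_findim => //; exact: spann_findim.
apply/seteqP; split=> [[x y] [/= [[m _ xm] [n _ yn]] Oxy]|[x y] [n _ [/= [xn yn] Oxy]]].
  exists (maxn m n) => //; split=> //; split.
    exact: spann_mono (leq_maxl _ _) _ xm.
  exact: spann_mono (leq_maxr _ _) _ yn.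
by split=> //; split; exists n.
Qed.

Lemma retr2_preimage O : il_open2 O ->
  measurable ((fun p : EE => (retr e p.1, retr e p.2)) @^-1` O).
Proof.
move=> /il_open2_cspan mO.
have mr : measurable_fun setT
    (fun p : EE => (retr e p.1 : ilBorel E, retr e p.2 : ilBorel E)).
  by apply: measurable_fun_pair;
    [exact: (measurableT_comp (retr_measurable e) measurable_fst)
    |exact: (measurableT_comp (retr_measurable e) measurable_snd)].
have := mr measurableT _ mO; rewrite setTI; congr measurable.
apply/seteqP; split=> p /=; first by case.
by move=> Op; split=> //; split; exact: retr_in.
Qed.

Definition il_continuous2 (F : E -> E -> R) := forall x y eps, 0 < eps ->
  exists2 q : E -> R, seminorm q &
    forall x' y', q (x' - x) < 1 -> q (y' - y) < 1 -> `|F x' y' - F x y| < eps.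

Lemma retr2_measurable F : il_continuous2 F ->
  measurable_fun setT (fun p : EE => F (retr e p.1) (retr e p.2)).
Proof.
move=> Fc; apply: (measurability (@RGenOInfty.G R)); first exact: RGenOInfty.measurableE.
move=> _ [_ [a ->] <-]; rewrite setTI.
apply: (retr2_preimage (O := [set p | F p.1 p.2 \in `]a, +oo[])) => x y /=.
rewrite in_itv /= andbT -subr_gt0 => /(Fc x y)[q qs h].
exists q => // x' y' hx hy; have := h _ _ hx hy.
rewrite ltr_norml => /andP[+ _]; rewrite in_itv /= andbT; lra.
Qed.

Lemma retr2_add_measurable :
  measurable_fun setT (fun p : EE => retr e p.1 + retr e p.2 : ilBorel E).
Proof.
apply: il_measurable_fun => // U Uo.
apply: (retr2_preimage (O := [set p | U (p.1 + p.2)])) => x y /= /Uo[q qs h].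
exists (fun z => 2 * q z); first exact: seminormZl.
move=> x' y' hx hy; apply: h; rewrite opprD addrACA.
have [_ _ qD] := qs; apply: le_lt_trans (qD _ _) _; lra.
Qed.

End JointMeasurability.

(** * Representation of complex measures by densities *)

Section RawIntegral.
Import HBNNSimple.
Context d (T : measurableType d) (R : realType).
Local Open Scope ereal_scope.

(** Here [m1] and [m2] are arbitrary set functions, as [tv mu] and [pos_part nu] are. The integral
    evaluates them only at level sets of simple functions, which are measurable. *)
Lemma eq_set_integral (m1 m2 : set T -> \bar R) (f : T -> \bar R) :
  (forall A, measurable A -> m1 A = m2 A) -> \int[m1]_x f x = \int[m2]_x f x.
Proof.
move=> m12; rewrite /integral.
have E (g : {nnsfun T >-> R}) : sintegral m1 g = sintegral m2 g.
  rewrite /sintegral; by apply: eq_fsbigr => x _; rewrite m12.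
by congr (_ - _); congr ereal_sup; apply/seteqP; split=> _ [g gf <-];
  exists g => //; rewrite E.
Qed.

(** The functions [f] and [g] are not assumed measurable, since an inner integral is controlled only
    on a countable span. For nonnegative functions, a simple function below [f], cut off to [W],
    lies below [g] and has the same integral. *)
Lemma integral_agree (m : {measure set T -> \bar R}) (W : set T) (f g : T -> \bar R) :
  measurable W -> m (~` W) = 0 -> (forall x, W x -> f x = g x) ->
  \int[m]_x f x = \int[m]_x g x.
Proof.
move=> mW W0.
have le (f' g' : T -> \bar R) : (forall x, 0 <= f' x) -> (forall x, 0 <= g' x) ->
    (forall x, W x -> f' x = g' x) -> \int[m]_x f' x <= \int[m]_x g' x.
  move=> f0 g0 fg; rewrite !ge0_integralTE//; apply: ge_ereal_sup => _ [k kf <-].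
  apply: le_trans (ereal_sup_ubound _); last first.
    exists (proj_nnsfun k mW); last reflexivity.
    move=> x; rewrite /= mindicE; have [xW|xW] := boolP (x \in W).
      by rewrite mulr1 -fg; [exact: kf|exact: set_mem].
    by rewrite mulr0.
  rewrite -!integralT_nnsfun.
  rewrite (@ge0_ae_eq_integral _ _ _ m setT _ (EFin \o proj_nnsfun k mW))//.
  - exact/measurable_EFinP.
  - exact/measurable_EFinP.
  - by move=> x _; rewrite lee_fin.
  - by move=> x _; rewrite lee_fin.
  - exists (~` W); split=> //; first exact: measurableC.
    move=> x /= h Wx; apply: h => _.
    by rewrite mindicE mem_set// mulr1.
move=> fg; rewrite [LHS]integralE [RHS]integralE.
have eq (f' g' : T -> \bar R) : (forall x, 0 <= f' x) -> (forall x, 0 <= g' x) ->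
    (forall x, W x -> f' x = g' x) -> \int[m]_x f' x = \int[m]_x g' x.
  move=> f0 g0 fg'; apply/eqP; rewrite eq_le !le//.
  by move=> x Wx; rewrite fg'.
congr (_ - _); apply: eq => [x|x|x Wx]; rewrite ?funepos_ge0 ?funeneg_ge0 //.
  by rewrite !funeposE fg.
by rewrite !funenegE fg.
Qed.

End RawIntegral.

Section Density.
Context d (T : measurableType d) (R : realType).
Variables (pi : {sigma_finite_measure set T -> \bar R}) (a : T -> R).
Hypothesis ia : rintegrable pi a.

Definition mdens (A : set T) : \bar R := (\int[pi]_(t in A) `|a t|%:E)%E.

Let ma : measurable_fun setT (fun t => `|a t|%:E).
Proof. exact: measurable_int (integrable_norm ia). Qed.

Let mdens0 : mdens set0 = 0%E. Proof. by rewrite /mdens integral_set0. Qed.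

Let mdens_ge0 A : (0 <= mdens A)%E.
Proof. by apply: integral_ge0 => t _; rewrite lee_fin. Qed.

Let mdens_sigma_additive : semi_sigma_additive mdens.
Proof. by apply: semi_sigma_additive_nng_induced => // t; rewrite lee_fin. Qed.

HB.instance Definition _ := isMeasure.Build _ _ _ mdens mdens0 mdens_ge0 mdens_sigma_additive.

Let mdens_fin : fin_num_fun mdens.
Proof.
move=> A mA; rewrite ge0_fin_numE//.
apply: (@le_lt_trans _ _ (mdens setT)); first by apply: le_measure; rewrite ?inE.
have := integrable_lty measurableT (integrable_norm ia).
by rewrite /mdens.
Qed.

HB.instance Definition _ := Measure_isFinite.Build _ _ _ mdens mdens_fin.

Definition density : {finite_measure set T -> \bar R} := mdens.

(** The change of variables formula holds for the Radon-Nikodym derivative of [density], which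
    equals [|a|] almost everywhere because both have the same integral over every measurable set. *)
Lemma ge0_integral_density (f : T -> \bar R) : (forall t, 0 <= f t)%E ->
  measurable_fun setT f ->
  (\int[density]_t f t = \int[pi]_t (f t * `|a t|%:E))%E.
Proof.
move=> f0 mf.
have dom : density `<< pi.
  apply/null_content_dominatesP => A mA A0.
  apply: null_set_integral => //; first exact: measurable_funTS.
rewrite -(Radon_Nikodym_SigmaFinite.change_of_variables dom)//.
apply: ge0_ae_eq_integral => //.
- apply: emeasurable_funM => //.
  exact: measurable_int (Radon_Nikodym_SigmaFinite.f_integrable dom).
- exact: emeasurable_funM.
- by move=> x _; rewrite mule_ge0// Radon_Nikodym_SigmaFinite.f_ge0.
- by move=> x _; rewrite mule_ge0// lee_fin.
apply: ae_eqe_mul2l; apply: integral_ae_eq => //.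
- exact: Radon_Nikodym_SigmaFinite.f_integrable.
- by move=> A _ mA; rewrite -Radon_Nikodym_SigmaFinite.f_integral.
Qed.

Lemma integrable_density (f : T -> R) : measurable_fun setT f ->
  rintegrable pi (fun t => f t * a t) -> rintegrable density f.
Proof.
move=> mf ifa; apply/integrableP; split; first exact/measurable_EFinP.
rewrite ge0_integral_density//; last by apply: measurableT_comp => //; exact/measurable_EFinP.
have /integrableP[_] := ifa; congr (_ < _)%E; apply: eq_integral => t _.
by rewrite -EFinM -normrM.
Qed.

Lemma Rintegral_density (f : T -> R) : measurable_fun setT f ->
  rintegrable pi (fun t => f t * a t) ->
  Rintegral density setT f = Rintegral pi setT (fun t => f t * `|a t|).
Proof.
move=> mf ifa; rewrite /Rintegral; congr fine.
have mf' : measurable_fun setT (EFin \o f) by exact/measurable_EFinP.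
rewrite [LHS]integralE [RHS]integralE.
rewrite !ge0_integral_density//; [|exact: measurable_funeneg|exact: measurable_funepos].
have H (x y : R) : 0 <= y -> (maxe x%:E 0 * y%:E = maxe (x * y)%:E 0)%E.
  by move=> y0; rewrite -[0%E]/(0%:E)%E -!EFin_max -EFinM maxr_pMl// mul0r.
congr (_ - _)%E; apply: eq_integral => t _; rewrite ?funeposE ?funenegE /= ?H//.
by rewrite mulNr.
Qed.

End Density.
Arguments density {d T R pi a} ia.

Section ImageMeasure.
Context d1 d2 (T1 : measurableType d1) (T2 : measurableType d2) (R : realType).
Variables (m : {measure set T1 -> \bar R}) (f : T1 -> T2).
Hypothesis mf : measurable_fun setT f.

(** The measurability proof is an argument of the set function, which allows the measure structure
    to be attached to it. *)
Definition image_measure & measurable_fun setT f := pushforward m f.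

Let im0 : image_measure mf set0 = 0%E.
Proof. by rewrite /image_measure /pushforward preimage_set0 measure0. Qed.

Let im_ge0 A : (0 <= image_measure mf A)%E.
Proof. exact: measure_ge0. Qed.

Let im_sigma_additive : semi_sigma_additive (image_measure mf).
Proof. exact: measure_semi_sigma_additive. Qed.

HB.instance Definition _ := isMeasure.Build _ _ _ (image_measure mf) im0 im_ge0 im_sigma_additive.

Lemma image_measureE A : image_measure mf A = m (f @^-1` A).
Proof. by []. Qed.
End ImageMeasure.

Section FiniteImageMeasure.
Context d1 d2 (T1 : measurableType d1) (T2 : measurableType d2) (R : realType).
Variables (m : {finite_measure set T1 -> \bar R}) (f : T1 -> T2).
Hypothesis mf : measurable_fun setT f.

Let im_fin : fin_num_fun (image_measure m mf).
Proof.
move=> A mA; rewrite image_measureE fin_num_measure//.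
by rewrite -[_ @^-1` _]setTI; exact: mf.
Qed.

HB.instance Definition _ := Measure_isFinite.Build _ _ _ (image_measure m mf) im_fin.
End FiniteImageMeasure.

(** * Integrals against differences of finite measures *)

Section SignedIntegral.
Context (R : realType) (E : lmodType R).
Variables (p n : {finite_measure set (ilBorel E) -> \bar R}) (nu : set E -> R).
Hypothesis nuE : forall A, il_measurable A -> (nu A)%:E = (p A - n A)%E.

Let c : {charge set (ilBorel E) -> \bar R} :=
  cadd (charge_of_finite_measure p) (cscale (-1) (charge_of_finite_measure n)).

Let cE A : il_measurable A -> c A = (nu A)%:E.
Proof.
move=> mA; rewrite nuE//.
have -> : c A = (p A + cscale (-1) (charge_of_finite_measure n) A)%E by [].
by rewrite cscaleN1.
Qed.

(** A Hahn decomposition computes the suprema that define [pos_part]. Here [nu] is the difference of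
    arbitrary finite measures [p] and [n]: the inequalities express minimality of the Jordan
    decomposition, and the last identity is [jp - jn = p - n] in a form free of subtraction. *)
Lemma jordan_pos_part : exists jp jn : {finite_measure set (ilBorel E) -> \bar R},
  forall A, il_measurable A ->
  [/\ pos_part nu A = jp A, pos_part (fun B => - nu B) A = jn A,
     (jp A <= p A)%E, (jn A <= n A)%E & (jp A + n A = jn A + p A)%E].
Proof.
have [P [N PN]] := Hahn_decomposition c.
have [[mP _] [mN _] _ _] := PN.
pose jp : {finite_measure set (ilBorel E) -> \bar R} := jordan_pos PN.
pose jn : {finite_measure set (ilBorel E) -> \bar R} := jordan_neg PN.
exists jp, jn => A mA.
have jpE B : measurable B -> jp B = c (B `&` P).
  by move=> mB; rewrite -[jp B]/(jordan_pos PN B) jordan_posE cjordan_posE /crestr0 mem_set.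
have jnE B : measurable B -> jn B = (- c (B `&` N))%E.
  by move=> mB; rewrite -[jn B]/(jordan_neg PN B) jordan_negE cjordan_negE /crestr0 mem_set.
have dec B : measurable B -> c B = (jp B - jn B)%E.
  move=> mB; rewrite (jordan_decomp PN mB).
  have -> : cadd (jordan_pos PN) (cscale (-1) (jordan_neg PN)) B =
    (jp B + cscale (-1) (jn) B)%E by [].
  by rewrite cscaleN1.
have fp := fin_num_measure p A mA; have fn := fin_num_measure n A mA.
have fjp := fin_num_measure jp A mA.
have fjn := fin_num_measure jn A mA.
split.
- apply/eqP; rewrite eq_le; apply/andP; split.
    apply: ge_ereal_sup => _ [B [mB BA] <-]; rewrite -cE// dec//.
    apply: (@le_trans _ _ (jp B)); last by apply: le_measure; rewrite ?inE.
    by rewrite leeBlDr ?fin_num_measure// leeDl.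
  apply: ereal_sup_ubound; exists (A `&` P).
    by split; [exact: (@measurableI _ (ilBorel E))|exact: subIsetl].
  by rewrite jpE// -cE//; exact: (@measurableI _ (ilBorel E)).
- apply/eqP; rewrite eq_le; apply/andP; split.
    apply: ge_ereal_sup => _ [B [mB BA] <-]; rewrite EFinN -cE// dec//.
    apply: (@le_trans _ _ (jn B)); last by apply: le_measure; rewrite ?inE.
    rewrite fin_num_oppeB ?fin_num_measure// addeC leeBlDr ?fin_num_measure//.
    by rewrite leeDl.
  apply: ereal_sup_ubound; exists (A `&` N).
    by split; [exact: (@measurableI _ (ilBorel E))|exact: subIsetl].
  by rewrite jnE// EFinN -cE//; exact: (@measurableI _ (ilBorel E)).
- have mAP : il_measurable (A `&` P) by exact: (@measurableI _ (ilBorel E)).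
  rewrite jpE// cE// nuE//; apply: (@le_trans _ _ (p (A `&` P : set (ilBorel E)))).
    by rewrite leeBlDr ?fin_num_measure// leeDl.
  by apply: le_measure; rewrite ?inE.
- have mAN : il_measurable (A `&` N) by exact: (@measurableI _ (ilBorel E)).
  rewrite jnE// cE// nuE// fin_num_oppeB ?fin_num_measure//.
  apply: (@le_trans _ _ (n (A `&` N : set (ilBorel E)))); last by apply: le_measure; rewrite ?inE.
  by rewrite addeC leeBlDr ?fin_num_measure// leeDl.
- have := dec A mA; rewrite cE// nuE// => /eqP.
  move: fp fn fjp fjn => /fineK <- /fineK <- /fineK <- /fineK <-.
  by rewrite -!EFinB eqe => /eqP h; rewrite -!EFinD; congr EFin; lra.
Qed.

Variables (W : set E) (h h' : E -> R).
Hypotheses (mW : il_measurable W) (pW : p (~` W) = 0%E) (nW : n (~` W) = 0%E).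
Hypotheses (mh' : measurable_fun setT (h' : ilBorel E -> R))
  (hh' : forall x, W x -> h x = h' x).
Hypotheses (ip : rintegrable p h') (inn : rintegrable n h').

(** Integrating [jp + n = jn + p] exchanges the Jordan parts for [p] and [n]; minimality transfers
    integrability to [jp] and [jn]. The function [h] is arbitrary off [W], and [h'] is a measurable
    substitute that agrees with it on the carrier. *)
Lemma rintE : rint nu h = Rintegral p setT h' - Rintegral n setT h'.
Proof.
have [jp [jn J]] := jordan_pos_part.
rewrite /rint.
rewrite (@eq_set_integral _ (ilBorel E) R (pos_part nu) jp); last first.
  by move=> A mA; have [] := J A mA.
rewrite (@eq_set_integral _ (ilBorel E) R (pos_part (fun B => - nu B)) jn); last first.
  by move=> A mA; have [] := J A mA.
have mWc : measurable (~` W : set (ilBorel E)) by exact: measurableC.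
have jpW : jp (~` W) = 0%E.
  apply/eqP; rewrite eq_le measure_ge0 andbT -pW.
  by have [] := J _ mWc.
have jnW : jn (~` W) = 0%E.
  apply/eqP; rewrite eq_le measure_ge0 andbT -nW.
  by have [] := J _ mWc.
have hh'E x : W x -> (h x)%:E = (h' x)%:E by move=> /hh' ->.
rewrite (integral_agree mW jpW hh'E) (integral_agree mW jnW hh'E).
have mEh' : measurable_fun setT (EFin \o (h' : ilBorel E -> R)) by exact/measurable_EFinP.
have ijp : rintegrable jp h'.
  apply/integrableP; split => //; apply: le_lt_trans (integrable_lty measurableT (integrable_norm ip)).
  apply: ge0_le_measure_integral => //; last exact: measurableT_comp.
  by move=> A mA; have [] := J _ mA.
have ijn : rintegrable jn h'.
  apply/integrableP; split => //; apply: le_lt_trans (integrable_lty measurableT (integrable_norm inn)).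
  apply: ge0_le_measure_integral => //; last exact: measurableT_comp.
  by move=> A mA; have [] := J _ mA.
have e1 := integral_measure_add measurableT ijp inn.
have e2 := integral_measure_add measurableT ijn ip.
have e3 : (\int[measure_add jp n]_x (h' x)%:E = \int[measure_add jn p]_x (h' x)%:E)%E.
  apply: eq_set_integral => A mA; rewrite !measure_addE.
  by have [] := J _ mA.
move: e3; rewrite e1 e2.
have f1 := integrable_fin_num measurableT ijp; have f2 := integrable_fin_num measurableT ijn.
have f3 := integrable_fin_num measurableT ip; have f4 := integrable_fin_num measurableT inn.
rewrite /Rintegral -(fineK f1) -(fineK f2) -(fineK f3) -(fineK f4) -!EFinD => -[].
by move=> e; rewrite /=; lra.
Qed.

End SignedIntegral.

(** * Complex measures given by a density and a map *)

Section Representation.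
Context (R : realType) (E : lmodType R) d (T : measurableType d).
Variables (pi : {sigma_finite_measure set T -> \bar R}) (Phi : T -> ilBorel E).

(* [u] is the density, with respect to [pi], of a complex measure on [T] whose
   image under [Phi] is [mu]. *)
Definition crep (u : T -> R[i]) (mu : set E -> R[i]) :=
  [/\ measurable_fun setT Phi, cintegrable pi u &
    mu = fun A => if `[< il_measurable A >]
      then Cint pi (fun t => u t * (\1_A (Phi t) : R)%:C) else 0].

Hypothesis mPhi : measurable_fun setT Phi.

Lemma indic_comp_measurable A : il_measurable A ->
  measurable_fun setT (fun t => \1_A (Phi t) : R).
Proof.
move=> mA; apply: (@measurableT_comp _ _ _ _ _ _ (\1_A : ilBorel E -> R)) => //.
Qed.

Lemma rintegrable_indic (a : T -> R) A : il_measurable A -> rintegrable pi a ->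
  rintegrable pi (fun t => a t * \1_A (Phi t)).
Proof.
move=> mA ia; apply: (rintegrable_le _ (integrable_norm ia)).
  apply: measurable_funM; first exact: (rintegrable_mf ia).
  exact: indic_comp_measurable.
move=> t; rewrite normrM /= ler_piMr// indicE.
by case: (_ \in _); rewrite ?normr1 ?normr0.
Qed.

Lemma pushforward_density (a : T -> R) (ia : rintegrable pi a) A :
  (forall t, 0 <= a t) -> il_measurable A ->
  image_measure (density ia) mPhi A = (Rintegral pi setT (fun t => a t * \1_A (Phi t)))%:E.
Proof.
move=> a0 mA; rewrite image_measureE /= /mdens.
have mPA : measurable (Phi @^-1` A) by rewrite -[_ @^-1` _]setTI; exact: mPhi.
rewrite /Rintegral fineK; last by apply: integrable_fin_num => //; exact: rintegrable_indic.
rewrite [LHS]integral_mkcond; apply: eq_integral => t _.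
rewrite patchE indicE.
have -> : (t \in Phi @^-1` A) = (Phi t \in A) by apply/idP/idP; rewrite !inE.
case: ifP => _.
  by rewrite mulr1 ger0_norm.
by rewrite mulr0.
Qed.

(** The images under [Phi] of the positive and the negative part of [a] need not be mutually
    singular, which is why [rintE] allows any splitting of [nu]. The measurable substitute of [h] is
    its composition with [retr e]. *)
Lemma rint_rep (e : nat -> E) (a : T -> R) (nu : set E -> R) (h : E -> R) :
  (forall t, cspan e (Phi t)) -> rintegrable pi a ->
  (forall A, il_measurable A -> nu A = Rintegral pi setT (fun t => a t * \1_A (Phi t))) ->
  measurable_fun setT (fun x : ilBorel E => h (retr e x)) ->
  rintegrable pi (fun t => a t * h (Phi t)) ->
  rint nu h = Rintegral pi setT (fun t => a t * h (Phi t)).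
Proof.
move=> PhiW ia nuE mh iah; have ma := rintegrable_mf ia.
have map : measurable_fun setT (fun t => Num.max (a t) 0) by exact: measurable_maxr.
have man : measurable_fun setT (fun t => Num.max (- a t) 0).
  by apply: measurable_maxr => //; exact: measurableT_comp.
have iap : rintegrable pi (fun t => Num.max (a t) 0).
  apply: (rintegrable_le map (integrable_norm ia)) => t /=.
  by rewrite /Num.max; case: ltP => h0; rewrite ?normr0.
have ian : rintegrable pi (fun t => Num.max (- a t) 0).
  apply: (rintegrable_le man (integrable_norm ia)) => t /=.
  by rewrite /Num.max; case: ltP => h0; rewrite ?normr0 ?normrN.
have mm (x : R) : 0 <= Num.max x 0 by rewrite le_max lexx orbT.
have xE (x : R) : x = Num.max x 0 - Num.max (- x) 0.
  by rewrite /Num.max; case: ltP => h1; case: ltP => h2; lra.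
pose p : {finite_measure set (ilBorel E) -> \bar R} := image_measure (density iap) mPhi.
pose n : {finite_measure set (ilBorel E) -> \bar R} := image_measure (density ian) mPhi.
have hr t : h (retr e (Phi t)) = h (Phi t) by rewrite retr_id.
have mhP : measurable_fun setT (fun t => h (retr e (Phi t))) by exact: (measurableT_comp mh mPhi).
have ihp : rintegrable pi (fun t => h (retr e (Phi t)) * Num.max (a t) 0).
  apply: (rintegrable_le _ (integrable_norm iah)); first exact: measurable_funM.
  move=> t /=; rewrite hr mulrC !normrM ler_wpM2r//.
  by rewrite /Num.max; case: ltP => h0; rewrite ?normr0.
have ihn : rintegrable pi (fun t => h (retr e (Phi t)) * Num.max (- a t) 0).
  apply: (rintegrable_le _ (integrable_norm iah)); first exact: measurable_funM.
  move=> t /=; rewrite hr mulrC !normrM ler_wpM2r//.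
  by rewrite /Num.max; case: ltP => h0; rewrite ?normr0 ?normrN.
have null (b : T -> R) (ib : rintegrable pi b) : (forall t, 0 <= b t) ->
    image_measure (density ib) mPhi (~` cspan e) = 0%E.
  move=> b0; rewrite pushforward_density//; last first.
    by apply: (@measurableC _ (ilBorel E)); exact: cspan_measurable.
  rewrite (_ : (fun t => _) = cst 0) ?Rintegral_cst//= ?mul0r//.
  by apply/funext => t; rewrite indicE memNset ?mulr0//= => /(_ (PhiW t)).
have mEh : measurable_fun setT (EFin \o (fun x : ilBorel E => h (retr e x))).
  exact/measurable_EFinP.
rewrite (@rintE _ _ p n _ _ (cspan e) _ (fun x => h (retr e x))) //.
- rewrite /Rintegral.
  have -> := integral_pushforward mPhi mEh (integrable_density iap mhP ihp) measurableT.
  have -> := integral_pushforward mPhi mEh (integrable_density ian mhP ihn) measurableT.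
  rewrite preimage_setT.
  have := Rintegral_density iap mhP ihp; rewrite /Rintegral /= => ->.
  have := Rintegral_density ian mhP ihn; rewrite /Rintegral /= => ->.
  have nE (b : T -> R) : (fun t => (h (retr e (Phi t)) * `|Num.max (b t) 0|)%:E) =
      fun t => (h (retr e (Phi t)) * Num.max (b t) 0)%:E.
    by apply/funext => t; rewrite ger0_norm.
  rewrite !nE -fineB; try exact: integrable_fin_num.
  congr fine; rewrite -integralB_EFin//.
  by apply: eq_integral => t _; rewrite -EFinB -mulrBr -xE hr mulrC.
- move=> A mA; have -> : p A = _ := pushforward_density iap (fun=> mm _) mA.
  have -> : n A = _ := pushforward_density ian (fun=> mm _) mA.
  rewrite -EFinB nuE//.
  rewrite -RintegralB//; last 2 first.
  + exact: rintegrable_indic.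
  + exact: rintegrable_indic.
  by congr EFin; apply: eq_Rintegral => t _; rewrite -mulrBl -xE.
- exact: cspan_measurable.
- exact: (null _ iap (fun=> mm _)).
- exact: (null _ ian (fun=> mm _)).
- by move=> x Wx; rewrite retr_id.
- exact: (integrable_pushforward mPhi mEh (integrable_density iap mhP ihp) measurableT).
- exact: (integrable_pushforward mPhi mEh (integrable_density ian mhP ihn) measurableT).
Qed.
End Representation.

Lemma il_measurableI (R : realType) (E : lmodType R) (A B : set E) :
  il_measurable A -> il_measurable B -> il_measurable (A `&` B).
Proof. exact: (@measurableI _ (ilBorel E)). Qed.
Lemma il_measurableU (R : realType) (E : lmodType R) (A B : set E) :
  il_measurable A -> il_measurable B -> il_measurable (A `|` B).
Proof. exact: (@measurableU _ (ilBorel E)). Qed.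
Lemma il_measurableC (R : realType) (E : lmodType R) (A : set E) :
  il_measurable A -> il_measurable (~` A).
Proof. exact: (@measurableC _ (ilBorel E)). Qed.
Lemma il_measurableT (R : realType) (E : lmodType R) : il_measurable [set: E].
Proof. exact: (@measurableT _ (ilBorel E)). Qed.
Lemma il_measurable0 (R : realType) (E : lmodType R) : il_measurable (set0 : set E).
Proof. exact: (@measurable0 _ (ilBorel E)). Qed.
Lemma il_measurable_bigcup (R : realType) (E : lmodType R) (F : nat -> set E) :
  (forall i, il_measurable (F i)) -> il_measurable (\bigcup_i F i).
Proof. exact: (@bigcupT_measurable _ (ilBorel E)). Qed.

Lemma finite_measure_vanish d (T : measurableType d) (R : realType)
    (m : {finite_measure set T -> \bar R}) (D : nat -> set T) :
  (forall n, measurable (D n)) -> nonincreasing_seq D -> \bigcap_n D n = set0 ->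
  (fun n => fine (m (D n))) @ \oo --> (0 : R).
Proof.
move=> mD decD D0.
have := @nonincreasing_cvg_mu _ T R m D.
rewrite D0 measure0 => /(_ _ mD measurable0 decD) h.
by apply: fine_cvg; apply: h; rewrite -ge0_fin_numE// fin_num_measure.
Qed.

Lemma tv_ge0 (R : realType) (E : lmodType R) (mu : set E -> R[i]) A : (0 <= tv mu A)%E.
Proof.
apply: ereal_sup_ubound; exists 0%N, (fun=> set0); split; first by case.
  by case.
by rewrite big_ord0.
Qed.

Section CRep.
Context (R : realType) (E : lmodType R) d (T : measurableType d).
Variables (pi : {sigma_finite_measure set T -> \bar R}) (Phi : T -> ilBorel E).
Variables (u : T -> R[i]) (mu : set E -> R[i]).
Hypothesis muP : crep pi Phi u mu.

Let mPhi : measurable_fun setT Phi. Proof. by case: muP. Qed.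
Let iu : cintegrable pi u. Proof. by case: muP. Qed.

Lemma crepE A : il_measurable A -> mu A = Cint pi (fun t => u t * (\1_A (Phi t) : R)%:C).
Proof. by case: muP => _ _ -> mA; rewrite asboolT. Qed.

Lemma crep_out A : ~ il_measurable A -> mu A = 0.
Proof. by case: muP => _ _ -> mA; rewrite asboolF. Qed.

Lemma crep_Re A : il_measurable A ->
  complex.Re (mu A) = Rintegral pi setT (fun t => complex.Re (u t) * \1_A (Phi t)).
Proof.
move=> mA; rewrite crepE//=; apply: eq_Rintegral => t _.
by rewrite ReCM /= mulr0 subr0.
Qed.

Lemma crep_Im A : il_measurable A ->
  complex.Im (mu A) = Rintegral pi setT (fun t => complex.Im (u t) * \1_A (Phi t)).
Proof.
move=> mA; rewrite crepE//=; apply: eq_Rintegral => t _.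
by rewrite ImCM /= mulr0 add0r.
Qed.

Lemma cintegrable_indic A : il_measurable A ->
  cintegrable pi (fun t => u t * (\1_A (Phi t) : R)%:C).
Proof.
move=> mA; apply: (cintegrable_le _ (cintegrable_normc iu)).
  by apply: cmfM; [exact: (cintegrable_cmf iu)|exact/cmf_real/(indic_comp_measurable mPhi mA)].
move=> t; rewrite Normc.normcM normcR indicE; case: (_ \in _).
  by rewrite normr1 mulr1.
by rewrite normr0 mulr0 normc_ge0.
Qed.

Lemma cint_rep (e : nat -> E) (h : E -> R[i]) :
  (forall t, cspan e (Phi t)) -> cmf (fun x : ilBorel E => h (retr e x)) ->
  rintegrable pi (fun t => normc (u t) * normc (h (Phi t))) ->
  cint mu h = Cint pi (fun t => u t * h (Phi t)).
Proof.
move=> PhiW hm iuh; have [u1 u2] := iu; have [h1 h2] := hm.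
have [mu1 mu2] := cintegrable_cmf iu.
have hmP : cmf (fun t => h (Phi t)).
  by have := cmf_comp hm mPhi; under eq_fun do rewrite retr_id//.
have [hP1 hP2] := hmP.
have i11 : rintegrable pi (fun t => complex.Re (u t) * complex.Re (h (Phi t))).
  apply: (rintegrable_le _ iuh) => [|t]; first exact: measurable_funM.
  by rewrite normrM ler_pM// normc_Re.
have i12 : rintegrable pi (fun t => complex.Re (u t) * complex.Im (h (Phi t))).
  apply: (rintegrable_le _ iuh) => [|t]; first exact: measurable_funM.
  by rewrite normrM ler_pM// ?normc_Re ?normc_Im.
have i21 : rintegrable pi (fun t => complex.Im (u t) * complex.Re (h (Phi t))).
  apply: (rintegrable_le _ iuh) => [|t]; first exact: measurable_funM.
  by rewrite normrM ler_pM// ?normc_Re ?normc_Im.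
have i22 : rintegrable pi (fun t => complex.Im (u t) * complex.Im (h (Phi t))).
  apply: (rintegrable_le _ iuh) => [|t]; first exact: measurable_funM.
  by rewrite normrM ler_pM// ?normc_Re ?normc_Im.
rewrite /cint.
rewrite (rint_rep mPhi PhiW u1 crep_Re h1 i11) (rint_rep mPhi PhiW u1 crep_Re h2 i12).
rewrite (rint_rep mPhi PhiW u2 crep_Im h1 i21) (rint_rep mPhi PhiW u2 crep_Im h2 i22).
rewrite /Cint; congr (_ +i* _).
  by rewrite -RintegralB//; apply: eq_Rintegral => t _; rewrite ReCM.
by rewrite -RintegralD//; apply: eq_Rintegral => t _; rewrite ImCM.
Qed.

(** The image [vmeas] of the measure with density [|u|] dominates the variation of [mu]. It may be
    strictly larger, because [u] can cancel along the fibres of [Phi]. *)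
Definition vdens : {finite_measure set T -> \bar R} := density (cintegrable_normc iu).
Definition vmeas : {finite_measure set (ilBorel E) -> \bar R} := image_measure vdens mPhi.

Lemma vmeasE A : il_measurable A ->
  vmeas A = (Rintegral pi setT (fun t => normc (u t) * \1_A (Phi t)))%:E.
Proof.
move=> mA.
exact: (pushforward_density mPhi (cintegrable_normc iu) (fun=> normc_ge0 _) mA).
Qed.

Lemma normc_crep A : il_measurable A -> ((normc (mu A))%:E <= vmeas A)%E.
Proof.
move=> mA; rewrite vmeasE// lee_fin crepE//.
apply: le_trans (normc_Cint (cintegrable_indic mA)) _.
rewrite le_eqVlt; apply/orP; left; apply/eqP; apply: eq_Rintegral => t _.
by rewrite Normc.normcM normcR ger0_norm// indicE.
Qed.

Lemma tv_crep A : il_measurable A -> (tv mu A <= vmeas A)%E.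
Proof.
move=> mA; apply: ge_ereal_sup => _ [n [F [FA tF ->]]].
rewrite -sumEFin.
apply: (@le_trans _ _ (\sum_(i < n) vmeas (F i))%E).
  by apply: lee_sum => i _; apply: normc_crep; have [] := FA i.
rewrite -(measure_bigsetU_ord vmeas xpredT (F := F))//; last by move=> i; have [] := FA i.
apply: le_measure; rewrite ?inE//.
  by apply: (@bigsetU_measurable _ (ilBorel E)) => i _; have [] := FA i.
by elim/big_rec: _ => // i B _ BA x [Fx|/BA//]; have [_] := FA i; exact.
Qed.

Lemma crep_additive2 A B : il_measurable A -> il_measurable B -> A `&` B = set0 ->
  mu (A `|` B) = mu A + mu B.
Proof.
move=> mA mB AB; rewrite !crepE//; last exact: il_measurableU.
rewrite -CintD; try exact: cintegrable_indic.
apply: eq_Cint => t; rewrite -mulrDr -rmorphD; congr (_ * _%:C).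
rewrite !indicE in_setU; have [tA|tA] := boolP (Phi t \in A); have [tB|tB] := boolP (Phi t \in B).
- by exfalso; move: tA tB; rewrite !inE => a b; have : (A `&` B) (Phi t) by []; rewrite AB.
- by rewrite addr0.
- by rewrite add0r.
- by rewrite addr0.
Qed.

Lemma crep_set0 : mu set0 = 0.
Proof.
rewrite crepE; last exact: il_measurable0.
rewrite (_ : (fun t => _) = fun=> 0) ?Cint0//.
by apply/funext => t; rewrite indic0 mulr0.
Qed.

(** The error of the [n]-th partial sum is the measure of the tail [D n]. It is dominated by the
    value of the finite measure [vmeas] at [D n], and these sets decrease to the empty set. *)
Lemma crep_cmeasure : cmeasure mu.
Proof.
split; [exact: crep_set0|exact: crep_out|move=> F mF tF].
pose D n := \bigcup_i F (n + i)%N.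
have mD n : il_measurable (D n) by exact: il_measurable_bigcup.
have E1 n : \sum_(0 <= i < n) mu (F i) - mu (\bigcup_i F i) = - mu (D n).
  suff -> : mu (\bigcup_i F i) = \sum_(0 <= i < n) mu (F i) + mu (D n).
    by rewrite opprD addrA subrr add0r.
  elim: n => [|n ->]; first by rewrite big_nil add0r.
  rewrite big_nat_recr//= -addrA; congr (_ + _); rewrite -crep_additive2//.
    congr mu; apply/seteqP; split=> [x [[|i] _]|x [Fx|[i _]]].
    - by rewrite addn0; left.
    - by right; exists i => //; rewrite addSnnS.
    - by exists 0%N => //; rewrite addn0.
    - by exists i.+1 => //; rewrite -addSnnS.
  rewrite -subset0 => x [Fx [i _ Fx']].
  by have := tF n (n.+1 + i)%N I I (ex_intro _ x (conj Fx Fx')); lia.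
under eq_fun do rewrite E1 normcNN.
have dec : nonincreasing_seq D.
  move=> m n mn; apply/subsetPset => x [i _ Fx]; exists (n - m + i)%N => //.
  by rewrite addnA subnKC.
have D0 : \bigcap_n D n = set0.
  rewrite -subset0 => x Dx; have [i _ Fi] := Dx 0%N I.
  have [j _ Fj] := Dx i.+1 I.
  by have := tF _ _ I I (ex_intro _ x (conj Fi Fj)); lia.
have := finite_measure_vanish vmeas mD dec D0.
apply: squeeze_cvgr; last exact: cvg_cst.
apply: nearW => n; rewrite normc_ge0/=.
have fD := fin_num_measure vmeas _ (mD n).
by rewrite -lee_fin (fineK fD); exact: normc_crep.
Qed.

Lemma tvnorm_crep : tvnorm mu <= Rintegral pi setT (fun t => normc (u t)).
Proof.
have mT : il_measurable [set: E] by exact: il_measurableT.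
have := tv_crep mT; rewrite vmeasE//.
rewrite (_ : (fun t => _) = fun t => normc (u t)); last first.
  by apply/funext => t; rewrite indicT mulr1.
rewrite /tvnorm => h; rewrite -lee_fin fineK//.
rewrite ge0_fin_numE; first exact: le_lt_trans h (ltry _).
exact: tv_ge0.
Qed.

End CRep.

Lemma squeeze_dist (R : realType) (I : Type) (F : set_system I) {FF : Filter F}
    (f g : I -> R) (a : R) :
  (\forall n \near F, `|f n - a| <= g n) -> g @ F --> (0 : R) -> f @ F --> a.
Proof.
move=> fg g0; apply/cvgrPdist_lt => e e0.
move/cvgrPdist_lt : g0 => /(_ _ e0) ge.
apply: filterS2 fg ge => n h1 h2; rewrite distrC (le_lt_trans h1)//.
by move: h2; rewrite sub0r normrN => /(le_lt_trans (ler_norm _)).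
Qed.

(** * Total variation of a measure with a density *)

Section TotalVariation.
Context (R : realType) (E : lmodType R).
Variables (lam : {sigma_finite_measure set (ilBorel E) -> \bar R}).
Variables (u : ilBorel E -> R[i]) (mu : set E -> R[i]).
Hypothesis muP : crep lam (fun x => x) u mu.

Let iu : cintegrable lam u. Proof. by case: muP. Qed.
Let um : cmf u. Proof. exact: (cintegrable_cmf iu). Qed.
Let mid : measurable_fun setT ((fun x => x) : ilBorel E -> ilBorel E).
Proof. exact: measurable_id. Qed.

(* On [B] the values of [u] lie in a narrow cone around [q], so that there is
   almost no cancellation. *)
Lemma cone_bound (q : R[i]) (eps : R) (B : set E) : 0 < eps < 1 -> il_measurable B ->
  (forall x, B x -> normc (u x - q) <= eps * normc (u x)) ->
  (1 - eps) / (1 + eps) * Rintegral lam setT (fun x => normc (u x) * \1_B x) <= normc (mu B).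
Proof.
move=> /andP[e0 e1] mB uq.
have iB : rintegrable lam (fun x => normc (u x) * \1_B x).
  exact: (rintegrable_indic mid mB (cintegrable_normc iu)).
have e1' : 0 < 1 + eps by lra.
(* For [q = 0] the cone condition forces [u] to vanish on [B], as [eps < 1]. *)
have [q0|q0] := eqVneq q 0.
  rewrite (_ : (fun x => _) = cst 0).
    by rewrite Rintegral_cst// mul0r mulr0 normc_ge0.
  apply/funext => x /=; rewrite indicE.
  case: (boolP (x \in B)) => [/set_mem Bx|_]; last by rewrite mulr0.
  rewrite mulr1; apply/eqP; rewrite eq_le normc_ge0 andbT.
  have := uq _ Bx; rewrite q0 subr0 -subr_ge0.
  have -> : eps * normc (u x) - normc (u x) = - ((1 - eps) * normc (u x)) by ring.
  by rewrite oppr_ge0 pmulr_rle0//; lra.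
have qp : 0 < normc q.
  by rewrite lt_neqAle normc_ge0 andbT eq_sym; apply: contra q0 => /eqP/normc_eq0P ->.
have iqB := cintegrableZ q^* (cintegrable_indic muP mB).
rewrite -(ler_pM2l qp).
have -> : normc q * normc (mu B) = normc (q^* * mu B) by rewrite Normc.normcM normcJ_.
(* On [B] the real part of [q^* * u] is at least [(1 - eps) |u| ^ 2], since [q] differs from [u] by
   at most [eps |u|]. Moreover [|q| <= (1 + eps) |u|], which produces the quotient of the
   statement. *)
apply: (@le_trans _ _ (complex.Re (q^* * mu B))); last first.
  exact: le_trans (ler_norm _) (normc_Re _).
rewrite (crepE muP mB) -CintZ//; last exact: (cintegrable_indic muP mB).
rewrite -RintegralZl// -RintegralZl//; last exact: (rintegrableZ _ iB).
apply: le_Rintegral => //.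
- exact: (rintegrableZ _ (rintegrableZ _ iB)).
- by case: iqB.
have ReMr (z : R[i]) (b : R) : complex.Re (z * b%:C) = complex.Re z * b.
  by rewrite ReCM mulr0 subr0.
move=> x _; rewrite [X in complex.Re X]mulrA ReMr indicE.
case: (boolP (x \in B)) => [/set_mem Bx|_]; last by rewrite !mulr0.
rewrite !mulr1 /=; set n := normc (u x); have n0 : 0 <= n := normc_ge0 _.
have n2 : complex.Re (u x) ^+ 2 + complex.Im (u x) ^+ 2 = n ^+ 2.
  by rewrite /n normcE2 sqr_sqrtr// addr_ge0 ?sqr_ge0.
have uqx := uq _ Bx; rewrite -/n in uqx.
have hq : normc q <= (1 + eps) * n.
  have := normcD (q - u x) (u x); rewrite subrK normcBC -/n; lra.
have hre : - (eps * n * n) <= complex.Re ((q - u x)^* * u x).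
  have := le_trans (normc_Re ((q - u x)^* * u x)) (lexx _).
  rewrite Normc.normcM normcJ_ normcBC -/n ler_norml => /andP[h _].
  by apply: le_trans h; rewrite lerN2 ler_wpM2r.
have -> : complex.Re (q^* * u x) = complex.Re ((q - u x)^* * u x) + n ^+ 2.
  by rewrite -n2 !reimE; ring.
apply: (@le_trans _ _ ((1 - eps) * n * n)); last by lra.
have -> : normc q * ((1 - eps) / (1 + eps) * n) = (1 - eps) * n * (normc q / (1 + eps)).
  by rewrite mulrA mulrCA !mulrA [_ * n]mulrC; field; lra.
apply: ler_wpM2l; first by apply: mulr_ge0 => //; lra.
by rewrite ler_pdivrMr// mulrC.
Qed.

(** The set [A] is cut into countably many pieces, on each of which [u] is within relative distance
    [eps] of one complex number with rational parts. By [cone_bound] each piece retains at least the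
    fraction [(1 - eps) / (1 + eps)] of its mass, and finitely many pieces form a family allowed in
    [tv]. *)
Lemma tv_ge A : il_measurable A -> (vmeas muP A <= tv mu A)%E.
Proof.
move=> mA.
have key (eps : R) : 0 < eps < 1 -> (((1 - eps) / (1 + eps))%:E * vmeas muP A <= tv mu A)%E.
  move=> e01; have /andP[e0 e1] := e01.
  have c0 : 0 <= (1 - eps) / (1 + eps) by apply: divr_ge0; lra.
  pose q (k : nat) : R[i] := if unpickle k is Some (a, b) then ratr a +i* ratr b else 0.
  pose B k : set E := A `&` [set x | normc (u x - q k) <= eps * normc (u x)].
  have mB k : il_measurable (B k).
    apply: il_measurableI => //.
    have m1 : measurable_fun setT (fun x => normc (u x - q k)).
      by apply: cmf_normc; apply: cmfB => //; exact: cmf_cst.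
    have m2 : measurable_fun setT (fun x => eps * normc (u x)).
      by apply: measurable_funM; [exact: measurable_cst|exact: cmf_normc].
    have := measurable_fun_le measurableT m1 m2; rewrite setTI.
    exact.
  pose F := seqDU B.
  have mF k : il_measurable (F k) by apply: (@seqDU_measurable _ (ilBorel E)).
  have FB k : F k `<=` B k by exact: subset_seqDU.
  have AE : A = \bigcup_k F k.
    rewrite -seqDU_bigcup_eq; apply/seteqP; split=> [x Ax|x [k _ []]//].
    have [ux0|ux0] := eqVneq (u x) 0.
      (* Zeros of [u] belong to the piece of the rational point 0, because the inequality in [B] is
         not strict. *)
      exists (pickle (0 : rat, 0 : rat)) => //; split => //=.
      by rewrite /q pickleK ux0 !rmorph0 -[0 +i* 0]/(0 : R[i]) subr0 Normc.normc0 mulr0.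
    have nu0 : 0 < eps * normc (u x) / 2.
      apply: divr_gt0 => //; apply: mulr_gt0 => //.
      by rewrite lt_neqAle normc_ge0 andbT eq_sym; apply: contra ux0 => /eqP/normc_eq0P ->.
    have rat_near (y : R) : exists r : rat, `|y - ratr r| < eps * normc (u x) / 2.
      have lt : y - eps * normc (u x) / 2 < y + eps * normc (u x) / 2 by lra.
      have [r] := rat_in_itvoo lt; rewrite in_itv /= => /andP[h1 h2].
      by exists r; rewrite ltr_norml; apply/andP; split; lra.
    have [a ha] := rat_near (complex.Re (u x)); have [b hb] := rat_near (complex.Im (u x)).
    exists (pickle (a, b)) => //; split => //=; rewrite /q pickleK.
    apply: le_trans (normc_le _) _; rewrite !reimE /=; lra.
  have -> : vmeas muP A = (\sum_(k <oo) vmeas muP (F k))%E.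
    rewrite [in LHS]AE; apply/esym/cvg_lim => //.
    have := @measure_semi_sigma_additive _ _ _ (vmeas muP) F. apply => //; first exact: trivIset_seqDU.
    exact: il_measurable_bigcup.
  rewrite -nneseriesZl//.
  apply: lime_le; first by apply: is_cvg_nneseries => k _ _; apply: mule_ge0.
  apply: nearW => n.
  apply: (@le_trans _ _ (\sum_(i < n) normc (mu (F i)))%:E).
    rewrite big_mkord -sumEFin; apply: lee_sum => i _.
    rewrite vmeasE// -EFinM lee_fin.
    by apply: (cone_bound (q := q i)) => // x /FB[].
  apply: ereal_sup_ubound; exists n, (fun i : 'I_n => F i); split => //.
    by move=> i; split=> // x /FB[].
  by move=> i j _ _ /(@trivIset_seqDU _ B i j I I)/val_inj.
have fv : vmeas muP A \is a fin_num by exact: (fin_num_measure (vmeas muP)).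
apply/lee_mul01Pr => [|r /andP[r0 r1]]; first exact: measure_ge0.
(* This [eps] is the solution of [(1 - eps) / (1 + eps) = r]. *)
have := key ((1 - r) / (1 + r)).
have -> : (1 - (1 - r) / (1 + r)) / (1 + (1 - r) / (1 + r)) = r by field; lra.
apply; apply/andP; split; first by apply: divr_gt0; lra.
rewrite ltr_pdivrMr; lra.
Qed.

Lemma tvE A : il_measurable A -> tv mu A = vmeas muP A.
Proof. by move=> mA; apply/eqP; rewrite eq_le tv_ge// tv_crep. Qed.

End TotalVariation.

(** * Existence of densities by the Radon-Nikodym theorem *)

Section PartCharges.
Context (R : realType) (E : lmodType R) (mu : set E -> R[i]).
Hypothesis cmu : cmeasure mu.

Definition re_charge & cmeasure mu := fun A : set (ilBorel E) => (complex.Re (mu A))%:E.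
Definition im_charge & cmeasure mu := fun A : set (ilBorel E) => (complex.Im (mu A))%:E.

Let cvg_parts (F : nat -> set E) : (forall i, il_measurable (F i)) -> trivIset setT F ->
  (fun n => \sum_(0 <= i < n) complex.Re (mu (F i))) @ \oo --> complex.Re (mu (\bigcup_i F i)) /\
  (fun n => \sum_(0 <= i < n) complex.Im (mu (F i))) @ \oo --> complex.Im (mu (\bigcup_i F i)).
Proof.
have [_ _ sa] := cmu; move=> mF tF; have h := sa F mF tF.
split; apply: squeeze_dist h; apply: nearW => n.
  by rewrite -Re_sumC -ReCN -ReCD normc_Re.
by rewrite -Im_sumC -ImCN -ImCD normc_Im.
Qed.

Let re0 : re_charge cmu set0 = 0%E. Proof. by have [h _ _] := cmu; rewrite /re_charge h. Qed.
Let im0 : im_charge cmu set0 = 0%E. Proof. by have [h _ _] := cmu; rewrite /im_charge h. Qed.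
Let re_fin A : measurable A -> re_charge cmu A \is a fin_num. Proof. by []. Qed.
Let im_fin A : measurable A -> im_charge cmu A \is a fin_num. Proof. by []. Qed.
Let re_sa : semi_sigma_additive (re_charge cmu).
Proof.
move=> F mF tF _; rewrite /re_charge; under eq_fun do rewrite sumEFin.
by apply: cvg_EFin; [exact: nearW|exact: (cvg_parts mF tF).1].
Qed.
Let im_sa : semi_sigma_additive (im_charge cmu).
Proof.
move=> F mF tF _; rewrite /im_charge; under eq_fun do rewrite sumEFin.
by apply: cvg_EFin; [exact: nearW|exact: (cvg_parts mF tF).2].
Qed.
HB.instance Definition _ := isCharge.Build _ _ _ (re_charge cmu) re0 re_fin re_sa.
HB.instance Definition _ := isCharge.Build _ _ _ (im_charge cmu) im0 im_fin im_sa.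

End PartCharges.

Lemma finite_measure_sum d (T : measurableType d) (R : realType)
    (m1 m2 : {finite_measure set T -> \bar R}) :
  exists lam : {finite_measure set T -> \bar R}, forall A, lam A = (m1 A + m2 A)%E.
Proof.
pose m := msum (fun n => if n is 0%N then m1 : {measure set T -> \bar R} else m2) 2.
have mE A : m A = (m1 A + m2 A)%E by exact: measure_addE.
have fin : fin_num_fun m by move=> A mA; rewrite mE fin_numD !fin_num_measure.
pose lam : {finite_measure set T -> \bar R} :=
  HB.pack m (Measure_isFinite.Build _ _ _ m fin).
by exists lam.
Qed.

Lemma charge_variation_dominates d (T : measurableType d) (R : realType)
    (nu : {charge set T -> \bar R}) : exists lam : {finite_measure set T -> \bar R}, nu `<< lam.
Proof.
have [P [N PN]] := Hahn_decomposition nu.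
pose jp : {finite_measure set T -> \bar R} := jordan_pos PN.
pose jn : {finite_measure set T -> \bar R} := jordan_neg PN.
have [lam lamE] := finite_measure_sum jp jn.
exists lam; apply/null_content_dominatesP => A mA lam0.
have : (jp A + jn A == 0)%E by rewrite -lamE; exact/eqP.
rewrite padde_eq0 ?measure_ge0// => /andP[/eqP p0 /eqP n0].
rewrite (jordan_decomp PN mA).
have -> : cadd (jordan_pos PN) (cscale (-1) (jordan_neg PN)) A =
    (jp A + cscale (-1) (jordan_neg PN) A)%E by [].
by rewrite cscaleN1 p0 add0e; apply/eqP; rewrite oppe_eq0; apply/eqP.
Qed.

Lemma dominates_le d (T : measurableType d) (R : realType) (nu : {charge set T -> \bar R})
    (l lam : {finite_measure set T -> \bar R}) :
  (forall A, measurable A -> (l A <= lam A)%E) -> nu `<< l -> nu `<< lam.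
Proof.
move=> le /null_content_dominatesP h; apply/null_content_dominatesP => A mA A0.
by apply: h => //; apply/eqP; rewrite eq_le measure_ge0 andbT -A0; exact: le.
Qed.

Section ExistsRep.
Context (R : realType) (E : lmodType R) (mu : set E -> R[i]).
Hypothesis cmu : cmeasure mu.

Lemma exists_dominating : exists lam : {finite_measure set (ilBorel E) -> \bar R},
  re_charge cmu `<< lam /\ im_charge cmu `<< lam.
Proof.
have [l1 d1] := charge_variation_dominates (re_charge cmu).
have [l2 d2] := charge_variation_dominates (im_charge cmu).
have [lam lamE] := finite_measure_sum l1 l2.
exists lam; split.
  by apply: dominates_le d1 => A mA; rewrite lamE leeDl.
by apply: dominates_le d2 => A mA; rewrite lamE leeDr.
Qed.

Lemma dominated_crep (lam : {finite_measure set (ilBorel E) -> \bar R}) :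
  re_charge cmu `<< lam -> im_charge cmu `<< lam ->
  exists u, crep lam (fun x => x) u mu.
Proof.
move=> D1 D2.
pose a := Radon_Nikodym (re_charge cmu) lam; pose b := Radon_Nikodym (im_charge cmu) lam.
pose u (x : ilBorel E) : R[i] := fine (a x) +i* fine (b x).
have aE x : (fine (a x))%:E = a x by rewrite fineK//; exact: Radon_Nikodym_fin_num.
have bE x : (fine (b x))%:E = b x by rewrite fineK//; exact: Radon_Nikodym_fin_num.
have iu : cintegrable lam u.
  split => /=.
    by under eq_fun do rewrite aE; exact: Radon_Nikodym_integrable.
  by under eq_fun do rewrite bE; exact: Radon_Nikodym_integrable.
exists u; split=> //; apply/funext => A; case: asboolP => mA; last first.
  by have [_ h _] := cmu; exact: h.
have int (f : ilBorel E -> R) : Rintegral lam setT (fun t => f t * \1_A t) =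
    fine (\int[lam]_(t in A) (f t)%:E)%E.
  rewrite /Rintegral [in RHS]integral_mkcond; congr fine; apply: eq_integral => t _.
  by rewrite patchE indicE; case: ifP => _; rewrite ?mulr1 ?mulr0.
apply: eq_ReIm.
  transitivity (Rintegral lam setT (fun t => fine (a t) * \1_A t)); last first.
    by apply: eq_Rintegral => t _; rewrite ReCM mulr0 subr0.
  rewrite int; under eq_integral do rewrite aE.
  by rewrite -(Radon_Nikodym_integral D1 mA).
transitivity (Rintegral lam setT (fun t => fine (b t) * \1_A t)); last first.
  by apply: eq_Rintegral => t _; rewrite ImCM mulr0 add0r.
rewrite int; under eq_integral do rewrite bE.
by rewrite -(Radon_Nikodym_integral D2 mA).
Qed.

Lemma exists_crep : exists (lam : {finite_measure set (ilBorel E) -> \bar R}) u,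
  crep lam (fun x => x) u mu.
Proof.
by have [lam [D1 D2]] := exists_dominating; exists lam; exact: dominated_crep.
Qed.

Lemma crep_on lam u W : crep lam (fun x => x) u mu -> il_measurable W ->
  (forall A, il_measurable A -> mu A = mu (A `&` W)) ->
  crep lam (fun x => x) (fun x => u x * (\1_W x : R)%:C) mu.
Proof.
move=> ru mW muW; have [mid iu muE] := ru.
split => //; first exact: (cintegrable_indic ru mW).
apply/funext => A; case: asboolP => mA; last by have [_ h _] := cmu; exact: h.
rewrite muW// (crepE ru); last exact: il_measurableI.
apply: eq_Cint => x; rewrite -mulrA -rmorphM; congr (_ * _%:C).
by rewrite setIC indicI.
Qed.

(** The density is made to vanish everywhere off [W], not only almost everywhere; then values of an
    integrand off [W], and the effect of [retr] there, disappear pointwise. *)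
Lemma exists_crep_on W : il_measurable W ->
  (forall A, il_measurable A -> mu A = mu (A `&` W)) ->
  exists (lam : {finite_measure set (ilBorel E) -> \bar R}) u,
  crep lam (fun x => x) u mu /\ forall x, ~ W x -> u x = 0.
Proof.
move=> mW muW; have [lam [u ru]] := exists_crep.
exists lam, (fun x => u x * (\1_W x : R)%:C); split; first exact: crep_on.
by move=> x Wx; rewrite indicE memNset// mulr0.
Qed.

End ExistsRep.

(** With one dominating measure the densities can be added; this is how linearity of [cint] in the
    measure is obtained. *)
Lemma exists_crep2 (R : realType) (E : lmodType R) (mu nu : set E -> R[i]) :
  cmeasure mu -> cmeasure nu ->
  exists (lam : {finite_measure set (ilBorel E) -> \bar R}) u v,
  crep lam (fun x => x) u mu /\ crep lam (fun x => x) v nu.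
Proof.
move=> cmu cnu.
have [l1 [D1 D1']] := exists_dominating cmu; have [l2 [D2 D2']] := exists_dominating cnu.
have [lam lamE] := finite_measure_sum l1 l2.
have le1 A : measurable A -> (l1 A <= lam A)%E by move=> mA; rewrite lamE leeDl.
have le2 A : measurable A -> (l2 A <= lam A)%E by move=> mA; rewrite lamE leeDr.
have [u ru] := dominated_crep (dominates_le le1 D1) (dominates_le le1 D1').
have [v rv] := dominated_crep (dominates_le le2 D2) (dominates_le le2 D2').
by exists lam, u, v.
Qed.

(** * Total variation norm and concentration *)

Section TVBasics.
Context (R : realType) (E : lmodType R).
Implicit Types (mu nu : set E -> R[i]) (A B W : set E).

Lemma cmeasure0 mu : cmeasure mu -> mu set0 = 0. Proof. by case. Qed.
Lemma cmeasure_out mu A : cmeasure mu -> ~ il_measurable A -> mu A = 0.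
Proof. by case=> _ h _; exact: h. Qed.

Lemma cmeasureU mu A B : cmeasure mu -> il_measurable A -> il_measurable B ->
  A `&` B = set0 -> mu (A `|` B) = mu A + mu B.
Proof. by move=> /exists_crep[lam [u r]]; exact: (crep_additive2 r). Qed.

Lemma cmeasureD mu A B : cmeasure mu -> il_measurable A -> il_measurable B ->
  mu A = mu (A `&` B) + mu (A `&` ~` B).
Proof.
move=> cmu mA mB; rewrite -cmeasureU//.
- by rewrite -setIUr setUv setIT.
- exact: il_measurableI.
- by apply: il_measurableI => //; exact: il_measurableC.
- by rewrite setIACA setICr setI0.
Qed.

Lemma tv_measure mu : cmeasure mu -> exists m : {finite_measure set (ilBorel E) -> \bar R},
  forall A, il_measurable A -> tv mu A = m A.
Proof.
move=> /exists_crep[lam [u r]]; exists (vmeas r) => A mA; exact: tvE.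
Qed.

Lemma tv_fin mu : cmeasure mu -> tv mu setT \is a fin_num.
Proof.
move=> /tv_measure[m ->]; last exact: il_measurableT.
exact: fin_num_measure.
Qed.

Lemma tvnormE mu : cmeasure mu -> (tvnorm mu)%:E = tv mu setT.
Proof. by move=> cmu; rewrite /tvnorm fineK// tv_fin. Qed.

Lemma tvnorm_ge0 mu : 0 <= tvnorm mu.
Proof. by rewrite /tvnorm fine_ge0// tv_ge0. Qed.

Lemma normc_tv mu A : il_measurable A -> ((normc (mu A))%:E <= tv mu A)%E.
Proof.
move=> mA; apply: ereal_sup_ubound; exists 1%N, (fun=> A); split.
- by move=> _; split.
- by move=> i j _ _ _; rewrite !ord1.
by rewrite big_ord1.
Qed.

Lemma tv_mono mu A B : A `<=` B -> (tv mu A <= tv mu B)%E.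
Proof.
move=> AB; apply: ge_ereal_sup => _ [n [F [FA tF ->]]].
apply: ereal_sup_ubound.
by exists n, F; split=> // i; have [? FiA] := FA i; split=> // x /FiA /AB.
Qed.

Lemma normc_tvnorm mu A : cmeasure mu -> normc (mu A) <= tvnorm mu.
Proof.
move=> cmu; have [mA|mA] := pselect (il_measurable A); last first.
  by rewrite cmeasure_out// Normc.normc0 tvnorm_ge0.
rewrite -lee_fin tvnormE//; apply: le_trans (normc_tv _ mA) _.
exact: tv_mono.
Qed.

Lemma tvnorm_le mu (c : R) : 0 <= c ->
  (forall n (F : 'I_n -> set E), (forall i, il_measurable (F i)) -> trivIset setT F ->
    \sum_(i < n) normc (mu (F i)) <= c) -> tvnorm mu <= c.
Proof.
move=> c0 h.
have le : (tv mu setT <= c%:E)%E.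
  apply: ge_ereal_sup => _ [n [F [FA tF ->]]]; rewrite lee_fin; apply: h => // i.
  by have [] := FA i.
rewrite /tvnorm -lee_fin fineK// ge0_fin_numE ?tv_ge0//.
exact: le_lt_trans le (ltry _).
Qed.

Lemma sum_tvnorm mu n (F : 'I_n -> set E) : cmeasure mu ->
  (forall i, il_measurable (F i)) -> trivIset setT F ->
  \sum_(i < n) normc (mu (F i)) <= tvnorm mu.
Proof.
move=> cmu mF tF; rewrite -lee_fin tvnormE//; apply: ereal_sup_ubound.
by exists n, F.
Qed.

Lemma cmeasure_lin (a : R[i]) mu nu : cmeasure mu -> cmeasure nu -> cmeasure (a *: mu + nu).
Proof.
move=> [mu0 muo mus] [nu0 nuo nus].
have lE A : (a *: mu + nu) A = a * mu A + nu A by [].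
split.
- by rewrite lE mu0 nu0 mulr0 addr0.
- by move=> A mA; rewrite lE muo// nuo// mulr0 addr0.
move=> F mF tF.
have h : (fun n => normc a * normc (\sum_(0 <= i < n) mu (F i) - mu (\bigcup_i F i)) +
    normc (\sum_(0 <= i < n) nu (F i) - nu (\bigcup_i F i))) @ \oo --> (0 : R).
  rewrite -[X in _ --> X](addr0 0) -[X in _ --> (X + _)](mulr0 (normc a)).
  by apply: cvgD; [apply: cvgM; [exact: cvg_cst|exact: mus]|exact: nus].
apply: squeeze_cvgr (cvg_cst _) h; apply: nearW => n.
rewrite normc_ge0 /= -Normc.normcM; apply: le_trans (normcD _ _).
rewrite le_eqVlt; apply/orP; left; apply/eqP; congr normc.
by rewrite mulrBr mulr_sumr addrACA -opprD -big_split.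
Qed.

Lemma cmeasure_zero : cmeasure (0 : set E -> R[i]).
Proof.
split=> // F _ _.
by under eq_fun do rewrite big1// subr0 Normc.normc0; exact: cvg_cst.
Qed.

Lemma cmeasureB mu nu : cmeasure mu -> cmeasure nu -> cmeasure (mu - nu).
Proof.
move=> cmu cnu; rewrite (_ : mu - nu = (-1) *: nu + mu); first exact: cmeasure_lin.
by rewrite scaleN1r addrC.
Qed.

Lemma tvnorm_lin (a : R[i]) mu nu : cmeasure mu -> cmeasure nu ->
  tvnorm (a *: mu + nu) <= normc a * tvnorm mu + tvnorm nu.
Proof.
move=> cmu cnu; apply: tvnorm_le.
  by rewrite addr_ge0 ?tvnorm_ge0// mulr_ge0 ?normc_ge0 ?tvnorm_ge0.
move=> n F mF tF.
apply: (@le_trans _ _ (\sum_(i < n) (normc a * normc (mu (F i)) + normc (nu (F i))))).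
  by apply: ler_sum => i _; rewrite -Normc.normcM; exact: normcD.
rewrite big_split /= -mulr_sumr lerD ?ler_wpM2l ?normc_ge0//; exact: sum_tvnorm.
Qed.

Lemma tvnorm0 : tvnorm (0 : set E -> R[i]) = 0.
Proof.
apply/eqP; rewrite eq_le tvnorm_ge0 andbT; apply: tvnorm_le => // n F _ _.
by rewrite big1// => i _; exact: Normc.normc0.
Qed.

Lemma tvnorm_eq0 mu : cmeasure mu -> tvnorm mu = 0 -> mu = 0.
Proof.
move=> cmu mu0; apply/funext => A; apply: normc_eq0P; apply/eqP.
by rewrite eq_le normc_ge0 andbT -mu0 normc_tvnorm.
Qed.

Lemma tvnormZ (a : R[i]) mu : cmeasure mu -> tvnorm (a *: mu) = normc a * tvnorm mu.
Proof.
move=> cmu; have le b nu : cmeasure nu -> tvnorm (b *: nu) <= normc b * tvnorm nu.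
  move=> cnu; have := tvnorm_lin b cnu cmeasure_zero.
  by rewrite tvnorm0 !addr0.
apply/eqP; rewrite eq_le le//=.
have [->|a0] := eqVneq a 0; first by rewrite Normc.normc0 mul0r tvnorm_ge0.
have ap : 0 < normc a.
  by rewrite lt_neqAle normc_ge0 andbT eq_sym; apply: contra a0 => /eqP/normc_eq0P ->.
have c : cmeasure (a *: mu).
  by have := cmeasure_lin a cmu cmeasure_zero; rewrite addr0.
have := le a^-1 _ c; rewrite scalerA mulVf// scale1r Normc.normcV.
by rewrite mulrC ler_pdivlMr// mulrC.
Qed.

Lemma tvnormN mu : tvnorm (- mu) = tvnorm mu.
Proof.
rewrite /tvnorm /tv; congr fine; congr ereal_sup; apply/seteqP.
by split=> _ [n [F [h1 h2 ->]]]; exists n, F; split=> //; congr EFin;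
  apply: eq_bigr => i _; rewrite normcNN.
Qed.

Lemma tvnormD mu nu : cmeasure mu -> cmeasure nu -> tvnorm (mu + nu) <= tvnorm mu + tvnorm nu.
Proof. by move=> cmu cnu; have := tvnorm_lin 1 cmu cnu; rewrite scale1r Normc.normc1 mul1r. Qed.

Lemma tvnormBC mu nu : tvnorm (mu - nu) = tvnorm (nu - mu).
Proof. by rewrite -tvnormN opprB. Qed.

Definition conc W mu := forall A, il_measurable A -> mu A = mu (A `&` W).

Definition restr B mu : set E -> R[i] :=
  fun A => if `[< il_measurable A >] then mu (A `&` B) else 0.

Lemma concS W W' mu : cmeasure mu -> il_measurable W' ->
  W `<=` W' -> conc W mu -> conc W' mu.
Proof.
move=> cmu mW' WW' cW A mA; rewrite cW// [RHS]cW; last exact: il_measurableI.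
by rewrite -setIA (setIidr WW').
Qed.

Lemma conc_restr B mu : il_measurable B -> conc B (restr B mu).
Proof.
move=> mB A mA; rewrite /restr !asboolT//; last exact: il_measurableI.
by rewrite -setIA setIid.
Qed.

Lemma cmeasure_restr B mu : il_measurable B -> cmeasure mu -> cmeasure (restr B mu).
Proof.
move=> mB [mu0 muo mus]; split.
- by rewrite /restr; case: asboolP => // _; rewrite set0I.
- by move=> A mA; rewrite /restr asboolF.
move=> F mF tF; rewrite /restr asboolT; last exact: il_measurable_bigcup.
rewrite setI_bigcupl; under eq_fun do (under eq_bigr do rewrite asboolT//).
apply: mus; first by move=> i; exact: il_measurableI.
by apply: trivIset_setIr.
Qed.

Lemma tvnorm_restr B mu : il_measurable B -> cmeasure mu ->
  ((tvnorm (mu - restr B mu))%:E <= tv mu (~` B))%E.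
Proof.
move=> mB cmu; have mBc := il_measurableC mB.
have [m mE] := tv_measure cmu.
have f : tv mu (~` B) \is a fin_num by rewrite mE// fin_num_measure.
rewrite -(fineK f) lee_fin; apply: tvnorm_le; first by rewrite fine_ge0// tv_ge0.
move=> n F mF tF; rewrite -lee_fin fineK//; apply: ereal_sup_ubound.
exists n, (fun i => F i `&` ~` B); split.
- by move=> i; split; [exact: il_measurableI|exact: subIsetr].
- exact: trivIset_setIr.
congr EFin; apply: eq_bigr => i _; congr normc.
have -> : (mu - restr B mu) (F i) = mu (F i) - restr B mu (F i) by [].
by rewrite (cmeasureD cmu (mF i) mB) /restr asboolT// addrC addKr.
Qed.

Lemma conc_limit W mu : il_measurable W -> cmeasure mu ->
  (forall e : R, 0 < e -> exists nu, [/\ cmeasure nu, conc W nu & tvnorm (mu - nu) < e]) ->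
  conc W mu.
Proof.
move=> mW cmu h A mA; have mAW := il_measurableI mA (il_measurableC mW).
rewrite (cmeasureD cmu mA mW); suff -> : mu (A `&` ~` W) = 0 by rewrite addr0.
apply: normc_eq0P; apply/eqP; rewrite eq_le normc_ge0 andbT.
apply/ler_addgt0Pr => e /h[nu [cnu Wnu lt]]; rewrite add0r.
apply: le_trans (ltW lt); have := normc_tvnorm (A `&` ~` W) (cmeasureB cmu cnu).
have -> : (mu - nu) (A `&` ~` W) = mu (A `&` ~` W) - nu (A `&` ~` W) by [].
by rewrite Wnu// -setIA setICl setI0 cmeasure0// subr0.
Qed.

(** The variation of [mu] off [B n] bounds the norm of what the restriction removes. It equals the
    variation of [D n], and these parts of the carrier decrease to the empty set. *)
Lemma restr_approx (B : nat -> set E) mu (e : R) : (forall n, il_measurable (B n)) ->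
  nondecreasing_seq B -> cmeasure mu -> conc (\bigcup_n B n) mu -> 0 < e ->
  exists n, tvnorm (mu - restr (B n) mu) < e.
Proof.
move=> mB ndB cmu cB e0; set W := \bigcup_n B n.
have mW : il_measurable W by exact: il_measurable_bigcup.
have [m mE] := tv_measure cmu.
pose D n := W `&` ~` B n.
have mD n : il_measurable (D n) by apply: il_measurableI => //; exact: il_measurableC.
have dec : nonincreasing_seq D.
  move=> i j ij; apply/subsetPset; apply: setIS; apply: subsetC.
  by apply/subsetPset; exact: ndB.
have D0 : \bigcap_n D n = set0.
  by rewrite -subset0 => x Dx; have [[k _ Bx] _] := Dx 0%N I; have [_] := Dx k I.
have v := finite_measure_vanish m mD dec D0.
have /cvgrPdist_lt/(_ _ e0)[k _ /(_ k (leqnn k))/=] := v.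
rewrite sub0r normrN ger0_norm ?fine_ge0// => lt.
exists k; rewrite -lte_fin; apply: le_lt_trans (tvnorm_restr (mB k) cmu) _.
rewrite mE; last exact: il_measurableC.
have mk : m (~` B k) = m (D k).
  have -> : ~` B k = D k `|` ~` W.
    rewrite /D setUIl setUv setTI; apply/esym/setUidl; apply: subsetC.
    by move=> x Bx; exists k.
  have mW0 : m (~` W) = 0%E.
    apply/eqP; rewrite eq_le measure_ge0 andbT -mE; last exact: il_measurableC.
    apply: ge_ereal_sup => _ [n [F [FW tF ->]]]; rewrite lee_fin big1// => i _.
    have [mF FWc] := FW i; rewrite cB// (_ : F i `&` W = set0) ?cmeasure0 ?Normc.normc0//.
    by rewrite -subset0 => x [/FWc].
  have -> : m (D k `|` ~` W) = (m (D k) + m (~` W))%E.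
    apply: measureU; [exact: mD|exact: il_measurableC|].
    by rewrite /D setIAC setICr set0I.
  by rewrite mW0 adde0.
have fD : m (D k) \is a fin_num by exact: (fin_num_measure m _ (mD k)).
by rewrite mk -(fineK fD) lte_fin. 
Qed.

End TVBasics.

(** * The norm closures characterized by their carriers *)

Section MEChar.
Context (R : realType) (E : lmodType R).
Implicit Types (mu nu : set E -> R[i]) (D : set E).

Lemma countable_range D : countable D -> exists d : nat -> E, D `<=` range d.
Proof.
move=> /countable_injP[g gi].
exists (fun k => xget 0 [set x | D x /\ g x = k]) => x Dx.
exists (g x) => //; case: xgetP => [y _ [Dy gy]|/(_ x)]; last by case.
by apply: gi; rewrite ?inE.
Qed.

Lemma seq_measurable (s : seq E) : il_measurable [set x | x \in s].
Proof.
elim: s => [|y s IH].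
  rewrite (_ : [set x | _] = set0); first exact: il_measurable0.
  by rewrite -subset0 => x.
rewrite (_ : [set x | _] = [set y] `|` [set x | x \in s]).
  by apply: il_measurableU => //; exact: set1_measurable.
apply/seteqP; split=> x /=; rewrite inE.
  by move=> /orP[/eqP ->|]; [left|right].
by move=> [->|->]; rewrite ?eqxx ?orbT.
Qed.

Lemma countable_il_measurable D : countable D -> il_measurable D.
Proof.
move=> /countable_range[d Dd].
have -> : D = \bigcup_k ([set d k] `&` D).
  apply/seteqP; split=> [x Dx|x [k _ []]//].
  by have [k _ kx] := Dd _ Dx; exists k.
apply: il_measurable_bigcup => k.
have [Dk|Dk] := pselect (D (d k)).
  rewrite (_ : _ `&` _ = [set d k]); first exact: set1_measurable.
  by apply/seteqP; split=> [x []//|x ->].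
rewrite (_ : _ `&` _ = set0); first exact: il_measurable0.
by rewrite -subset0 => x [-> /Dk].
Qed.

Definition firsts (d : nat -> E) n : set E := [set x | x \in [seq d i | i <- iota 0 n]].

Lemma firsts_bigcup (d : nat -> E) : \bigcup_n firsts d n = range d.
Proof.
apply/seteqP; split=> [x [n _ /mapP[i _ ->]]|_ [k _ <-]]; first by exists i.
by exists k.+1 => //; apply: map_f; rewrite mem_iota add0n ltnS /=.
Qed.

Lemma firsts_nondecreasing (d : nat -> E) : nondecreasing_seq (firsts d).
Proof.
move=> m n mn; apply/subsetPset => x /mapP[i + ->]; rewrite !mem_iota add0n => ilt.
by apply: map_f; rewrite mem_iota add0n (leq_trans ilt mn).
Qed.

Lemma firsts_spann (d : nat -> E) n : firsts d n `<=` spann d n.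
Proof. by move=> x /mapP[i + ->]; rewrite mem_iota add0n => ilt; exact: spann_gen. Qed.

Lemma spann_nondecreasing (d : nat -> E) : nondecreasing_seq (spann d).
Proof. by move=> m n mn; apply/subsetPset; exact: spann_mono. Qed.

(** A point of the closure is the limit of a sequence, hence is carried by every measurable set that
    contains the countably many carriers of the approximants. The property [P] stands for
    countability or for inclusion in a countable span. *)
Lemma conc_fin_limit (S : set (set E -> R[i])) (P : set E -> Prop) mu :
  (forall nu, S nu -> cmeasure nu /\ exists2 W, P W & conc W nu) ->
  (forall W : nat -> set E, (forall n, P (W n)) ->
    exists2 W', il_measurable W' & forall n, W n `<=` W' ) ->
  tv_closure S mu -> exists W : nat -> set E, (forall n, P (W n)) /\
    forall W', il_measurable W' -> (forall n, W n `<=` W') -> conc W' mu.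
Proof.
move=> SP _ [cmu h].
have ex n : exists W, P W /\ exists nu, [/\ cmeasure nu, conc W nu & tvnorm (mu - nu) < n.+1%:R^-1].
  have [|nu Snu lt] := h n.+1%:R^-1; first by rewrite invr_gt0.
  by have [cnu [W PW cW]] := SP _ Snu; exists W; split=> //; exists nu.
have [W WP] := choice ex; exists W; split=> [n|W' mW' WW']; first by have [] := WP n.
apply: conc_limit => // e e0.
have [n hn] : exists n : nat, n.+1%:R^-1 < e.
  exists (Num.truncn e^-1); rewrite invf_plt ?posrE//.
  exact: truncnS_gt.
have [_ [nu [cnu cW lt]]] := WP n; exists nu; split=> //; last exact: lt_trans hn.
exact: concS (WW' n) cW.
Qed.

Lemma MEP mu : ME mu <-> cmeasure mu /\ exists e, conc (cspan e) mu.
Proof.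
split=> [muP|[cmu [e ce]]].
  have [cmu _] := muP; split=> //.
  have [||W [WP cW]] := conc_fin_limit (P := fun W => exists e, W `<=` cspan e) _ _ muP.
  - move=> nu [V Vf [cnu cV]]; split=> //; exists V => //; exact: findim_cspan.
  - move=> W WP; have [e eP] := choice WP; exists (cspan (joined e)).
      exact: cspan_measurable.
    by move=> n; apply: subset_trans (eP n) _; exact: cspan_joined.
  have [e eP] := choice WP; exists (joined e); apply: cW; first exact: cspan_measurable.
  by move=> n; apply: subset_trans (eP n) _; exact: cspan_joined.
split=> // eps eps0.
have mV n : il_measurable (spann e n) by exact: findim_measurable (spann_findim e n).
have [n lt] := restr_approx mV (spann_nondecreasing e) cmu ce eps0.
exists (restr (spann e n) mu) => //; exists (spann e n); first exact: spann_findim.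
by split; [exact: cmeasure_restr|exact: conc_restr].
Qed.

Lemma ME_cmeasure mu : ME mu -> cmeasure mu. Proof. by case. Qed.

(** Countable sets are measurable and closed under countable unions, so a limit keeps a countable
    carrier. Conversely a countable carrier is exhausted by the finite sets [firsts d n], which lie
    in finite dimensional subspaces. *)
Lemma ME_dP mu : ME_d mu <-> cmeasure mu /\ discrete mu.
Proof.
split=> [muP|[cmu [D Dc cD]]].
  have [cmu _] := muP; split=> //.
  have [||W [WP cW]] := conc_fin_limit (P := fun W => countable W) _ _ muP.
  - by move=> nu [V Vf [[cnu _] [D Dc cD]]]; split=> //; exists D.
  - move=> W WP; exists (\bigcup_n W n); last by move=> n x; exists n.
    by apply: countable_il_measurable; apply: bigcup_countable.
  have cW' : countable (\bigcup_n W n) by apply: bigcup_countable.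
  by exists (\bigcup_n W n) => //; apply: cW; [exact: countable_il_measurable|move=> n x; exists n].
split=> // eps eps0.
have [d Dd] := countable_range Dc.
have cd : conc (\bigcup_n firsts d n) mu.
  apply: concS cD => //; last by rewrite firsts_bigcup.
  by apply: il_measurable_bigcup => n; exact: seq_measurable.
have mf n : il_measurable (firsts d n) by exact: seq_measurable.
have [n lt] := restr_approx mf (firsts_nondecreasing d) cmu cd eps0.
exists (restr (firsts d n) mu) => //.
exists (spann d n); first exact: spann_findim.
have c1 : cmeasure (restr (firsts d n) mu) by exact: cmeasure_restr.
split; first split => //.
  apply: (concS c1 _ (firsts_spann (d := d) (n := n))); last exact: conc_restr.
  exact: findim_measurable (spann_findim d n).
exists (firsts d n); last exact: conc_restr.
by apply: sub_countable (countableP [set` [seq d i | i <- iota 0 n]]) || exact: finite_set_countable (finite_seq _).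
Qed.

(** The mass of a point is continuous in the norm, and restriction to a finite dimensional subspace
    creates no atoms. *)
Lemma ME_cP mu : ME_c mu <-> ME mu /\ atomless mu.
Proof.
split=> [[cmu h]|[/MEP[cmu [e ce]] at0]].
  split.
    split=> // eps /h[nu [V Vf [mV _]] lt]; exists nu => //; by exists V.
  move=> f; apply: normc_eq0P; apply/eqP; rewrite eq_le normc_ge0 andbT.
  apply/ler_addgt0Pr => eps /h[nu [V Vf [[cnu _] nu0]] lt]; rewrite add0r.
  apply: le_trans (ltW lt); have := normc_tvnorm [set f] (cmeasureB cmu cnu).
  have -> : (mu - nu) [set f] = mu [set f] - nu [set f] by [].
  by rewrite nu0 subr0.
split=> // eps eps0.
have mV n : il_measurable (spann e n) by exact: findim_measurable (spann_findim e n).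
have [n lt] := restr_approx mV (spann_nondecreasing e) cmu ce eps0.
exists (restr (spann e n) mu) => //; exists (spann e n); first exact: spann_findim.
split; first by split; [exact: cmeasure_restr|exact: conc_restr].
move=> f; rewrite /restr; case: asboolP => // _.
have [Vf|Vf] := pselect (spann e n f).
  by rewrite (_ : _ `&` _ = [set f])//; apply/seteqP; split=> [x []//|x ->].
by rewrite (_ : _ `&` _ = set0) ?cmeasure0// -subset0 => x [->].
Qed.

Lemma point_cmeasure f : cmeasure (@point_measure R E f).
Proof.
split.
- by rewrite /point_measure; case: asboolP => // -[].
- by move=> A mA; rewrite /point_measure; case: asboolP => // -[].
move=> F mF tF.
have pE A : il_measurable A -> point_measure f A = if `[< A f >] then 1 else 0 :> R[i].
  by move=> mA; rewrite /point_measure; congr (if _ then _ else _); apply/asboolP/asboolP => [[]|].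
rewrite pE; last exact: il_measurable_bigcup.
under eq_fun do (under eq_bigr do rewrite pE//).
case: asboolP => [[k _ Fk]|nF].
  apply/cvgrPdist_lt => e e0; exists k.+1 => // n /= kn.
  rewrite (bigD1_seq k) ?iota_uniq ?mem_index_iota//= asboolT// big1 => [|i ik].
    by rewrite addr0 subrr Normc.normc0 subrr normr0.
  case: asboolP => // Fi; have := tF i k I I (ex_intro _ f (conj Fi Fk)).
  by move=> ikE; rewrite ikE eqxx in ik.
rewrite (_ : (fun n => _) = cst 0); first exact: cvg_cst.
apply/funext => n /=; rewrite big1 ?subrr ?Normc.normc0// => i _.
by case: asboolP => // Fi; case: nF; exists i.
Qed.

Lemma conc_point f : conc [set f] (@point_measure R E f).
Proof.
move=> A mA; rewrite /point_measure; congr (if _ then _ else _).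
apply/asboolP/asboolP => [[? Af]|[? [Af _]]]; last by [].
by split=> //; apply: il_measurableI => //; exact: set1_measurable.
Qed.

Lemma cmeasure_sum n (a : 'I_n -> R[i]) (mu : 'I_n -> set E -> R[i]) :
  (forall i, cmeasure (mu i)) -> cmeasure (\sum_(i < n) a i *: mu i).
Proof.
move=> h; elim/big_rec: _ => [|i nu _ cnu]; first exact: cmeasure_zero.
exact: cmeasure_lin.
Qed.

Lemma conc_lin W (a : R[i]) mu nu : conc W mu -> conc W nu -> conc W (a *: mu + nu).
Proof.
move=> cmu cnu A mA.
have lE B : (a *: mu + nu) B = a * mu B + nu B by [].
by rewrite !lE cmu// cnu.
Qed.

Lemma ME_dfP mu : ME_df mu <-> cmeasure mu /\ exists s : seq E, conc [set x | x \in s] mu.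
Proof.
split=> [[n [a [f ->]]]|[cmu [s cs]]].
  split; first by apply: cmeasure_sum => i; exact: point_cmeasure.
  exists [seq f i | i <- enum 'I_n].
  have mS := seq_measurable [seq f i | i <- enum 'I_n].
  elim/big_rec: _ => [A _ //|i nu _ cnu]; apply: conc_lin => //.
  apply: (concS (point_cmeasure _) mS _ (conc_point (f i))) => _ ->.
  by apply: map_f; rewrite mem_enum.
(* Repeated points would contribute their mass several times to the sum. *)
wlog us : s cs / uniq s.
  move=> h; apply: (h (undup s)); last exact: undup_uniq.
  by rewrite (_ : [set x | _] = [set x | x \in s])//; apply/seteqP; split=> x /=; rewrite mem_undup.
exists (size s), (fun i => mu [set s`_i]), (fun i => s`_i).
apply/funext => A.
have sE n (F : 'I_n -> set E -> R[i]) : (\sum_(i < n) F i) A = \sum_(i < n) F i A.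
  by elim/big_ind2 : _ => // x1 x2 y1 y2 <- <-.
rewrite sE; have [mA|mA] := pselect (il_measurable A); last first.
  rewrite cmeasure_out// big1// => i _.
  have -> : (mu [set s`_i] *: point_measure s`_i) A = mu [set s`_i] * point_measure s`_i A by [].
  by rewrite /point_measure asboolF ?mulr0// => -[].
rewrite cs//.
transitivity (\sum_(x <- s) mu [set x] * point_measure x A); last first.
  by rewrite (big_nth 0) big_mkord.
elim: s us {cs sE} => [|x s IH] /=.
  move=> _; rewrite big_nil (_ : _ `&` _ = set0) ?cmeasure0//.
  by rewrite -subset0 => y [].
move=> /andP[xs us]; rewrite big_cons -IH//.
have mS := seq_measurable s; have m1 := set1_measurable x.
rewrite (_ : _ `&` _ = (A `&` [set x]) `|` (A `&` [set y | y \in s])); last first.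
  rewrite -setIUr; congr (_ `&` _); apply/seteqP; split=> y /=; rewrite inE.
    by move=> /orP[/eqP ->|]; [left|right].
  by move=> [->|->]; rewrite ?eqxx ?orbT.
rewrite cmeasureU//; [|exact: il_measurableI|exact: il_measurableI|]; last first.
  by rewrite -subset0 => y [[_ /= ->] [_ /=]]; rewrite (negbTE xs).
congr (_ + _); rewrite /point_measure; case: asboolP => [[_ Ax]|Ax].
  by rewrite mulr1 (_ : _ `&` _ = [set x])//; apply/seteqP; split=> [y []//|y ->].
rewrite mulr0 (_ : _ `&` _ = set0) ?cmeasure0// -subset0 => y [Ay /= yx].
by apply: Ax; rewrite -yx.
Qed.

Lemma ME_lin (a : R[i]) mu nu : ME mu -> ME nu -> ME (a *: mu + nu).
Proof.
move=> /MEP[cmu [e ce]] /MEP[cnu [e' ce']].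
have [e2 [ee ee']] := cspan_join2 e e'.
apply/MEP; split; first exact: cmeasure_lin.
exists e2; apply: conc_lin; first exact: concS (cspan_measurable e2) ee ce.
exact: concS (cspan_measurable e2) ee' ce'.
Qed.

Lemma ME_zero : ME (0 : set E -> R[i]).
Proof. by apply/MEP; split; [exact: cmeasure_zero|exists (fun=> 0)]. Qed.

End MEChar.

(** * Kernels and iterated integrals *)

(** Fubini's theorem contains the measurability of the inner integral, but asks for integrability of
    the bound [a]. With respect to the zero measure [z] every measurable function is integrable. *)
Lemma cmf_param d1 d2 (T1 : measurableType d1) (T2 : measurableType d2) (R : realType)
    (rho : {sigma_finite_measure set T2 -> \bar R})
    (h : T1 * T2 -> R[i]) (a : T1 -> R) (b : T2 -> R) :
  cmf h -> measurable_fun setT a -> rintegrable rho b ->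
  (forall x y, normc (h (x, y)) <= a x * b y) ->
  (forall t, 0 <= a t) -> (forall t, 0 <= b t) ->
  cmf (fun x => Cint rho (fun y => h (x, y))).
Proof.
move=> hm ma ib hab a0 b0.
pose z : {sigma_finite_measure set T1 -> \bar R} := mzero.
have ia : rintegrable z a.
  apply/integrableP; split; first exact/measurable_EFinP.
  by rewrite integral_measure_zero.
exact: cintegrable_cmf (cintegrable_inner1 hm ia ib hab a0 b0).
Qed.

Section Moments.
Context (R : realType) (E : lmodType R).
Implicit Types (mu nu : set E -> R[i]) (h : E -> R).

Definition wint mu h := (\int[tv mu]_f (h f)%:E < +oo)%E.

Lemma wintE mu (m : {finite_measure set (ilBorel E) -> \bar R}) h :
  (forall A, il_measurable A -> tv mu A = m A) ->
  wint mu h = (\int[m]_f (h f)%:E < +oo)%E.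
Proof. by move=> mE; rewrite /wint (@eq_set_integral _ (ilBorel E) R (tv mu) m _ mE). Qed.

Definition nonneg_meas h := (forall x, 0 <= h x) /\ measurable_fun setT (h : ilBorel E -> R).

Section WintRep.
Context d (T : measurableType d) (pi : {sigma_finite_measure set T -> \bar R}).
Variables (Phi : T -> ilBorel E) (u : T -> R[i]) (mu : set E -> R[i]).
Hypothesis muP : crep pi Phi u mu.

Lemma integral_vmeas h : nonneg_meas h ->
  (\int[vmeas muP]_x (h x)%:E = \int[pi]_t (h (Phi t) * normc (u t))%:E)%E.
Proof.
move=> [h0 mh]; have [mPhi iu _] := muP.
have mEh : measurable_fun setT (fun x : ilBorel E => (h x)%:E) by exact/measurable_EFinP.
have := ge0_integral_pushforward mPhi (vdens muP) measurableT mEh.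
rewrite preimage_setT => -> //; last by move=> y _; rewrite lee_fin.
rewrite ge0_integral_density//; last 2 first.
- by move=> t /=; rewrite lee_fin.
- exact: (measurableT_comp mEh mPhi).
by apply: eq_integral => t _; rewrite -EFinM ger0_norm ?normc_ge0.
Qed.

Lemma wint_crep h : nonneg_meas h ->
  rintegrable pi (fun t => h (Phi t) * normc (u t)) -> wint mu h.
Proof.
move=> hP ih; have [h0 mh] := hP.
have [m mE] := tv_measure (crep_cmeasure muP).
rewrite (wintE _ mE).
apply: (@le_lt_trans _ _ (\int[vmeas muP]_x (h x)%:E)%E).
  apply: ge0_le_measure_integral => //.
  - by move=> A mA; have := tv_crep muP mA; rewrite mE.
  - exact/measurable_EFinP.
rewrite integral_vmeas//.
have := integrable_lty measurableT ih; exact.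
Qed.

End WintRep.

Lemma wint_le mu (C : R) h k : cmeasure mu -> nonneg_meas h -> nonneg_meas k ->
  (forall x, h x <= C * k x) -> wint mu k -> wint mu h.
Proof.
move=> cmu [h0 mh] [k0 mk] hk; have [m mE] := tv_measure cmu.
rewrite !(wintE _ mE) => ik.
have irk : rintegrable m k by exact: rintegrable_lty.
have : rintegrable m h.
  apply: (rintegrable_le mh (rintegrableZ C irk)) => x.
  by rewrite ger0_norm.
by move=> /(integrable_lty measurableT); exact.
Qed.

Lemma wintD mu h k : cmeasure mu -> nonneg_meas h -> nonneg_meas k ->
  wint mu h -> wint mu k -> wint mu (fun x => h x + k x).
Proof.
move=> cmu [h0 mh] [k0 mk]; have [m mE] := tv_measure cmu.
rewrite !(wintE _ mE) => ih ik.
have irk : rintegrable m k by exact: rintegrable_lty.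
have irh : rintegrable m h by exact: rintegrable_lty.
by have /(integrable_lty measurableT) := rintegrableD irh irk; exact.
Qed.

Lemma wint_cst mu : cmeasure mu -> wint mu (fun=> 1).
Proof.
move=> cmu; have [m mE] := tv_measure cmu.
rewrite (wintE _ mE).
have /(integrable_lty measurableT) := finite_measure_integrable_cst m 1 measurableT.
exact.
Qed.

Lemma wint_lin (a : R[i]) mu nu h : cmeasure mu -> cmeasure nu -> nonneg_meas h ->
  wint mu h -> wint nu h -> wint (a *: mu + nu) h.
Proof.
move=> cmu cnu [h0 mh].
have [m mE] := tv_measure cmu; have [n nE] := tv_measure cnu.
have [s sE] := tv_measure (cmeasure_lin a cmu cnu).
rewrite (wintE _ mE) (wintE _ nE) (wintE _ sE) => ih ik.
pose na : {nonneg R} := NngNum (normc_ge0 a).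
have mEh : measurable_fun setT (fun x : ilBorel E => (h x)%:E) by exact/measurable_EFinP.
have hE0 x : (0 <= (h x)%:E)%E by rewrite lee_fin.
apply: (@le_lt_trans _ _ (\int[measure_add (mscale na m) n]_x (h x)%:E)%E).
  rewrite /measure_add; apply: ge0_le_measure_integral => // A mA.
  suff : (tv (a *: mu + nu)%R A <= (normc a)%:E * tv mu A + tv nu A)%E.
    by rewrite sE// mE// nE// => le; apply: le_trans le _; rewrite [X in (_ <= X)%E]measure_addE.
  apply: ge_ereal_sup => _ [k [F [FA tF ->]]].
  apply: (@le_trans _ _ ((normc a)%:E * (\sum_(i < k) normc (mu (F i)))%:E +
      (\sum_(i < k) normc (nu (F i)))%:E)%E).
    rewrite -EFinM -EFinD lee_fin mulr_sumr -big_split; apply: ler_sum => i _.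
    by rewrite -Normc.normcM; exact: normcD.
  apply: leeD; last by apply: ereal_sup_ubound; exists k, F.
  apply: lee_wpmul2l; first by rewrite lee_fin normc_ge0.
  by apply: ereal_sup_ubound; exists k, F.
rewrite ge0_integral_measure_add// ge0_integral_mscale//.
by apply: lte_add_pinfty => //; apply: lte_mul_pinfty => //; rewrite ?lee_fin ?normc_ge0.
Qed.

End Moments.

(** * Admissible kernels on a countable span *)

Section Kernels.
Context (R : realType) (E : lmodType R) (e : nat -> E).
Local Notation EE := (ilBorel E * ilBorel E)%type.
Local Notation W := (cspan e).
Local Notation r := (retr e).
Implicit Types (mu nu : set E -> R[i]) (m : E -> R) (h : E -> R[i])
  (w : E -> E -> R[i]) (F : E -> E -> E -> R[i]).

(** Submultiplicativity bounds a function of [f + g] by a product of functions of [f] and [g]. The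
    lower bound 1 lets a kernel ignore some of its variables and makes a product of weights at least
    as large as each factor. *)
Definition weight m := [/\ forall x, 1 <= m x, measurable_fun setT (m : ilBorel E -> R) &
  forall x y, m (x + y) <= m x * m y].

Lemma weight_ge0 m x : weight m -> 0 <= m x.
Proof. by move=> [h _ _]; exact: le_trans ler01 (h x). Qed.
Lemma weight_nonneg m : weight m -> nonneg_meas m.
Proof. by move=> mW; split=> [x|]; [exact: weight_ge0|case: mW]. Qed.
Lemma weight1 : weight (fun=> 1).
Proof. by split=> // x y; rewrite mulr1. Qed.
Lemma weightM m m' : weight m -> weight m' -> weight (fun x => m x * m' x).
Proof.
move=> mW mW'; have [h1 h2 h3] := mW; have [k1 k2 k3] := mW'; split=> [x||x y].
- by rewrite -[1]mulr1 ler_pM.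
- exact: measurable_funM.
- by rewrite mulrACA ler_pM// ?mulr_ge0 ?(weight_ge0 _ mW) ?(weight_ge0 _ mW').
Qed.

(** Measurability is required only after composition with [r], and the bound only on [W]. This is
    all that a measure on [W] sees, and all that can be proved of an inner integral. *)
Definition adm m h := cmf (fun x : ilBorel E => h (r x)) /\
  exists2 C : R, 0 <= C & forall x, W x -> normc (h x) <= C * m x.

Definition adm2 m w := cmf (fun p : EE => w (r p.1) (r p.2)) /\
  exists2 C : R, 0 <= C & forall f g, W f -> W g -> normc (w f g) <= C * (m f * m g).

Definition adm3 m F := cmf (fun p : ilBorel E * EE => F (r p.1) (r p.2.1) (r p.2.2)) /\
  exists2 C : R, 0 <= C & forall f g k, W f -> W g -> W k ->
    normc (F f g k) <= C * (m f * (m g * m k)).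

Let rE x : W x -> r x = x. Proof. exact: retr_id. Qed.

Lemma cmf_adm d (T : measurableType d) m h (al : T -> ilBorel E) : adm m h ->
  measurable_fun setT al -> (forall t, W (al t)) -> cmf (fun t => h (al t)).
Proof.
move=> [hm _] mal aW; have := cmf_comp hm mal.
by under eq_fun do rewrite (rE (aW _)).
Qed.

Lemma cmf_adm2 d (T : measurableType d) m w (al be : T -> ilBorel E) : adm2 m w ->
  measurable_fun setT al -> measurable_fun setT be ->
  (forall t, W (al t)) -> (forall t, W (be t)) -> cmf (fun t => w (al t) (be t)).
Proof.
move=> [wm _] mal mbe aW bW.
have := cmf_comp wm (measurable_fun_pair mal mbe).
by under eq_fun do rewrite /= (rE (aW _)) (rE (bW _)).
Qed.

Lemma cmf_adm3 d (T : measurableType d) m F (al be ga : T -> ilBorel E) : adm3 m F ->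
  measurable_fun setT al -> measurable_fun setT be -> measurable_fun setT ga ->
  (forall t, W (al t)) -> (forall t, W (be t)) -> (forall t, W (ga t)) ->
  cmf (fun t => F (al t) (be t) (ga t)).
Proof.
move=> [Fm _] mal mbe mga aW bW gW.
have := cmf_comp Fm (measurable_fun_pair mal (measurable_fun_pair mbe mga)).
by under eq_fun do rewrite /= (rE (aW _)) (rE (bW _)) (rE (gW _)).
Qed.

Let mr : measurable_fun setT (r : ilBorel E -> ilBorel E). Proof. exact: retr_measurable. Qed.
Let rW x : W (r x). Proof. exact: retr_in. Qed.
Let mrc d (T : measurableType d) (al : T -> ilBorel E) : measurable_fun setT al ->
  measurable_fun setT (fun t => r (al t) : ilBorel E).
Proof. by move=> mal; exact: (measurableT_comp mr mal). Qed.

Lemma adm_ext m h k : (forall x, W x -> h x = k x) -> adm m h -> adm m k.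
Proof.
move=> hk [hm [C C0 hC]]; split; last by exists C => // x Wx; rewrite -hk// hC.
by have := hm; under eq_fun do rewrite hk//.
Qed.

Lemma adm_lin m a h k : weight m -> adm m h -> adm m k -> adm m (fun x => a * h x + k x).
Proof.
move=> mW [hm [C C0 hC]] [km [D D0 kD]]; split.
  by apply: cmfD => //; apply: cmfM => //; exact: cmf_cst.
exists (normc a * C + D); first by rewrite addr_ge0// mulr_ge0// normc_ge0.
move=> x Wx; apply: le_trans (normcD _ _) _; rewrite Normc.normcM mulrDl -mulrA.
by rewrite lerD ?kD// ler_wpM2l ?normc_ge0// hC.
Qed.

Lemma adm2_fst m w f : weight m -> adm2 m w -> W f -> adm m (w f).
Proof.
move=> mW wA Wf; split.
  have := @cmf_adm2 _ _ _ _ (fun=> f) (r : ilBorel E -> ilBorel E) wA.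
  by apply; [exact: measurable_cst|exact: mr|by []|move=> t; exact: rW].
have [_ [C C0 wC]] := wA; exists (C * m f); first by rewrite mulr_ge0 ?(weight_ge0 _ mW).
by move=> g Wg; rewrite -mulrA wC.
Qed.

Lemma adm2_swap m w : adm2 m w -> adm2 m (fun g f => w f g).
Proof.
move=> wA; split.
  by apply: (cmf_adm2 wA (al := fun p : EE => r p.2) (be := fun p : EE => r p.1)) => //;
    apply: mrc; [exact: measurable_snd|exact: measurable_fst].
by have [_ [C C0 wC]] := wA; exists C => // f g Wf Wg; rewrite [m f * _]mulrC wC.
Qed.

Lemma adm2_lin m a w w' : weight m -> adm2 m w -> adm2 m w' ->
  adm2 m (fun f g => a * w f g + w' f g).
Proof.
move=> mW [hm [C C0 hC]] [km [D D0 kD]]; split.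
  by apply: cmfD => //; apply: cmfM => //; exact: cmf_cst.
exists (normc a * C + D); first by rewrite addr_ge0// mulr_ge0// normc_ge0.
move=> x y Wx Wy; apply: le_trans (normcD _ _) _; rewrite Normc.normcM mulrDl -mulrA.
by rewrite lerD ?kD// ler_wpM2l ?normc_ge0// hC.
Qed.

Lemma adm2M m m' w w' : weight m -> weight m' -> adm2 m w -> adm2 m' w' ->
  adm2 (fun x => m x * m' x) (fun f g => w f g * w' f g).
Proof.
move=> mW mW' [hm [C C0 hC]] [km [D D0 kD]]; split; first exact: cmfM.
exists (C * D); first exact: mulr_ge0.
move=> x y Wx Wy; rewrite Normc.normcM (mulrACA (m x)) (mulrACA C).
by apply: ler_pM; [exact: normc_ge0|exact: normc_ge0|exact: hC|exact: kD].
Qed.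

Lemma adm2_weight m m' w : weight m -> weight m' -> (forall x, m x <= m' x) ->
  adm2 m w -> adm2 m' w.
Proof.
move=> mW mW' mm [hm [C C0 hC]]; split => //; exists C => // x y Wx Wy.
by apply: le_trans (hC _ _ Wx Wy) _; rewrite ler_wpM2l// ler_pM// ?(weight_ge0 _ mW).
Qed.

Lemma adm2_add m h : weight m -> adm m h -> adm2 m (fun f g => h (f + g)).
Proof.
move=> mW hA; split.
  apply: (cmf_adm hA (al := fun p : EE => r p.1 + r p.2)); first exact: retr2_add_measurable.
  by move=> p; apply: is_subspaceD; [exact: cspan_subspace|exact: rW|exact: rW].
have [_ [C C0 hC]] := hA; exists C => // f g Wf Wg.
have [_ _ mD] := mW; apply: le_trans (hC _ (is_subspaceD (cspan_subspace e) Wf Wg)) _.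
by rewrite ler_wpM2l.
Qed.

Lemma adm3_fst m F f : weight m -> adm3 m F -> W f -> adm2 m (F f).
Proof.
move=> mW FA Wf; split.
  apply: (cmf_adm3 FA (al := fun=> f) (be := fun p : EE => r p.1) (ga := fun p : EE => r p.2)) => //.
  - by apply: mrc; exact: measurable_fst.
  - by apply: mrc; exact: measurable_snd.
have [_ [C C0 FC]] := FA; exists (C * m f); first by rewrite mulr_ge0 ?(weight_ge0 _ mW).
by move=> g k Wg Wk; rewrite -mulrA FC.
Qed.

Let p1 : measurable_fun setT (fun p : ilBorel E * EE => r p.1 : ilBorel E).
Proof. by apply: mrc; exact: measurable_fst. Qed.
Let p2 : measurable_fun setT (fun p : ilBorel E * EE => r p.2.1 : ilBorel E).
Proof. by apply: mrc; exact: (measurableT_comp measurable_fst measurable_snd). Qed.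
Let p3 : measurable_fun setT (fun p : ilBorel E * EE => r p.2.2 : ilBorel E).
Proof. by apply: mrc; exact: (measurableT_comp measurable_snd measurable_snd). Qed.

Lemma adm3_swap12 m F : adm3 m F -> adm3 m (fun g f k => F f g k).
Proof.
move=> FA; split; first exact: (cmf_adm3 FA p2 p1 p3).
have [_ [C C0 FC]] := FA; exists C => // g f k Wg Wf Wk.
by rewrite (mulrCA (m g)) FC.
Qed.

Lemma adm3_swap23 m F : adm3 m F -> adm3 m (fun f k g => F f g k).
Proof.
move=> FA; split; first exact: (cmf_adm3 FA p1 p3 p2).
have [_ [C C0 FC]] := FA; exists C => // f k g Wf Wk Wg.
by rewrite [m k * _]mulrC FC.
Qed.

Lemma adm3_12 m w : weight m -> adm2 m w -> adm3 m (fun f g _ => w f g).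
Proof.
move=> mW wA; split; first exact: (cmf_adm2 wA p1 p2).
have [_ [C C0 wC]] := wA; exists C => // f g k Wf Wg Wk.
apply: le_trans (wC _ _ Wf Wg) _; rewrite ler_wpM2l// ler_wpM2l ?(weight_ge0 _ mW)//.
by rewrite ler_peMr ?(weight_ge0 _ mW)//; case: mW.
Qed.

Lemma adm3_1_23 m w : weight m -> adm2 m w -> adm3 m (fun f g k => w f (g + k)).
Proof.
move=> mW wA; have Ws := cspan_subspace e; split.
  have ms : measurable_fun setT (fun p : ilBorel E * EE => r p.2.1 + r p.2.2 : ilBorel E).
    exact: (measurableT_comp (retr2_add_measurable e) measurable_snd).
  by apply: (cmf_adm2 wA p1 ms) => // p; exact: is_subspaceD.
have [_ [C C0 wC]] := wA; exists C => // f g k Wf Wg Wk.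
have [_ _ mD] := mW.
apply: le_trans (wC _ _ Wf (is_subspaceD Ws Wg Wk)) _.
by rewrite ler_wpM2l// ler_wpM2l ?(weight_ge0 _ mW).
Qed.

Lemma adm3_sum m h : weight m -> adm m h -> adm3 m (fun f g k => h (f + (g + k))).
Proof. by move=> mW hA; apply: (adm3_1_23 mW (adm2_add mW hA)). Qed.

Lemma adm3M m m' F F' : weight m -> weight m' -> adm3 m F -> adm3 m' F' ->
  adm3 (fun x => m x * m' x) (fun f g k => F f g k * F' f g k).
Proof.
move=> mW mW' [hm [C C0 hC]] [km [D D0 kD]]; split; first exact: cmfM.
exists (C * D); first exact: mulr_ge0.
move=> x y z Wx Wy Wz; rewrite Normc.normcM (mulrACA (m y)) (mulrACA (m x)) (mulrACA C).
by apply: ler_pM; [exact: normc_ge0|exact: normc_ge0|exact: hC|exact: kD].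
Qed.

Lemma adm3_lin m a F F' : weight m -> adm3 m F -> adm3 m F' ->
  adm3 m (fun f g k => a * F f g k + F' f g k).
Proof.
move=> mW [hm [C C0 hC]] [km [D D0 kD]]; split.
  by apply: cmfD => //; apply: cmfM => //; exact: cmf_cst.
exists (normc a * C + D); first by rewrite addr_ge0// mulr_ge0// normc_ge0.
move=> x y z Wx Wy Wz; apply: le_trans (normcD _ _) _; rewrite Normc.normcM mulrDl -mulrA.
by rewrite lerD ?kD// ler_wpM2l ?normc_ge0// hC.
Qed.

Section NRep.
Variables (lam : {sigma_finite_measure set (ilBorel E) -> \bar R})
  (u : ilBorel E -> R[i]) (mu : set E -> R[i]) (m : E -> R).
Hypotheses (muP : crep lam (fun x => x) u mu) (u0 : forall x, ~ W x -> u x = 0).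
Hypotheses (mW : weight m) (im : wint mu m).

Lemma retr_u (A : Type) (h : E -> A) (k : A -> R[i]) x :
  u x * k (h (r x)) = u x * k (h x).
Proof.
have [Wx|Wx] := pselect (W x); first by rewrite retr_id.
by rewrite u0// !mul0r.
Qed.

Lemma crep_retr : crep lam (r : ilBorel E -> ilBorel E) u mu.
Proof.
have [_ iu muE] := muP; split=> //; rewrite muE; apply/funext => A; case: asboolP => // mA.
by apply: eq_Cint => x; rewrite (retr_u (fun y => \1_A y : R) (real_complex R)).
Qed.

(** The moment hypothesis concerns [tv mu]. It becomes a bound on the density through [tvE]; here
    the lower estimate of the total variation matters. *)
Lemma rintegrable_weight : rintegrable lam (fun x => normc (u x) * m (r x)).
Proof.
have iu : cintegrable lam u by case: muP.
have mm : measurable_fun setT (fun x : ilBorel E => m (r x)).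
  by case: mW => _ mm _; exact: (measurableT_comp mm mr).
apply: rintegrable_lty.
- by move=> x; rewrite mulr_ge0 ?normc_ge0 ?(weight_ge0 _ mW).
- by apply: measurable_funM => //; apply: cmf_normc; exact: (cintegrable_cmf iu).
have := im; rewrite /wint (@eq_set_integral _ (ilBorel E) R (tv mu) (vmeas muP) _ (tvE muP)).
rewrite integral_vmeas; last exact: weight_nonneg.
congr (_ < _)%E; apply: eq_integral => x _; rewrite mulrC.
have [Wx|Wx] := pselect (W x); first by rewrite retr_id.
by rewrite u0// Normc.normc0 !mul0r.
Qed.

Lemma cintegrable_adm h : adm m h -> cintegrable lam (fun x => u x * h (r x)).
Proof.
move=> [hm [C C0 hC]]; have iu : cintegrable lam u by case: muP.
apply: (cintegrable_le _ (rintegrableZ C rintegrable_weight)).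
  by apply: cmfM => //; exact: (cintegrable_cmf iu).
by move=> x; rewrite Normc.normcM mulrCA ler_wpM2l ?normc_ge0// hC.
Qed.

Lemma cint_adm h : adm m h -> cint mu h = Cint lam (fun x => u x * h (r x)).
Proof.
move=> hA; apply: (cint_rep crep_retr (e := e)) => //; first by case: hA.
have := cintegrable_normc (cintegrable_adm hA).
by under eq_fun do rewrite Normc.normcM.
Qed.

End NRep.

Definition onW mu := cmeasure mu /\ conc W mu.

Lemma onW_rep mu : onW mu -> exists (lam : {finite_measure set (ilBorel E) -> \bar R}) u,
  crep lam (fun x => x) u mu /\ forall x, ~ W x -> u x = 0.
Proof. by move=> [cmu cW]; apply: exists_crep_on => //; exact: cspan_measurable. Qed.

Lemma eq_cint mu m h k : onW mu -> weight m -> wint mu m -> adm m h ->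
  (forall x, W x -> h x = k x) -> cint mu h = cint mu k.
Proof.
move=> /onW_rep[lam [u [ru u0]]] mW im hA hk.
rewrite (cint_adm ru u0 mW im hA) (cint_adm ru u0 mW im (adm_ext hk hA)).
by apply: eq_Cint => x; rewrite hk.
Qed.

Lemma cint_lin mu m a h k : onW mu -> weight m -> wint mu m -> adm m h -> adm m k ->
  cint mu (fun x => a * h x + k x) = a * cint mu h + cint mu k.
Proof.
move=> /onW_rep[lam [u [ru u0]]] mW im hA kA.
rewrite (cint_adm ru u0 mW im hA) (cint_adm ru u0 mW im kA).
rewrite (cint_adm ru u0 mW im (adm_lin a mW hA kA)).
have ih := cintegrable_adm ru u0 mW im hA; have ik := cintegrable_adm ru u0 mW im kA.
rewrite -CintZ// -CintD//; last exact: cintegrableZ.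
by apply: eq_Cint => x; rewrite mulrDr mulrCA.
Qed.

Lemma adm0 m : weight m -> adm m (fun=> 0).
Proof.
move=> mW; split; first exact: cmf_cst.
by exists 0 => // x _; rewrite Normc.normc0 mul0r.
Qed.

Lemma cint0 mu m : onW mu -> weight m -> wint mu m -> cint mu (fun=> 0) = 0.
Proof.
move=> /onW_rep[lam [u [ru u0]]] mW im; rewrite (cint_adm ru u0 mW im (adm0 mW)).
transitivity (Cint lam (fun=> 0)); last exact: Cint0.
by apply: eq_Cint => x; rewrite mulr0.
Qed.

Lemma cintZ mu m a h : onW mu -> weight m -> wint mu m -> adm m h ->
  cint mu (fun x => a * h x) = a * cint mu h.
Proof.
move=> muW mW im hA; have := cint_lin a muW mW im hA (adm0 mW).
rewrite (cint0 muW mW im) addr0 => <-; congr cint; apply/funext => x.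
by rewrite addr0.
Qed.

Section TwoMeasures.
Variables (lam kap : {sigma_finite_measure set (ilBorel E) -> \bar R})
  (u v : ilBorel E -> R[i]) (mu nu : set E -> R[i]) (m : E -> R) (w : E -> E -> R[i]).
Hypotheses (muP : crep lam (fun x => x) u mu) (u0 : forall x, ~ W x -> u x = 0).
Hypotheses (nuP : crep kap (fun x => x) v nu) (v0 : forall x, ~ W x -> v x = 0).
Hypotheses (mW : weight m) (imu : wint mu m) (inu : wint nu m) (wA : adm2 m w).

Definition prod_density (p : EE) := u p.1 * v p.2 * w (r p.1) (r p.2).

Let cu : cmf u. Proof. by have [_ iu _] := muP; exact: (cintegrable_cmf iu). Qed.
Let cv : cmf v. Proof. by have [_ iv _] := nuP; exact: (cintegrable_cmf iv). Qed.

Lemma prod_density_cmf : cmf prod_density.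
Proof.
apply: cmfM; last by case: wA.
by apply: cmfM; [exact: (cmf_comp cu measurable_fst)|exact: (cmf_comp cv measurable_snd)].
Qed.

Lemma prod_density_bound : exists2 C : R, 0 <= C & forall x y,
  normc (prod_density (x, y)) <= (C * (normc (u x) * m (r x))) * (normc (v y) * m (r y)).
Proof.
have [_ [C C0 wC]] := wA; exists C => // x y; rewrite !Normc.normcM /=.
have -> : C * (normc (u x) * m (r x)) * (normc (v y) * m (r y)) =
  normc (u x) * normc (v y) * (C * (m (r x) * m (r y))) by ring.
by rewrite ler_wpM2l ?mulr_ge0 ?normc_ge0// wC.
Qed.

Let iC (C : R) := rintegrableZ C (rintegrable_weight muP u0 mW imu).
Let ib := rintegrable_weight nuP v0 mW inu.
Let a0 (C : R) : 0 <= C -> forall x, 0 <= C * (normc (u x) * m (r x)).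
Proof. by move=> C0 x; rewrite !mulr_ge0 ?normc_ge0 ?(weight_ge0 _ mW). Qed.
Let b0 : forall x, 0 <= normc (v x) * m (r x).
Proof. by move=> x; rewrite mulr_ge0 ?normc_ge0 ?(weight_ge0 _ mW). Qed.

Lemma prod_density_integrable : cintegrable (lam \x kap)%E prod_density.
Proof.
have [C C0 h] := prod_density_bound.
exact: (cintegrable_prod prod_density_cmf (iC C) ib h (a0 C0) b0).
Qed.

(** Integrating out a variable keeps the weight and multiplies the constant by the integral of [m]
    against the variation of [nu]. Iterated integrals thus stay admissible at every stage. *)
Lemma adm_inner : adm m (fun f => cint nu (w f)).
Proof.
have wE f : W f -> cint nu (w f) = Cint kap (fun y => v y * w f (r y)).
  by move=> Wf; rewrite (cint_adm nuP v0 mW inu (adm2_fst mW wA Wf)).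
have [_ [C C0 wC]] := wA.
have hm : cmf (fun p : EE => v p.2 * w (r p.1) (r p.2)).
  by apply: cmfM; [exact: (cmf_comp cv measurable_snd)|case: wA].
have hb (x y : ilBorel E) : normc (v y * w (r x) (r y)) <= (C * m (r x)) * (normc (v y) * m (r y)).
  by rewrite Normc.normcM mulrCA ler_wpM2l ?normc_ge0// -mulrA wC.
have mm : measurable_fun setT (fun x : ilBorel E => C * m (r x)).
  apply: measurable_funM; first exact: measurable_cst.
  by case: mW => _ mm _; exact: (measurableT_comp mm mr).
have am x : 0 <= C * m (r x) by rewrite mulr_ge0 ?(weight_ge0 _ mW).
split.
  have := cmf_param hm mm ib hb am b0.
  by under eq_fun do rewrite /= -wE//.
exists (C * Rintegral kap setT (fun y => normc (v y) * m (r y))).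
  by rewrite mulr_ge0//; apply: Rintegral_ge0 => y _.
move=> f Wf; rewrite wE//.
have iw := cintegrable_adm nuP v0 mW inu (adm2_fst mW wA Wf).
apply: le_trans (normc_Cint iw) _.
rewrite mulrAC -RintegralZl//; apply: le_Rintegral => //.
- exact: cintegrable_normc.
- exact: (rintegrableZ _ ib).
by move=> y _; rewrite Normc.normcM mulrCA ler_wpM2l ?normc_ge0// -mulrA wC.
Qed.

Lemma cint_prod1 : cint mu (fun f => cint nu (w f)) = Cint (lam \x kap)%E prod_density.
Proof.
rewrite (cint_adm muP u0 mW imu adm_inner).
have [C C0 h] := prod_density_bound.
rewrite (Cint_fubini1 prod_density_cmf (iC C) ib h (a0 C0) b0).
apply: eq_Cint => x.
rewrite (cint_adm nuP v0 mW inu (adm2_fst mW wA (rW x))).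
rewrite -CintZ; last exact: (cintegrable_adm nuP v0 mW inu (adm2_fst mW wA (rW x))).
by apply: eq_Cint => y; rewrite mulrA.
Qed.

Lemma Cint_prod_swap : Cint (lam \x kap)%E prod_density =
  Cint kap (fun y => Cint lam (fun x => u x * v y * w (r x) (r y))).
Proof.
have [C C0 h] := prod_density_bound.
exact: (Cint_fubini2 prod_density_cmf (iC C) ib h (a0 C0) b0).
Qed.

End TwoMeasures.

Lemma cint_swap mu nu m w : onW mu -> onW nu -> weight m -> wint mu m -> wint nu m ->
  adm2 m w ->
  cint mu (fun f => cint nu (w f)) = cint nu (fun g => cint mu (fun f => w f g)).
Proof.
move=> /onW_rep[lam [u [ru u0]]] /onW_rep[kap [v [rv v0]]] mW imu inu wA.
rewrite (cint_prod1 ru u0 rv v0 mW imu inu wA).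
have wA' := adm2_swap wA.
rewrite (cint_adm rv v0 mW inu (adm_inner ru u0 mW imu wA')).
rewrite (Cint_prod_swap ru u0 rv v0 mW imu inu wA).
apply: eq_Cint => y; have wy := adm2_fst mW wA' (rW y).
rewrite (cint_adm ru u0 mW imu wy) -CintZ.
  by apply: eq_Cint => x; rewrite [u x * v y]mulrC -mulrA.
exact: (cintegrable_adm ru u0 mW imu wy).
Qed.

Lemma adm_cint nu m w : onW nu -> weight m -> wint nu m -> adm2 m w ->
  adm m (fun f => cint nu (w f)).
Proof. by move=> /onW_rep[kap [v [rv v0]]] mW inu wA; exact: (adm_inner rv v0 mW inu wA). Qed.

(** The pair of outer variables is treated as one parameter in the product space, to which
    [cmf_param] applies as before. *)
Lemma adm2_cint nu m F : onW nu -> weight m -> wint nu m -> adm3 m F ->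
  adm2 m (fun f g => cint nu (F f g)).
Proof.
move=> /onW_rep[kap [v [rv v0]]] mW inu FA.
have FE f g : W f -> W g -> cint nu (F f g) = Cint kap (fun y => v y * F f g (r y)).
  by move=> Wf Wg; rewrite (cint_adm rv v0 mW inu (adm2_fst mW (adm3_fst mW FA Wf) Wg)).
have cv : cmf v by have [_ iv _] := rv; exact: (cintegrable_cmf iv).
have [_ [C C0 FC]] := FA.
have ib := rintegrable_weight rv v0 mW inu.
have b0 x : 0 <= normc (v x) * m (r x) by rewrite mulr_ge0 ?normc_ge0 ?(weight_ge0 _ mW).
have hm : cmf (fun p : EE * ilBorel E => v p.2 * F (r p.1.1) (r p.1.2) (r p.2)).
  apply: cmfM; first exact: (cmf_comp cv measurable_snd).
  apply: (cmf_adm3 FA (al := fun p : EE * ilBorel E => r p.1.1)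
    (be := fun p : EE * ilBorel E => r p.1.2) (ga := fun p : EE * ilBorel E => r p.2)) => //.
  - by apply: mrc; exact: (measurableT_comp measurable_fst measurable_fst).
  - by apply: mrc; exact: (measurableT_comp measurable_snd measurable_fst).
  - by apply: mrc; exact: measurable_snd.
have hb (p : EE) (y : ilBorel E) : normc (v y * F (r p.1) (r p.2) (r y)) <=
    (C * (m (r p.1) * m (r p.2))) * (normc (v y) * m (r y)).
  by rewrite Normc.normcM mulrCA ler_wpM2l ?normc_ge0// -!mulrA FC.
have mm : measurable_fun setT (fun p : EE => C * (m (r p.1) * m (r p.2))).
  have mm : measurable_fun setT (fun x : ilBorel E => m (r x)).
    by case: mW => _ mm _; exact: (measurableT_comp mm mr).
  apply: measurable_funM; first exact: measurable_cst.
  by apply: measurable_funM;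
    [exact: (measurableT_comp mm measurable_fst)|exact: (measurableT_comp mm measurable_snd)].
have am (p : EE) : 0 <= C * (m (r p.1) * m (r p.2)) by rewrite !mulr_ge0 ?(weight_ge0 _ mW).
split.
  have := cmf_param hm mm ib hb am b0.
  by under eq_fun do rewrite /= -FE//.
exists (C * Rintegral kap setT (fun y => normc (v y) * m (r y))).
  by rewrite mulr_ge0//; apply: Rintegral_ge0 => y _.
move=> f g Wf Wg; rewrite FE//.
have iw := cintegrable_adm rv v0 mW inu (adm2_fst mW (adm3_fst mW FA Wf) Wg).
apply: le_trans (normc_Cint iw) _.
rewrite mulrAC -RintegralZl//; apply: le_Rintegral => //.
- exact: cintegrable_normc.
- exact: (rintegrableZ _ ib).
by move=> y _; rewrite Normc.normcM mulrCA ler_wpM2l ?normc_ge0// -!mulrA FC.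
Qed.

End Kernels.

(** * Twisted convolutions *)

Section FiniteProduct.
Context d1 d2 (T1 : measurableType d1) (T2 : measurableType d2) (R : realType).
Variables (m1 : {finite_measure set T1 -> \bar R}) (m2 : {finite_measure set T2 -> \bar R}).

Definition finite_prod : set (T1 * T2) -> \bar R := (m1 \x m2)%E.

HB.instance Definition _ := Measure.copy finite_prod (m1 \x m2)%E.

Let finite_prod_fin : fin_num_fun finite_prod.
Proof.
move=> A mA; rewrite ge0_fin_numE//.
apply: (@le_lt_trans _ _ (finite_prod setT)); first by apply: le_measure; rewrite ?inE.
rewrite /finite_prod -setXTT product_measure1E//.
by apply: lte_mul_pinfty => //; rewrite ?ge0_fin_numE ?fin_num_fun_lty// fin_num_measure.
Qed.

HB.instance Definition _ := Measure_isFinite.Build _ _ _ finite_prod finite_prod_fin.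
End FiniteProduct.

Lemma Rintegral_prod d1 d2 (T1 : measurableType d1) (T2 : measurableType d2) (R : realType)
    (pi : {sigma_finite_measure set T1 -> \bar R}) (rho : {sigma_finite_measure set T2 -> \bar R})
    (a : T1 -> R) (b : T2 -> R) :
  (forall t, 0 <= a t) -> (forall t, 0 <= b t) -> rintegrable pi a -> rintegrable rho b ->
  Rintegral (pi \x rho)%E setT (fun p => a p.1 * b p.2) =
  Rintegral pi setT a * Rintegral rho setT b.
Proof.
move=> a0 b0 ia ib.
have ma := rintegrable_mf ia; have mb := rintegrable_mf ib.
pose h (p : T1 * T2) : R[i] := (a p.1 * b p.2)%:C.
have hm : cmf h.
  apply: cmf_real; apply: measurable_funM;
    [exact: (measurableT_comp ma measurable_fst)|exact: (measurableT_comp mb measurable_snd)].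
have hab x y : normc (h (x, y)) <= a x * b y by rewrite normcR /= ger0_norm// mulr_ge0.
have := congr1 (@complex.Re R) (Cint_fubini1 hm ia ib hab a0 b0); rewrite /h /= => ->.
under eq_Rintegral do rewrite RintegralZl//.
by rewrite RintegralZr.
Qed.

Section Twisted.
Context (R : realType) (E : lmodType R) (e : nat -> E).
Local Notation EE := (ilBorel E * ilBorel E)%type.
Local Notation W := (cspan e).
Local Notation r := (retr e).
Implicit Types (mu nu : set E -> R[i]) (m : E -> R) (w : E -> E -> R[i])
  (F : E -> E -> E -> R[i]).

Definition cindic (A : set E) (x : E) : R[i] := (\1_A x : R)%:C.

Lemma normc_cindic A x : normc (cindic A x) <= 1.
Proof. by rewrite normcR indicE; case: (_ \in _); rewrite ?normr1 ?normr0. Qed.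

Lemma adm_cindic A : il_measurable A -> adm e (fun=> 1) (cindic A).
Proof.
move=> mA; split.
  by apply: cmf_real; exact: (indic_comp_measurable (retr_measurable e) mA).
by exists 1 => // x _; rewrite mulr1 normc_cindic.
Qed.

Lemma twisted_convE mu nu w A : il_measurable A ->
  twisted_conv w mu nu A = cint mu (fun f => cint nu (fun g => w f g * cindic A (f + g))).
Proof. by move=> mA; rewrite /twisted_conv asboolT. Qed.

Lemma twisted_conv_out mu nu w A : ~ il_measurable A -> twisted_conv w mu nu A = 0.
Proof. by move=> mA; rewrite /twisted_conv asboolF. Qed.

Lemma weight_ge1 m x : weight m -> 1 <= m x. Proof. by case. Qed.

Lemma adm2_indic m w A : weight m -> adm2 e m w -> il_measurable A ->
  adm2 e m (fun f g => w f g * cindic A (f + g)).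
Proof.
move=> mW wA mA.
have := adm2M mW (@weight1 R E) wA (adm2_add (@weight1 R E) (adm_cindic mA)).
apply: adm2_weight => //; first exact: weightM (@weight1 R E).
by move=> x; rewrite mulr1.
Qed.

Lemma adm3_weight m m' F : weight m -> weight m' -> (forall x, m x <= m' x) ->
  adm3 e m F -> adm3 e m' F.
Proof.
move=> mW mW' mm [hm [C C0 hC]]; split => //; exists C => // x y z Wx Wy Wz.
apply: le_trans (hC _ _ _ Wx Wy Wz) _; rewrite ler_wpM2l//.
by rewrite !ler_pM// ?mulr_ge0// ?(weight_ge0 _ mW).
Qed.

Lemma adm3_indic m F A : weight m -> adm3 e m F -> il_measurable A ->
  adm3 e m (fun f g k => F f g k * cindic A (f + (g + k))).
Proof.
move=> mW FA mA.
have := adm3M mW (@weight1 R E) FA (adm3_sum (@weight1 R E) (adm_cindic mA)).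
apply: adm3_weight => //; first exact: weightM (@weight1 R E).
by move=> x; rewrite mulr1.
Qed.

Lemma adm3_23 m w : weight m -> adm2 e m w -> adm3 e m (fun _ g k => w g k).
Proof. by move=> mW wA; exact: (adm3_swap12 (adm3_swap23 (adm3_12 mW wA))). Qed.

Lemma adm3_12_3 m w : weight m -> adm2 e m w -> adm3 e m (fun f g k => w (f + g) k).
Proof.
move=> mW wA.
exact: (adm3_swap23 (adm3_swap12 (adm3_1_23 mW (adm2_swap wA)))).
Qed.

Lemma wint_mono mu m m' : cmeasure mu -> weight m -> weight m' -> (forall x, m x <= m' x) ->
  wint mu m' -> wint mu m.
Proof.
move=> cmu mW mW' mm; apply: (wint_le (C := 1)) => //.
- exact: weight_nonneg.
- exact: weight_nonneg.
- by move=> x; rewrite mul1r.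
Qed.

Lemma le_weightMl m m' x : weight m -> weight m' -> m x <= m x * m' x.
Proof. by move=> mW mW'; rewrite ler_peMr ?(weight_ge0 _ mW)// weight_ge1. Qed.
Section Rep.
Variables (lam kap : {finite_measure set (ilBorel E) -> \bar R})
  (u v : ilBorel E -> R[i]) (mu nu : set E -> R[i]) (m : E -> R) (w : E -> E -> R[i]).
Hypotheses (muP : crep lam (fun x => x) u mu) (u0 : forall x, ~ W x -> u x = 0).
Hypotheses (nuP : crep kap (fun x => x) v nu) (v0 : forall x, ~ W x -> v x = 0).
Hypotheses (mW : weight m) (imu : wint mu m) (inu : wint nu m) (wA : adm2 e m w).

Definition retr_sum (p : EE) : ilBorel E := r p.1 + r p.2.

(** The convolution is the image under addition of the density [u v w] on the product. As a [crep]
    it inherits countable additivity, the bounds on norm and moments, and the computation of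
    integrals against it. *)
Lemma twisted_crep :
  crep (finite_prod lam kap) retr_sum (prod_density e u v w) (twisted_conv w mu nu).
Proof.
split; first exact: retr2_add_measurable.
  exact: (prod_density_integrable muP u0 nuP v0 mW imu inu wA).
apply/funext => A; rewrite /twisted_conv; case: asboolP => // mA.
rewrite (cint_prod1 muP u0 nuP v0 mW imu inu (adm2_indic mW wA mA)).
by apply: eq_Cint => p; rewrite /prod_density mulrA.
Qed.

Lemma tvnorm_rep : tvnorm mu = Rintegral lam setT (fun x => normc (u x)).
Proof.
have cmu := crep_cmeasure muP.
have := tvnormE cmu; rewrite (tvE muP); last exact: il_measurableT.
rewrite vmeasE; last exact: il_measurableT.
by move=> [->]; apply: eq_Rintegral => x _; rewrite indicT mulr1.
Qed.

Lemma retr_sum_in p : W (retr_sum p).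
Proof. by apply: is_subspaceD; [exact: cspan_subspace|exact: retr_in|exact: retr_in]. Qed.

Lemma rintegrable_weights m' (C : R) : weight m' -> wint mu m' -> wint nu m' -> 0 <= C ->
  rintegrable (lam \x kap)%E
    (fun p => (C * (normc (u p.1) * m' (r p.1))) * (normc (v p.2) * m' (r p.2))).
Proof.
move=> mW' im' in' C0.
have a0 x : 0 <= C * (normc (u x) * m' (r x)).
  by rewrite !mulr_ge0// ?normc_ge0 ?(weight_ge0 _ mW').
have b0 x : 0 <= normc (v x) * m' (r x).
  by rewrite mulr_ge0// ?normc_ge0 ?(weight_ge0 _ mW').
exact: (rintegrable_prod a0 b0 (rintegrableZ C (rintegrable_weight muP u0 mW' im'))
  (rintegrable_weight nuP v0 mW' in')).
Qed.

Lemma tvnorm_twisted1 : (forall f g, normc (w f g) <= 1) ->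
  tvnorm (twisted_conv w mu nu) <= tvnorm mu * tvnorm nu.
Proof.
move=> w1; apply: le_trans (tvnorm_crep twisted_crep) _.
have iu : rintegrable lam (fun x => normc (u x)) by have [_ + _] := muP => /cintegrable_normc.
have iv : rintegrable kap (fun x => normc (v x)) by have [_ + _] := nuP => /cintegrable_normc.
rewrite tvnorm_rep.
have -> : tvnorm nu = Rintegral kap setT (fun x => normc (v x)).
  have cnu := crep_cmeasure nuP.
  have := tvnormE cnu; rewrite (tvE nuP); last exact: il_measurableT.
  rewrite vmeasE; last exact: il_measurableT.
  by move=> [->]; apply: eq_Rintegral => x _; rewrite indicT mulr1.
rewrite -(Rintegral_prod (fun=> normc_ge0 _) (fun=> normc_ge0 _) iu iv).
apply: le_Rintegral => //.
- exact: cintegrable_normc (prod_density_integrable muP u0 nuP v0 mW imu inu wA).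
- exact: (rintegrable_prod (fun=> normc_ge0 _) (fun=> normc_ge0 _) iu iv).
move=> p _; rewrite /prod_density !Normc.normcM ler_piMr//.
by rewrite mulr_ge0 ?normc_ge0.
Qed.

(** The kernel costs a factor [m] in each variable, and the value of [m'] at the sum costs a factor
    [m'] in each variable; hence the product weight in the hypotheses. *)
Lemma wint_twisted m' : weight m' -> wint mu (fun x => m x * m' x) ->
  wint nu (fun x => m x * m' x) -> wint (twisted_conv w mu nu) m'.
Proof.
move=> mW' im' in'; have MW := weightM mW mW'.
apply: (wint_crep twisted_crep); first exact: weight_nonneg.
have [_ [C C0 wC]] := wA.
apply: (rintegrable_le _ (rintegrable_weights MW im' in' C0)).
  apply: measurable_funM.
    by case: mW' => _ mm' _; exact: (measurableT_comp mm' (retr2_add_measurable e)).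
  by apply: cmf_normc; exact: (prod_density_cmf muP nuP wA).
move=> [x y] /=; rewrite ger0_norm; last by rewrite mulr_ge0 ?normc_ge0 ?(weight_ge0 _ mW').
have [_ _ mD] := mW'.
have := wC _ _ (retr_in e x) (retr_in e y) => wxy.
have mxy := mD (r x) (r y).
rewrite /prod_density /retr_sum !Normc.normcM /=.
have -> : C * (normc (u x) * (m (r x) * m' (r x))) * (normc (v y) * (m (r y) * m' (r y))) =
   (m' (r x) * m' (r y)) * ((normc (u x) * normc (v y)) * (C * (m (r x) * m (r y)))) by ring.
apply: ler_pM => //; first exact: weight_ge0 mW'.
  by rewrite !mulr_ge0 ?normc_ge0.
by rewrite ler_wpM2l ?mulr_ge0 ?normc_ge0.
Qed.

Lemma cint_twisted m' H : weight m' -> wint mu (fun x => m x * m' x) ->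
  wint nu (fun x => m x * m' x) -> adm e m' H ->
  cint (twisted_conv w mu nu) H = cint mu (fun f => cint nu (fun g => w f g * H (f + g))).
Proof.
move=> mW' im' in' HA; have MW := weightM mW mW'.
have wHA : adm2 e (fun x => m x * m' x) (fun f g => w f g * H (f + g)).
  by apply: adm2M => //; exact: adm2_add.
rewrite (cint_prod1 muP u0 nuP v0 MW im' in' wHA).
rewrite (cint_rep twisted_crep (e := e)).
- by apply: eq_Cint => p; rewrite /prod_density mulrA.
- exact: retr_sum_in.
- by case: HA.
have := cintegrable_normc (prod_density_integrable muP u0 nuP v0 MW im' in' wHA).
by under eq_fun do rewrite /prod_density mulrA Normc.normcM.
Qed.

End Rep.

Lemma onW_twisted mu nu m w : onW e mu -> onW e nu -> weight m -> wint mu m -> wint nu m ->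
  adm2 e m w -> onW e (twisted_conv w mu nu).
Proof.
move=> muW nuW mW imu inu wA.
have [lam [u [ru u0]]] := onW_rep muW; have [kap [v [rv v0]]] := onW_rep nuW.
have tc := twisted_crep ru u0 rv v0 mW imu inu wA.
split; first exact: crep_cmeasure tc.
have mWW := cspan_measurable e.
move=> A mA; rewrite !(crepE tc)//; last exact: il_measurableI.
apply: eq_Cint => p; congr (_ * _%:C); rewrite !indicE; congr (_%:R).
by congr nat_of_bool; rewrite in_setI (mem_set (retr_sum_in p)) andbT.
Qed.

Definition cint3 (x y z : set E -> R[i]) F := cint x (fun f => cint y (fun g => cint z (F f g))).

Lemma cint3_swap12 x y z m F : onW e x -> onW e y -> onW e z -> weight m ->
  wint x m -> wint y m -> wint z m -> adm3 e m F ->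
  cint3 x y z F = cint3 y x z (fun g f k => F f g k).
Proof.
move=> xW yW zW mW ix iy iz FA; rewrite /cint3.
by rewrite (cint_swap xW yW mW ix iy (adm2_cint zW mW iz FA)).
Qed.

Lemma cint3_swap23 x y z m F : onW e x -> onW e y -> onW e z -> weight m ->
  wint x m -> wint y m -> wint z m -> adm3 e m F ->
  cint3 x y z F = cint3 x z y (fun f k g => F f g k).
Proof.
move=> xW yW zW mW ix iy iz FA; rewrite /cint3.
apply: (eq_cint xW mW ix).
  exact: (adm_cint yW mW iy (adm2_cint zW mW iz FA)).
by move=> f Wf; rewrite (cint_swap yW zW mW iy iz (adm3_fst mW FA Wf)).
Qed.

Lemma cint3_lin x y z m a F F' : onW e x -> onW e y -> onW e z -> weight m ->
  wint x m -> wint y m -> wint z m -> adm3 e m F -> adm3 e m F' ->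
  cint3 x y z (fun f g k => a * F f g k + F' f g k) = a * cint3 x y z F + cint3 x y z F'.
Proof.
move=> xW yW zW mW ix iy iz FA FA'; rewrite /cint3.
have A2 := adm2_cint zW mW iz FA; have A2' := adm2_cint zW mW iz FA'.
have A1 := adm_cint yW mW iy A2; have A1' := adm_cint yW mW iy A2'.
rewrite -(cint_lin a xW mW ix A1 A1').
have A3 := adm3_lin a mW FA FA'.
apply: (eq_cint xW mW ix); first exact: (adm_cint yW mW iy (adm2_cint zW mW iz A3)).
move=> f Wf; rewrite -(cint_lin a yW mW iy (adm2_fst mW A2 Wf) (adm2_fst mW A2' Wf)).
apply: (eq_cint yW mW iy); first exact: (adm2_fst mW (adm2_cint zW mW iz A3) Wf).
move=> g Wg; rewrite -(cint_lin a zW mW iz)//.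
- exact: (adm2_fst mW (adm3_fst mW FA Wf) Wg).
- exact: (adm2_fst mW (adm3_fst mW FA' Wf) Wg).
Qed.

Section Composition.
Variables (x y z : set E -> R[i]) (m : E -> R) (w w' : E -> E -> R[i]).
Hypotheses (xW : onW e x) (yW : onW e y) (zW : onW e z) (mW : weight m).
(** One factor [m] is spent on each of the two kernels. *)
Let M t := m t * m t.
Hypotheses (ix : wint x M) (iy : wint y M) (iz : wint z M).
Hypotheses (wA : adm2 e m w) (wA' : adm2 e m w').

Let MW : weight M. Proof. exact: weightM. Qed.
Let mM t : m t <= M t. Proof. exact: le_weightMl. Qed.
Let ix1 : wint x m. Proof. by apply: (wint_mono _ mW MW mM ix); case: xW. Qed.
Let iy1 : wint y m. Proof. by apply: (wint_mono _ mW MW mM iy); case: yW. Qed.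
Let iz1 : wint z m. Proof. by apply: (wint_mono _ mW MW mM iz); case: zW. Qed.

(** Together with [twisted_comp_l] this turns identities between iterated convolutions into
    identities of kernels under one triple integral. Both are written with [f + (g + k)] to make
    them comparable. *)
Lemma twisted_comp_r A : il_measurable A ->
  twisted_conv w x (twisted_conv w' y z) A =
  cint3 x y z (fun f g k => w' g k * w f (g + k) * cindic A (f + (g + k))).
Proof.
move=> mA; rewrite (twisted_convE _ _ _ mA).
have [l2 [u2 [r2 v2]]] := onW_rep yW; have [l3 [u3 [r3 v3]]] := onW_rep zW.
have tW := onW_twisted yW zW mW iy1 iz1 wA'.
have it := wint_twisted r2 v2 r3 v3 mW iy1 iz1 wA' mW iy iz.
have wiA := adm2_indic mW wA mA.
apply: (eq_cint xW mW ix1); first exact: (adm_cint tW mW it wiA).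
move=> f Wf.
rewrite (cint_twisted r2 v2 r3 v3 mW iy1 iz1 wA' mW iy iz (adm2_fst mW wiA Wf)).
congr cint; apply/funext => g; congr cint; apply/funext => k.
by rewrite mulrA.
Qed.

Lemma twisted_comp_l A : il_measurable A ->
  twisted_conv w (twisted_conv w' x y) z A =
  cint3 x y z (fun f g k => w' f g * w (f + g) k * cindic A (f + (g + k))).
Proof.
move=> mA; rewrite (twisted_convE _ _ _ mA).
have [l2 [u2 [r2 v2]]] := onW_rep xW; have [l3 [u3 [r3 v3]]] := onW_rep yW.
have wiA := adm2_indic mW wA mA.
rewrite (cint_twisted r2 v2 r3 v3 mW ix1 iy1 wA' mW ix iy (adm_cint zW mW iz1 wiA)).
have HA : adm2 e M (fun f g => w' f g * cint z (fun k => w (f + g) k * cindic A (f + g + k))).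
  by apply: adm2M => //; apply: (adm2_add mW (adm_cint zW mW iz1 wiA)).
apply: (eq_cint xW MW ix); first exact: (adm_cint yW MW iy HA).
move=> f Wf; apply: (eq_cint yW MW iy); first exact: (adm2_fst MW HA Wf).
move=> g Wg; have Wfg := is_subspaceD (cspan_subspace e) Wf Wg.
rewrite -(cintZ _ zW mW iz1 (adm2_fst mW wiA Wfg)); congr cint; apply/funext => k.
by rewrite mulrA addrA.
Qed.

Lemma adm3_comp_r A : il_measurable A ->
  adm3 e M (fun f g k => w' g k * w f (g + k) * cindic A (f + (g + k))).
Proof.
move=> mA; apply: adm3_indic => //.
exact: (adm3M mW mW (adm3_23 mW wA') (adm3_1_23 mW wA)).
Qed.

Lemma adm3_comp_l A : il_measurable A ->
  adm3 e M (fun f g k => w' f g * w (f + g) k * cindic A (f + (g + k))).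
Proof.
move=> mA; apply: adm3_indic => //.
exact: (adm3M mW mW (adm3_12 mW wA') (adm3_12_3 mW wA)).
Qed.

End Composition.
End Twisted.

Lemma conjC0 (R : realType) : (0 : R[i])^* = 0.
Proof. by apply: eq_ReIm => //=; rewrite oppr0. Qed.

Lemma conjC_real (R : realType) (x : R) : (x%:C)^* = x%:C.
Proof. by apply: eq_ReIm => //=; rewrite oppr0. Qed.

(** * Linearity and the involution *)

Section MeasureLinearity.
Context (R : realType) (E : lmodType R) (e : nat -> E).
Local Notation W := (cspan e).
Local Notation r := (retr e).
Implicit Types (mu nu rho : set E -> R[i]) (m : E -> R) (w : E -> E -> R[i]).

Lemma onW_rep2 mu nu : onW e mu -> onW e nu ->
  exists (lam : {finite_measure set (ilBorel E) -> \bar R}) u v,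
  [/\ crep lam (fun x => x) u mu, crep lam (fun x => x) v nu,
      forall x, ~ W x -> u x = 0 & forall x, ~ W x -> v x = 0].
Proof.
move=> [cmu cW] [cnu cW']; have [lam [u [v [ru rv]]]] := exists_crep2 cmu cnu.
have mW := cspan_measurable e.
exists lam, (fun x => u x * (\1_W x : R)%:C), (fun x => v x * (\1_W x : R)%:C); split.
- exact: crep_on.
- exact: crep_on.
- by move=> x Wx; rewrite indicE memNset// mulr0.
- by move=> x Wx; rewrite indicE memNset// mulr0.
Qed.

Lemma crep_lin (lam : {finite_measure set (ilBorel E) -> \bar R}) u v mu nu a :
  crep lam (fun x => x) u mu -> crep lam (fun x => x) v nu ->
  crep lam (fun x => x) (fun x => a * u x + v x) (a *: mu + nu).
Proof.
move=> ru rv; have [mid iu muE] := ru; have [_ iv nuE] := rv; split => //.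
  by apply: cintegrableD => //; exact: cintegrableZ.
apply/funext => A.
have -> : (a *: mu + nu) A = a * mu A + nu A by [].
case: asboolP => mA; last first.
  by rewrite (crep_out ru mA) (crep_out rv mA) mulr0 addr0.
rewrite (crepE ru mA) (crepE rv mA).
have iuA := cintegrable_indic ru mA; have ivA := cintegrable_indic rv mA.
rewrite -(CintZ a iuA) -(CintD (cintegrableZ a iuA) ivA).
by apply: eq_Cint => x; rewrite mulrDl mulrA.
Qed.

Lemma onW_lin a mu nu : onW e mu -> onW e nu -> onW e (a *: mu + nu).
Proof. by move=> [cmu Wmu] [cnu Wnu]; split; [exact: cmeasure_lin|exact: conc_lin]. Qed.

Lemma cint_meas_lin a mu nu m h : onW e mu -> onW e nu -> weight m ->
  wint mu m -> wint nu m -> adm e m h ->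
  cint (a *: mu + nu) h = a * cint mu h + cint nu h.
Proof.
move=> muW nuW mW imu inu hA.
have [lam [u [v [ru rv u0 v0]]]] := onW_rep2 muW nuW.
have [cmu _] := muW; have [cnu _] := nuW.
have il := wint_lin a cmu cnu (weight_nonneg mW) imu inu.
have w0 x : ~ W x -> a * u x + v x = 0 by move=> Wx; rewrite u0// v0// mulr0 addr0.
rewrite (cint_adm ru u0 mW imu hA) (cint_adm rv v0 mW inu hA).
rewrite (cint_adm (crep_lin a ru rv) w0 mW il hA).
have iu := cintegrable_adm ru u0 mW imu hA; have iv := cintegrable_adm rv v0 mW inu hA.
rewrite -(CintZ a iu) -(CintD (cintegrableZ a iu) iv).
by apply: eq_Cint => x; rewrite mulrDl mulrA.
Qed.

Lemma twisted_linl a mu nu rho m w : onW e mu -> onW e nu -> onW e rho -> weight m ->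
  wint mu m -> wint nu m -> wint rho m -> adm2 e m w ->
  twisted_conv w (a *: mu + nu) rho = a *: twisted_conv w mu rho + twisted_conv w nu rho.
Proof.
move=> muW nuW rW mW imu inu ir wA; apply/funext => A.
have -> : (a *: twisted_conv w mu rho + twisted_conv w nu rho) A =
  a * twisted_conv w mu rho A + twisted_conv w nu rho A by [].
have [mA|mA] := pselect (il_measurable A); last first.
  by rewrite !twisted_conv_out// mulr0 addr0.
rewrite !(twisted_convE _ _ _ mA).
exact: (cint_meas_lin a muW nuW mW imu inu (adm_cint rW mW ir (adm2_indic mW wA mA))).
Qed.

Lemma twisted_linr a mu nu rho m w : onW e mu -> onW e nu -> onW e rho -> weight m ->
  wint mu m -> wint nu m -> wint rho m -> adm2 e m w ->
  twisted_conv w rho (a *: mu + nu) = a *: twisted_conv w rho mu + twisted_conv w rho nu.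
Proof.
move=> muW nuW rW mW imu inu ir wA; apply/funext => A.
have -> : (a *: twisted_conv w rho mu + twisted_conv w rho nu) A =
  a * twisted_conv w rho mu A + twisted_conv w rho nu A by [].
have [mA|mA] := pselect (il_measurable A); last first.
  by rewrite !twisted_conv_out// mulr0 addr0.
rewrite !(twisted_convE _ _ _ mA).
have wiA := adm2_indic mW wA mA.
have A1 := adm_cint muW mW imu wiA; have A2 := adm_cint nuW mW inu wiA.
rewrite -(cint_lin a rW mW ir A1 A2).
have [cmu _] := muW; have [cnu _] := nuW.
have il := wint_lin a cmu cnu (weight_nonneg mW) imu inu.
apply: (eq_cint rW mW ir); first exact: (adm_cint (onW_lin a muW nuW) mW il wiA).
move=> f Wf; exact: (cint_meas_lin a muW nuW mW imu inu (adm2_fst mW wiA Wf)).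
Qed.

Lemma twisted_kernel_lin a mu nu m w w' : onW e mu -> onW e nu -> weight m ->
  wint mu m -> wint nu m -> adm2 e m w -> adm2 e m w' ->
  twisted_conv (fun f g => a * w f g + w' f g) mu nu =
  a *: twisted_conv w mu nu + twisted_conv w' mu nu.
Proof.
move=> muW nuW mW imu inu wA wA'; apply/funext => A.
have -> : (a *: twisted_conv w mu nu + twisted_conv w' mu nu) A =
  a * twisted_conv w mu nu A + twisted_conv w' mu nu A by [].
have [mA|mA] := pselect (il_measurable A); last first.
  by rewrite !twisted_conv_out// mulr0 addr0.
rewrite !(twisted_convE _ _ _ mA).
have iA := adm2_indic mW wA mA; have iA' := adm2_indic mW wA' mA.
have iA2 := adm2_indic mW (adm2_lin a mW wA wA') mA.
rewrite -(cint_lin a muW mW imu (adm_cint nuW mW inu iA) (adm_cint nuW mW inu iA')).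
apply: (eq_cint muW mW imu); first exact: (adm_cint nuW mW inu iA2).
move=> f Wf; rewrite -(cint_lin a nuW mW inu (adm2_fst mW iA Wf) (adm2_fst mW iA' Wf)).
congr cint; apply/funext => g; by rewrite mulrDl mulrA.
Qed.

Lemma twisted_swap mu nu m w : onW e mu -> onW e nu -> weight m ->
  wint mu m -> wint nu m -> adm2 e m w ->
  twisted_conv w mu nu = twisted_conv (fun g f => w f g) nu mu.
Proof.
move=> muW nuW mW imu inu wA; apply/funext => A.
have [mA|mA] := pselect (il_measurable A); last by rewrite !twisted_conv_out.
rewrite !(twisted_convE _ _ _ mA) (cint_swap muW nuW mW imu inu (adm2_indic mW wA mA)).
congr cint; apply/funext => g; congr cint; apply/funext => f.
by rewrite addrC.
Qed.

(** The definition of [measure_star] makes no test of measurability; a set and its reflection are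
    measurable together, so the normalization off the Borel sets is inherited. *)
Lemma measure_star_out mu A : cmeasure mu -> ~ il_measurable A -> measure_star mu A = 0.
Proof.
move=> cmu mA; rewrite /measure_star cmeasure_out ?conjC0// => h; apply: mA.
have := opp_measurable (il_measurableT (E := E)) h; rewrite setTI.
congr (il_measurable _); apply/seteqP; split=> x /=; by rewrite opprK.
Qed.

Lemma opp_il_measurable A : il_measurable A -> il_measurable [set x : E | A (- x)].
Proof.
move=> mA; have := opp_measurable (il_measurableT (E := E)) mA; by rewrite setTI.
Qed.

Definition opp_retr : ilBorel E -> ilBorel E := fun x => - r x.

Lemma measure_star_crep (lam : {finite_measure set (ilBorel E) -> \bar R}) u mu :
  crep lam (fun x => x) u mu -> (forall x, ~ W x -> u x = 0) ->
  crep lam opp_retr (fun x => (u x)^*) (measure_star mu).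
Proof.
move=> ru u0; have [_ iu muE] := ru; have cmu := crep_cmeasure ru.
have mo : measurable_fun setT opp_retr.
  exact: (measurableT_comp (@opp_measurable R E) (retr_measurable e)).
split => //.
  apply: (cintegrable_le _ (cintegrable_normc iu)).
    by have := cmfJ (cintegrable_cmf iu).
  by move=> x; rewrite normcJ_.
apply/funext => A; case: asboolP => mA; last exact: measure_star_out.
have mA' := opp_il_measurable mA.
rewrite /measure_star (crepE ru mA') -CintJ; last exact: (cintegrable_indic ru mA').
apply: eq_Cint => x; rewrite rmorphM /= conjC_real.
have [Wx|Wx] := pselect (W x); last by rewrite u0// conjC0 !mul0r.
congr (_ * _%:C); rewrite /opp_retr retr_id// !indicE; congr (_%:R).
Qed.

Lemma opp_retr_in x : W (opp_retr x).
Proof. by apply: is_subspaceN; [exact: cspan_subspace|exact: retr_in]. Qed.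

Lemma onW_star mu : onW e mu -> onW e (measure_star mu).
Proof.
move=> muW; have [lam [u [ru u0]]] := onW_rep muW.
have rs := measure_star_crep ru u0; split; first exact: crep_cmeasure rs.
have mW := cspan_measurable e.
move=> A mA; rewrite !(crepE rs)//; last exact: il_measurableI.
apply: eq_Cint => x; congr (_ * _%:C); rewrite !indicE; congr (_%:R).
by congr nat_of_bool; rewrite in_setI (mem_set (opp_retr_in x)) andbT.
Qed.

Definition even_weight m := weight m /\ forall x, m (- x) = m x.

Lemma wint_star mu m : onW e mu -> even_weight m -> wint mu m -> wint (measure_star mu) m.
Proof.
move=> muW [mW mN] im; have [lam [u [ru u0]]] := onW_rep muW.
apply: (wint_crep (measure_star_crep ru u0)); first exact: weight_nonneg.
have := rintegrable_weight ru u0 mW im.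
by under eq_fun do rewrite mulrC -mN -normcJ_.
Qed.

Lemma adm_opp m h : even_weight m -> adm e m h -> adm e m (fun x => h (- x)).
Proof.
move=> [mW mN] hA; have Ws := cspan_subspace e; split.
  apply: (cmf_adm hA (al := fun x : ilBorel E => - r x)) => [|x].
    exact: (measurableT_comp (@opp_measurable R E) (retr_measurable e)).
  exact: opp_retr_in.
have [_ [C C0 hC]] := hA; exists C => // x Wx; rewrite -mN; apply: hC.
exact: is_subspaceN.
Qed.

Lemma adm_conj m h : adm e m h -> adm e m (fun x => (h x)^*).
Proof.
move=> [hm [C C0 hC]]; split; first exact: cmfJ.
by exists C => // x Wx; rewrite normcJ_ hC.
Qed.

Lemma cint_star mu m h : onW e mu -> even_weight m -> wint mu m -> adm e m h ->
  cint (measure_star mu) h = (cint mu (fun x => (h (- x))^*))^*.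
Proof.
move=> muW mE im hA; have [mW mN] := mE; have [lam [u [ru u0]]] := onW_rep muW.
have rs := measure_star_crep ru u0.
have hA' := adm_conj (adm_opp mE hA).
rewrite (cint_adm ru u0 mW im hA') -CintJ; last exact: (cintegrable_adm ru u0 mW im hA').
have E1 x : (u x * (h (- r x))^*)^* = (u x)^* * h (opp_retr x).
  by rewrite rmorphM /= conjCK.
under eq_Cint do rewrite E1.
apply: (cint_rep rs (e := e)); first exact: opp_retr_in.
  by case: hA.
have := cintegrable_normc (cintegrable_adm ru u0 mW im hA').
by under eq_fun do rewrite -normcJ_ E1 Normc.normcM.
Qed.

(** Reflection and conjugation pass through both integrals, and [w'] records their effect on the
    kernel. The order of the factors is kept here; reversing it is left to [twisted_swap]. *)
Lemma twisted_star mu nu m w w' : onW e mu -> onW e nu -> even_weight m ->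
  wint mu m -> wint nu m -> adm2 e m w -> adm2 e m w' ->
  (forall f g, w' f g = (w (- f) (- g))^*) ->
  measure_star (twisted_conv w mu nu) =
  twisted_conv w' (measure_star mu) (measure_star nu).
Proof.
move=> muW nuW mE imu inu wA wA' ww; have [mW mN] := mE.
have [ctc _] := onW_twisted muW nuW mW imu inu wA.
apply/funext => A; have [mA|mA] := pselect (il_measurable A); last first.
  by rewrite twisted_conv_out// measure_star_out.
have mA' := opp_il_measurable mA.
rewrite /measure_star !(twisted_convE _ _ _ mA) (twisted_convE _ _ _ mA').
have snW := onW_star nuW; have isn := wint_star nuW mE inu.
have iA := adm2_indic mW wA' mA; have iA' := adm2_indic mW wA mA'.
have E1 := cint_star muW mE imu (adm_cint snW mW isn iA).
apply: (etrans _ (esym E1)).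
apply: (congr1 (fun z : R[i] => z^*)).
apply: (eq_cint muW mW imu); first exact: (adm_cint nuW mW inu iA').
move=> f Wf; have Wf' := is_subspaceN (cspan_subspace e) Wf.
rewrite (cint_star nuW mE inu (adm2_fst mW iA Wf')) conjCK.
congr cint; apply/funext => g; rewrite rmorphM /= ww !opprK conjCK /cindic conjC_real.
congr (_ * _%:C); rewrite !indicE; congr (_%:R).
by congr nat_of_bool; apply/idP/idP; rewrite !inE /= -opprD.
Qed.

Lemma tvnorm_star mu : onW e mu -> tvnorm (measure_star mu) = tvnorm mu.
Proof.
have le nu : onW e nu -> tvnorm (measure_star nu) <= tvnorm nu.
  move=> nuW; have [lam [u [ru u0]]] := onW_rep nuW.
  apply: le_trans (tvnorm_crep (measure_star_crep ru u0)) _.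
  rewrite (tvnorm_rep ru) le_eqVlt; apply/orP; left; apply/eqP.
  by apply: eq_Rintegral => x _; rewrite normcJ_.
move=> muW; apply/eqP; rewrite eq_le le//=.
have := le _ (onW_star muW); congr (tvnorm _ <= _); apply/funext => A.
rewrite /measure_star conjCK; congr mu; apply/seteqP; split=> x /=; by rewrite opprK.
Qed.

End MeasureLinearity.

(** * The Banach algebras and the classical limit *)

(** Convergence as [h] tends to 0 is tested along sequences of nonzero numbers, to which dominated
    convergence applies. *)
Lemma Rintegral_dct d (T : measurableType d) (R : realType)
    (pi : {measure set T -> \bar R}) (g : R -> T -> R) (G : T -> R) :
  (forall h, h != 0 -> rintegrable pi (g h)) -> rintegrable pi G ->
  (forall h t, h != 0 -> `|g h t| <= G t) ->
  (forall t, g h t @[h --> 0^'] --> (0 : R)) ->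
  Rintegral pi setT (g h) @[h --> 0^'] --> (0 : R).
Proof.
move=> ig iG gG g0; apply/cvgr_dnbhsP => s [s0 sc].
have H := @dominated_cvg _ _ _ pi setT measurableT (fun n t => (g (s n) t)%:E)
  (fun=> 0%E) (fun t => (G t)%:E).
have {H} : (\int[pi]_t (g (s n) t)%:E)%E @[n --> \oo] --> (\int[pi]_t 0%E)%E.
  apply: H => //.
  - by move=> n; exact: (measurable_int pi (ig _ (s0 n))).
  - move=> t _; apply/fine_cvgP; split; first exact: nearW.
    by have /cvgr_dnbhsP/(_ s (conj s0 sc)) := g0 t.
  - by move=> n t _; rewrite lee_fin gG.
by rewrite integral0 => /fine_cvgP[].
Qed.

(** * Trigonometric estimates and limits *)

Section Trigonometry.
Context (R : realType).
Implicit Types (t s : R).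

Lemma sin_le_norm t : `|sin t| <= `|t|.
Proof.
wlog t0 : t / 0 <= t.
  move=> H; have [/H//|t0] := leP 0 t.
  by rewrite -normrN -sinN -(normrN t); apply: H; lra.
have [|c _] := @MVT_segment R sin cos 0 t t0 (fun x _ => is_derive_sin x).
  exact/continuous_subspaceT/continuous_sin.
by rewrite sin0 !subr0 => ->; rewrite normrM ler_piMl// cos_max.
Qed.

Lemma normc_expi t : normc (expi t) = 1.
Proof. by rewrite normcE2 /= cos2Dsin2 sqrtr1. Qed.

Lemma expiD t s : expi (t + s) = expi t * expi s.
Proof.
apply: eq_ReIm; rewrite !reimE /= ?cosD ?sinD //.
by rewrite addrC.
Qed.

Lemma conjC_expi t : (expi t)^* = expi (- t).
Proof. by apply: eq_ReIm; rewrite !reimE /= ?cosN ?sinN. Qed.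

Lemma expi0 : expi 0 = 1 :> R[i].
Proof. by apply: eq_ReIm; rewrite /= ?cos0 ?sin0. Qed.

Lemma cmf_expi d (T : measurableType d) (f : T -> R) :
  measurable_fun setT f -> cmf (fun x => expi (f x)).
Proof.
move=> mf; split => /=.
  exact: (measurableT_comp (continuous_measurable_fun (@continuous_cos R)) mf).
exact: (measurableT_comp (continuous_measurable_fun (@continuous_sin R)) mf).
Qed.

(** This is the difference quotient at 0 of the function [2 sin (h s / 2)] of [h], whose derivative
    there is [s]. *)
Lemma sinc_cvg s : 2 / h * sin (h / 2 * s) @[h --> (0 : R)^'] --> s.
Proof.
have D : is_derive (0 : R) 1 (fun h : R => 2 * sin (h / 2 * s)) s.
  apply: is_derive_eq; rewrite mul0r mul0r cos0 /GRing.scale/=; by field.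
have H : cvg ((fun h : R => h^-1 *: (((fun h : R => 2 * sin (h / 2 * s)) \o shift 0) (h *: (1 : R))
    - 2 * sin (0 / 2 * s))) @ (0 : R)^') := @ex_derive _ _ _ _ _ _ _ D.
move: H; rewrite -[lim _]/('D_1 (fun h : R => 2 * sin (h / 2 * s)) 0) (derive_val (is_derive := D)).
apply: cvg_trans; apply: near_eq_cvg; near=> h.
rewrite /= !mul0r sin0 mulr0 subr0 addr0 /GRing.scale /= mulr1; ring.
Unshelve. all: by end_near.
Qed.

Lemma normc_expiB1_cvg s : normc (expi (- (h / 2 * s)) - 1) @[h --> (0 : R)^'] --> (0 : R).
Proof.
have h0 : -(h / 2 * s) @[h --> (0 : R)^'] --> (0 : R).
  have {2}<- : - (0 / 2 * s) = 0 by rewrite !mul0r oppr0.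
  apply: cvgN; by apply: cvgMr_tmp; apply: cvgMr_tmp; exact: cvg_within.
have c0 : cos (-(h / 2 * s)) @[h --> (0 : R)^'] --> cos (0 : R).
  by apply: (continuous_cvg _ _ h0); exact: continuous_cos.
have s0 : sin (-(h / 2 * s)) @[h --> (0 : R)^'] --> sin (0 : R).
  by apply: (continuous_cvg _ _ h0); exact: continuous_sin.
have H : `|cos (-(h / 2 * s)) - 1| + `|sin (-(h / 2 * s))| @[h --> (0 : R)^'] --> (0 : R).
  rewrite sin0 in s0; rewrite cos0 in c0.
  have {2}<- : `|1 - 1| + `|0 : R| = 0 by rewrite subrr !normr0 addr0.
  apply: cvgD; apply: cvg_norm => //; by apply: cvgB => //; exact: cvg_cst.
apply: squeeze_dist H; apply: nearW => h.
rewrite subr0 ger0_norm ?normc_ge0//; apply: le_trans (normc_le _) _.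
by rewrite !reimE /= oppr0 addr0.
Qed.
End Trigonometry.

Section SigmaKernels.
Context (R : realType) (E : lmodType R) (sigma : {biscalar E}) (vs : E -> R) (c : R).
Hypotheses (vsP : seminorm vs) (c_gt0 : 0 < c).
Hypothesis (sigma_bound : forall f g, `|sigma f g| <= c * vs f * vs g).

(** Expand [sigma] around [(x, y)]: with [t] the larger of the two distances and [t <= 1], the three
    terms add up to at most [S t]. The factor [1 + S / eps] in the semi-norm forces both [t <= 1]
    and [S t < eps]. *)
Lemma sigma_il_continuous2 : il_continuous2 (fun f g => sigma f g).
Proof.
move=> x y eps e0.
have [v0 _ _] := vsP.
pose S := c * (1 + vs x + vs y).
have S0 : 0 <= S by rewrite mulr_ge0 ?addr_ge0 ?v0// ltW.
have K0 : 0 <= 1 + S / eps by rewrite addr_ge0// divr_ge0// ltW.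
exists (fun z => (1 + S / eps) * vs z); first exact: seminormZl.
move=> x' y' hx hy.
pose t := Num.max (vs (x' - x)) (vs (y' - y)).
have t0 : 0 <= t by rewrite le_max v0.
have Kt : (1 + S / eps) * t < 1 by rewrite /t; case: (leP (vs (x' - x)) (vs (y' - y))).
have t1 : t <= 1.
  by apply: le_trans (ltW Kt); rewrite ler_peMl// lerDl divr_ge0// ltW.
have St : S * t < eps.
  have : S / eps * t < 1 by apply: le_lt_trans Kt; rewrite mulrDl mul1r lerDr.
  by rewrite mulrAC ltr_pdivrMr// mul1r.
have at_ : vs (x' - x) <= t by rewrite le_max lexx.
have bt : vs (y' - y) <= t by rewrite le_max lexx orbT.
have -> : sigma x' y' - sigma x y = sigma (x' - x) (y' - y) + sigma (x' - x) y + sigma x (y' - y).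
  by rewrite !linearBl !linearBr /=; ring.
apply: le_lt_trans St.
apply: le_trans (ler_normD _ _) _.
have -> : S * t = (c * t * 1 + c * t * vs y) + c * vs x * t by rewrite /S; ring.
apply: lerD; last first.
  by apply: le_trans (sigma_bound _ _) _; rewrite ler_wpM2l// mulr_ge0// ltW.
apply: le_trans (ler_normD _ _) _; apply: lerD; apply: le_trans (sigma_bound _ _) _.
  apply: ler_pM => //; first by rewrite mulr_ge0// ltW.
    by rewrite ler_wpM2l// ltW.
  exact: le_trans t1.
by rewrite ler_wpM2r// ler_wpM2l// ltW.
Qed.

Definition expi_sigma (h : R) f g : R[i] := expi (- (h / 2 * sigma f g)).
Definition csigma f g : R[i] := (sigma f g)%:C.

Lemma adm2_expi_sigma e h : adm2 e (fun=> 1) (expi_sigma h).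
Proof.
split.
  apply: cmf_expi; apply: measurableT_comp => //; apply: measurable_funM => //.
  exact: (retr2_measurable _ sigma_il_continuous2).
by exists 1 => // f g _ _; rewrite normc_expi !mul1r.
Qed.

Definition vs_weight x := 1 + vs x.

Lemma vs_weightP : weight vs_weight.
Proof.
have [v0 _ vD] := vsP; split => [x||x y].
- by rewrite lerDl.
- apply: measurable_funD => //; exact: seminorm_measurable.
- rewrite /vs_weight; have := vD x y; have := mulr_ge0 (v0 x) (v0 y); nra.
Qed.

Lemma adm2_csigma e : adm2 e vs_weight csigma.
Proof.
have [v0 _ vD] := vsP; split.
  apply: cmf_real; exact: (retr2_measurable _ sigma_il_continuous2).
exists c; first exact: ltW.
move=> f g _ _; rewrite normcR; apply: le_trans (sigma_bound f g) _.
rewrite -mulrA; apply: ler_wpM2l; first exact: ltW.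
by apply: ler_pM => //; rewrite lerDr.
Qed.
End SigmaKernels.

(** * Completeness in the total variation norm *)

Section Completeness.
Context (R : realType) (E : lmodType R).
Implicit Types (mu nu : set E -> R[i]).

Lemma real_cauchy_cvg (s : nat -> R) :
  (forall e : R, 0 < e -> exists N, forall m n, (N <= m)%N -> (N <= n)%N ->
    `|s m - s n| < e) -> cvg (s @ \oo).
Proof.
move=> H; apply: cauchy_cvg; apply: cauchy_exP => e e0.
have [N HN] := H e e0; exists (s N); exists N => // n /= Nn.
by rewrite /ball /=; apply: HN.
Qed.

(** The limit is taken set by set. The Cauchy condition is uniform over finite disjoint families
    ([unif]), which gives both countable additivity of the limit and convergence in norm; an
    approximant of [u N] in [M_fin] then approximates the limit. *)
Lemma ME_complete (u : nat -> set E -> R[i]) : (forall n, ME (u n)) ->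
  (forall e : R, 0 < e -> exists N, forall m n, (N <= m)%N -> (N <= n)%N ->
      tvnorm (u m - u n) < e) ->
  exists2 x, ME x & (fun n => tvnorm (u n - x)) @ \oo --> (0 : R).
Proof.
move=> Mu Cu.
have cu n : cmeasure (u n) := ME_cmeasure (Mu n).
have cB m n : cmeasure (u m - u n) := cmeasureB (cu m) (cu n).
have ptw A e : 0 < e -> exists N, forall m n, (N <= m)%N -> (N <= n)%N ->
    normc (u m A - u n A) < e.
  move=> e0; have [N HN] := Cu e e0; exists N => m n Nm Nn.
  exact: le_lt_trans (normc_tvnorm A (cB m n)) (HN m n Nm Nn).
have cre A : cvg ((fun n => complex.Re (u n A)) @ \oo).
  apply: real_cauchy_cvg => e e0; have [N HN] := ptw A e e0; exists N => m n Nm Nn.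
  by apply: le_lt_trans (HN m n Nm Nn); rewrite -ReCN -ReCD normc_Re.
have cim A : cvg ((fun n => complex.Im (u n A)) @ \oo).
  apply: real_cauchy_cvg => e e0; have [N HN] := ptw A e e0; exists N => m n Nm Nn.
  by apply: le_lt_trans (HN m n Nm Nn); rewrite -ImCN -ImCD normc_Im.
pose mu : set E -> R[i] := fun A =>
  (lim ((fun n => complex.Re (u n A)) @ \oo)) +i* (lim ((fun n => complex.Im (u n A)) @ \oo)).
have lim_mu A : normc (u n A - mu A) @[n --> \oo] --> (0 : R).
  have H1 : complex.Re (u n A) - complex.Re (mu A) @[n --> \oo] --> (0 : R).
    by apply/subr_cvg0; exact: cre.
  have H2 : complex.Im (u n A) - complex.Im (mu A) @[n --> \oo] --> (0 : R).
    by apply/subr_cvg0; exact: cim.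
  have H : `|complex.Re (u n A) - complex.Re (mu A)| + `|complex.Im (u n A) - complex.Im (mu A)|
      @[n --> \oo] --> (0 : R).
    have <- : `|0 : R| + `|0 : R| = 0 by rewrite normr0 addr0.
    by apply: cvgD; exact: cvg_norm.
  apply: squeeze_dist H; apply: nearW => n.
  rewrite subr0 ger0_norm ?normc_ge0//; apply: le_trans (normc_le _) _.
  by rewrite !reimE.
have unif e : 0 < e -> exists N, forall n, (N <= n)%N -> forall k (F : 'I_k -> set E),
    (forall i, il_measurable (F i)) -> trivIset setT F ->
    \sum_(i < k) normc (u n (F i) - mu (F i)) <= e.
  move=> e0; have [N HN] := Cu e e0; exists N => n Nn k F mF tF.
  apply/ler_addgt0Pr => d d0.
  have H : \sum_(i < k) normc (u m (F i) - mu (F i)) @[m --> \oo] --> (0 : R).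
    elim: k F {mF tF} => [|k IH] F.
      by under eq_fun do rewrite big_ord0; exact: cvg_cst.
    rewrite (_ : (fun m => _) = (fun m => \sum_(i < k) normc (u m (F (widen_ord (leqnSn k) i)) -
        mu (F (widen_ord (leqnSn k) i))) + normc (u m (F ord_max) - mu (F ord_max)))); last first.
      by apply/funext => m; rewrite big_ord_recr.
    suff: \sum_(i < k) normc (u m (F (widen_ord (leqnSn k) i)) - mu (F (widen_ord (leqnSn k) i)))
      + normc (u m (F ord_max) - mu (F ord_max)) @[m --> \oo] --> (0 + 0 : R) by rewrite addr0.
    by apply: cvgD; [exact: (IH (fun i => F (widen_ord (leqnSn k) i)))|exact: lim_mu].
  move/cvgrPdist_lt : H => /(_ _ d0) [M _ HM].
  (* The index [m] depends on the family, but it only serves to pass from the Cauchy bound to the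
     limit. *)
  pose m := maxn N M.
  have Nm : (N <= m)%N := leq_maxl _ _.
  have := HM m (leq_maxr _ _); rewrite /= sub0r normrN => Hm.
  apply: (@le_trans _ _ (\sum_(i < k) (normc (u n (F i) - u m (F i)) +
      normc (u m (F i) - mu (F i))))).
    apply: ler_sum => i _; apply: le_trans (normcD _ _).
    by rewrite addrA subrK.
  rewrite big_split/=; apply: lerD; last exact: le_trans (ler_norm _) (ltW Hm).
  exact: le_trans (sum_tvnorm (cB n m) mF tF) (ltW (HN n m Nn Nm)).
have cmu : cmeasure mu.
  split.
  - apply: eq_ReIm => /=; under eq_fun do rewrite (cmeasure0 (cu _)); exact: lim_cst.
  - move=> A mA; apply: eq_ReIm => /=;
      under eq_fun do rewrite (cmeasure_out (cu _) mA); exact: lim_cst.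
  - move=> F mF tF; apply/cvgrPdist_lt => e e0.
    have e3 : 0 < e / 3 by rewrite divr_gt0.
    have [N HN] := unif _ e3; have {}HN := HN N (leqnn N).
    have [_ _ /(_ F mF tF)/cvgrPdist_lt/(_ _ e3)[M _ HM]] := cu N.
    exists M => // n /= Mn; have {HM} := HM n Mn => /=.
    rewrite !sub0r !normrN !ger0_norm ?normc_ge0// => h1.
    have h2 : normc (u N (\bigcup_i F i) - mu (\bigcup_i F i)) <= e / 3.
      have := HN 1%N (fun=> \bigcup_i F i) (fun=> il_measurable_bigcup mF).
      rewrite big_ord1; apply; apply/trivIsetP => i j _ _.
      by rewrite !ord1 eqxx.
    have h3 : normc (\sum_(0 <= i < n) (u N (F i) - mu (F i))) <= e / 3.
      rewrite big_mkord; apply: le_trans (normc_sum _ _) _.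
      apply: (HN n (fun i : 'I_n => F i)) => //.
      move/trivIsetP : tF => tF; apply/trivIsetP => i j _ _ ij; exact: tF.
    rewrite sumrB in h3.
    set a := \sum_(0 <= i < n) mu (F i) in h3 *; set b := mu _ in h2 *.
    set a' := \sum_(0 <= i < n) u N (F i) in h1 h3; set b' := u N _ in h1 h2.
    have -> : a - b = - (a' - a) + ((a' - b') + (b' - b)) by ring.
    apply: le_lt_trans (normcD _ _) _; rewrite normcNN.
    apply: (@le_lt_trans _ _ (e / 3 + (normc (a' - b') + e / 3))).
      by apply: lerD => //; apply: le_trans (normcD _ _) _; apply: lerD.
    by apply: (@lt_le_trans _ _ (e / 3 + (e / 3 + e / 3))); [lra|lra].
have cvg_mu e : 0 < e -> exists N, forall n, (N <= n)%N -> tvnorm (u n - mu) <= e.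
  move=> e0; have [N HN] := unif _ e0; exists N => n Nn.
  apply: tvnorm_le; first exact: ltW.
  by move=> k F mF tF; exact: HN.
exists mu.
  split=> // e e0; have e2 : 0 < e / 2 by rewrite divr_gt0.
  have [N /(_ N (leqnn N)) HN] := cvg_mu _ e2.
  have [_ /(_ _ e2)[nu Mnu Hnu]] := Mu N; exists nu => //.
  have cnu : cmeasure nu by case: Mnu => V _ [].
  have -> : mu - nu = (mu - u N) + (u N - nu) by rewrite addrA subrK.
  apply: le_lt_trans (tvnormD (cmeasureB cmu (cu N)) (cmeasureB (cu N) cnu)) _.
  rewrite tvnormBC; lra.
apply/cvgrPdist_lt => e e0; have e2 : 0 < e / 2 by rewrite divr_gt0.
have [N HN] := cvg_mu _ e2; exists N => // n /= Nn.
rewrite sub0r normrN ger0_norm ?tvnorm_ge0//; apply: le_lt_trans (HN _ Nn) _; lra.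
Qed.
End Completeness.

Section CommonSpan.
Context (R : realType) (E : lmodType R).
Implicit Types (mu nu rho : set E -> R[i]).

Lemma onW_ME e mu : onW e mu -> ME mu.
Proof. by move=> [cmu Wmu]; apply/MEP; split => //; exists e. Qed.

Lemma ME_onW mu : ME mu -> exists e, onW e mu.
Proof. by move=> /MEP[cmu [e We]]; exists e. Qed.

Lemma onW_sub e e' mu : cspan e `<=` cspan e' -> onW e mu -> onW e' mu.
Proof.
move=> ee' [cmu Wmu]; split => //; apply: (concS cmu _ ee' Wmu).
exact: cspan_measurable.
Qed.

Lemma ME_onW2 mu nu : ME mu -> ME nu -> exists e, onW e mu /\ onW e nu.
Proof.
move=> /ME_onW[e1 H1] /ME_onW[e2 H2]; have [e [s1 s2]] := cspan_join2 e1 e2.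
by exists e; split; [exact: onW_sub H1|exact: onW_sub H2].
Qed.

Lemma ME_onW3 mu nu rho : ME mu -> ME nu -> ME rho ->
  exists e, [/\ onW e mu, onW e nu & onW e rho].
Proof.
move=> Mmu Mnu /ME_onW[e2 H2]; have [e1 [H1 H1']] := ME_onW2 Mmu Mnu.
have [e [s1 s2]] := cspan_join2 e1 e2.
by exists e; split; [exact: onW_sub H1|exact: onW_sub H1'|exact: onW_sub H2].
Qed.

Lemma ME_M_fin mu : M_fin mu -> ME mu.
Proof.
move=> Mmu; split; first by case: Mmu => V _ [].
by move=> e e0; exists mu => //; rewrite subrr tvnorm0.
Qed.

Lemma tv_cvg_unique (u : nat -> set E -> R[i]) mu nu : (forall n, cmeasure (u n)) ->
  cmeasure mu -> cmeasure nu -> tv_cvg u mu -> tv_cvg u nu -> mu = nu.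
Proof.
move=> cu cmu cnu umu unu; apply/eqP; rewrite -subr_eq0; apply/eqP.
apply: (tvnorm_eq0 (cmeasureB cmu cnu)).
have H : tvnorm (u n - mu) + tvnorm (u n - nu) @[n --> \oo] --> (0 + 0 : R) by exact: cvgD.
rewrite addr0 in H.
apply/eqP; rewrite eq_le tvnorm_ge0 andbT; apply/ler_addgt0Pr => e e0; rewrite add0r.
move/cvgrPdist_lt : H => /(_ _ e0)[N _ /(_ N (leqnn N))] /=.
rewrite sub0r normrN => HN; apply: le_trans (ltW HN); apply: le_trans (ler_norm _).
have -> : mu - nu = (mu - u N) + (u N - nu) by rewrite addrA subrK.
by rewrite (tvnormBC (u N) mu); apply: tvnormD; exact: cmeasureB.
Qed.

Lemma M_fin_seq mu : ME mu -> exists u, (forall n, M_fin (u n)) /\ tv_cvg u mu.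
Proof.
move=> [cmu H].
have {}H n : exists nu, M_fin nu /\ tvnorm (mu - nu) < n.+1%:R^-1.
  by have [|nu] := H n.+1%:R^-1; [rewrite invr_gt0|exists nu].
have [u Hu] := choice H.
exists u; split=> [n|]; first by case: (Hu n).
apply: squeeze_dist (@cvg_harmonic R); apply: nearW => n.
by rewrite subr0 ger0_norm ?tvnorm_ge0// tvnormBC; apply: ltW; case: (Hu n).
Qed.

Lemma even_weight1 : @even_weight R E (fun=> 1).
Proof. by split => //; exact: weight1. Qed.
End CommonSpan.

Lemma sub_telescope (V : zmodType) (x y z : V) : y - z = (- x + y) + (- z + x).
Proof. by rewrite [RHS]addrC -[RHS]addrA (addrA x) subrr add0r addrC. Qed.

Lemma scale_sub1D (K : pzRingType) (V : lmodType K) (a : K) (x : V) : (a - 1) *: x + x = a *: x.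
Proof. by rewrite scalerBl scale1r subrK. Qed.

Lemma scale_subB (K : pzRingType) (V : lmodType K) (a : K) (x y z : V) :
  a *: (x - y) - z = (-1) *: z + a *: ((-1) *: y + x).
Proof. by rewrite !scaleN1r [RHS]addrC (addrC (- y)). Qed.

(** * The products and their limits *)

Section StarProduct.
Context (R : realType) (E : lmodType R) (sigma : {biscalar E}) (vs : E -> R) (c : R).
Hypotheses (sigmaP : presymplectic sigma) (vsP : seminorm vs) (c_gt0 : 0 < c).
Hypothesis (sigma_bound : forall f g, `|sigma f g| <= c * vs f * vs g).
Implicit Types (mu nu rho : set E -> R[i]) (h : R).

Local Notation K := (expi_sigma sigma).
Local Notation sf := (star_fin sigma).

Lemma star_finE h mu nu : sf h mu nu = twisted_conv (K h) mu nu.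
Proof. by []. Qed.

Let KA e h : adm2 e (fun=> 1) (K h).
Proof. exact: (adm2_expi_sigma vsP c_gt0 sigma_bound). Qed.
Let w1 : @weight R E (fun=> 1). Proof. exact: weight1. Qed.
Let i1 e mu : onW e mu -> wint mu (fun=> 1).
Proof. by move=> [cmu _]; exact: wint_cst. Qed.

Lemma ME_star_fin h mu nu : ME mu -> ME nu -> ME (sf h mu nu).
Proof.
move=> Mmu Mnu; have [e [H1 H2]] := ME_onW2 Mmu Mnu.
exact: onW_ME (onW_twisted H1 H2 w1 (i1 H1) (i1 H2) (KA e h)).
Qed.

Lemma star_fin_linl h a mu nu rho : ME mu -> ME nu -> ME rho ->
  sf h (a *: mu + nu) rho = a *: sf h mu rho + sf h nu rho.
Proof.
move=> Mmu Mnu Mrho; have [e [H1 H2 H3]] := ME_onW3 Mmu Mnu Mrho.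
exact: (twisted_linl a H1 H2 H3 w1 (i1 H1) (i1 H2) (i1 H3) (KA e h)).
Qed.

Lemma star_fin_linr h a mu nu rho : ME mu -> ME nu -> ME rho ->
  sf h rho (a *: mu + nu) = a *: sf h rho mu + sf h rho nu.
Proof.
move=> Mmu Mnu Mrho; have [e [H1 H2 H3]] := ME_onW3 Mmu Mnu Mrho.
exact: (twisted_linr a H1 H2 H3 w1 (i1 H1) (i1 H2) (i1 H3) (KA e h)).
Qed.

Lemma tvnorm_star_fin h mu nu : ME mu -> ME nu ->
  tvnorm (sf h mu nu) <= tvnorm mu * tvnorm nu.
Proof.
move=> Mmu Mnu; have [e [H1 H2]] := ME_onW2 Mmu Mnu.
have [lam [u [ru u0]]] := onW_rep H1; have [kap [v [rv v0]]] := onW_rep H2.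
apply: (tvnorm_twisted1 ru u0 rv v0 w1 (i1 H1) (i1 H2) (KA e h)) => f g.
by rewrite normc_expi.
Qed.

Lemma ME_sub mu nu : ME mu -> ME nu -> ME (mu - nu).
Proof. by move=> Mmu Mnu; rewrite addrC -scaleN1r; exact: ME_lin. Qed.

Lemma star_fin_cvg h (u v : nat -> set E -> R[i]) mu nu :
  (forall n, ME (u n)) -> (forall n, ME (v n)) -> ME mu -> ME nu ->
  tv_cvg u mu -> tv_cvg v nu -> tv_cvg (fun n => sf h (u n) (v n)) (sf h mu nu).
Proof.
move=> Mu Mv Mmu Mnu umu vnu.
have H : (tvnorm (u n - mu) + tvnorm mu) * tvnorm (v n - nu) + tvnorm (u n - mu) * tvnorm nu
    @[n --> \oo] --> ((0 + tvnorm mu) * 0 + 0 * tvnorm nu : R).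
  apply: cvgD; apply: cvgM => //; [|exact: cvg_cst].
  by apply: cvgD => //; exact: cvg_cst.
rewrite mulr0 mul0r addr0 in H.
apply: squeeze_dist H; apply: nearW => n.
rewrite subr0 ger0_norm ?tvnorm_ge0//.
have M1 := ME_sub (Mu n) Mmu; have M2 := ME_sub (Mv n) Mnu.
(* The usual bilinear splitting; the norms of [u n] are bounded by comparison with [mu]. *)
have -> : sf h (u n) (v n) - sf h mu nu = sf h (u n) (v n - nu) + sf h (u n - mu) nu.
  have -> : v n - nu = (-1) *: nu + v n by rewrite scaleN1r addrC.
  have -> : u n - mu = (-1) *: mu + u n by rewrite scaleN1r addrC.
  rewrite star_fin_linl// star_fin_linr// !scaleN1r.
  exact: sub_telescope.
apply: le_trans (tvnormD _ _) _; try by apply: ME_cmeasure; exact: ME_star_fin.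
apply: lerD; last exact: tvnorm_star_fin.
apply: le_trans (tvnorm_star_fin h (Mu n) M2) _.
rewrite ler_wpM2r ?tvnorm_ge0//.
have {1}-> : u n = (u n - mu) + mu by rewrite subrK.
by apply: tvnormD; exact: ME_cmeasure.
Qed.

(** The set from which [xget] chooses contains [sf h mu nu] by norm continuity. It has no other
    element, since each of its elements is the limit of one fixed sequence of products. *)
Lemma starE h mu nu : ME mu -> ME nu -> star sigma h mu nu = sf h mu nu.
Proof.
move=> Mmu Mnu; rewrite /star.
have [u [Mu umu]] := M_fin_seq Mmu; have [v [Mv vnu]] := M_fin_seq Mnu.
case: xgetP => [rho _ [Mrho H]|/(_ (sf h mu nu)) []].
  apply: (@tv_cvg_unique R E (fun n => sf h (u n) (v n))).
  - by move=> n; apply: ME_cmeasure; apply: ME_star_fin; exact: ME_M_fin.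
  - exact: ME_cmeasure.
  - by apply: ME_cmeasure; exact: ME_star_fin.
  - exact: H.
  - by apply: star_fin_cvg => // n; exact: ME_M_fin.
split; first exact: ME_star_fin.
by move=> u' v' Mu' Mv' H1 H2; apply: star_fin_cvg => // n; exact: ME_M_fin.
Qed.

Lemma star_finA h mu nu rho : ME mu -> ME nu -> ME rho ->
  sf h mu (sf h nu rho) = sf h (sf h mu nu) rho.
Proof.
move=> Mmu Mnu Mrho; have [e [H1 H2 H3]] := ME_onW3 Mmu Mnu Mrho.
have i11 t : onW e t -> wint t (fun=> 1 * 1) by move=> Ht; rewrite mulr1; exact: i1 Ht.
apply/funext => A; have [mA|mA] := pselect (il_measurable A); last first.
  by rewrite !star_finE !twisted_conv_out.
rewrite !star_finE.
rewrite (twisted_comp_r H1 H2 H3 w1 (i11 _ H1) (i11 _ H2) (i11 _ H3) (KA e h) (KA e h) mA).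
rewrite (twisted_comp_l H1 H2 H3 w1 (i11 _ H1) (i11 _ H2) (i11 _ H3) (KA e h) (KA e h) mA).
congr cint3; apply/funext => f; apply/funext => g; apply/funext => k.
(* The phases agree because the bilinear form is a 2-cocycle: [sigma g k + sigma f (g + k) = sigma f
   g + sigma (f + g) k]. *)
congr (_ * _); rewrite /expi_sigma -!expiD; congr expi.
rewrite linearDr linearDl /=; ring.
Qed.

Lemma ME_measure_star mu : ME mu -> ME (measure_star mu).
Proof. by move=> /ME_onW[e H]; exact: onW_ME (onW_star H). Qed.

Lemma measure_starK mu : measure_star (measure_star mu) = mu.
Proof.
apply/funext => A; rewrite /measure_star conjCK; congr mu.
by apply/seteqP; split=> x /=; rewrite opprK.
Qed.

Lemma measure_star_lin a mu nu :
  measure_star (a *: mu + nu) = a^* *: measure_star mu + measure_star nu.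
Proof.
apply/funext => A.
by rewrite /measure_star [LHS]rmorphD/=; congr (_ + _); rewrite [LHS]rmorphM.
Qed.

Lemma star_finM h mu nu : ME mu -> ME nu ->
  measure_star (sf h mu nu) = sf h (measure_star nu) (measure_star mu).
Proof.
move=> Mmu Mnu; have [e [H1 H2]] := ME_onW2 Mmu Mnu.
have KA' := adm2_swap (KA e h).
rewrite star_finE (twisted_star H1 H2 (even_weight1 E) (i1 H1) (i1 H2) (KA e h) KA').
  have S1 := onW_star H1; have S2 := onW_star H2.
  by rewrite (twisted_swap S1 S2 w1 (i1 S1) (i1 S2) KA').
(* By antisymmetry, conjugating the kernel exchanges its arguments; hence the factors are
   reversed. *)
move=> f g; rewrite /expi_sigma conjC_expi; congr expi.
have [sC _] := sigmaP; rewrite linearNl linearNr /= opprK (sC g f); ring.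
Qed.

Lemma measure_banach h : banach_star_algebra (measure_algebra sigma h).
Proof.
split => /=.
- split.
  + by split => [|a x y]; [exact: ME_zero|exact: ME_lin].
  + by move=> x y Mx My; rewrite starE//; exact: ME_star_fin.
  + exact: ME_measure_star.
  + by move=> x y z Mx My Mz; rewrite !starE ?star_finA//; exact: ME_star_fin.
  + by move=> a x y z Mx My Mz; rewrite !starE ?star_fin_linl//; exact: ME_lin.
  + by move=> a x y z Mx My Mz; rewrite !starE ?star_fin_linr//; exact: ME_lin.
  + by move=> x _; exact: measure_starK.
  + by move=> a x y _ _; exact: measure_star_lin.
  + by move=> x y Mx My; rewrite !starE ?star_finM//; exact: ME_measure_star.
- by move=> x _; exact: tvnorm_ge0.
- by move=> x Mx; apply: tvnorm_eq0; exact: ME_cmeasure.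
- by move=> a x Mx; apply: tvnormZ; exact: ME_cmeasure.
- by move=> x y Mx My; apply: tvnormD; exact: ME_cmeasure.
- by move=> x y Mx My; rewrite starE// tvnorm_star_fin.
- by move=> x /ME_onW[e H]; exact: tvnorm_star H.
- exact: ME_complete.
Qed.

(** The norm is at most the integral of [|u| |v| |w h|] over the product, so pointwise convergence
    of kernels under a bound independent of [h] suffices. Conditions are imposed for [h != 0] only,
    as the scaled commutator divides by [h]. *)
Lemma tvnorm_twisted_dct e mu nu m (w : R -> E -> E -> R[i]) (C : R) : onW e mu -> onW e nu ->
  weight m -> wint mu m -> wint nu m -> 0 <= C -> (forall h, h != 0 -> adm2 e m (w h)) ->
  (forall h f g, h != 0 -> normc (w h f g) <= C * (m f * m g)) ->
  (forall f g, normc (w h f g) @[h --> (0 : R)^'] --> (0 : R)) ->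
  tvnorm (twisted_conv (w h) mu nu) @[h --> (0 : R)^'] --> (0 : R).
Proof.
move=> H1 H2 mW im in_ C0 wA wC w0.
have [lam [u [ru u0]]] := onW_rep H1; have [kap [v [rv v0]]] := onW_rep H2.
pose d h := fun p => normc (prod_density e u v (w h) p).
have H : Rintegral (finite_prod lam kap) setT (d h) @[h --> (0 : R)^'] --> (0 : R).
  apply: (Rintegral_dct (G := fun p => (C * (normc (u p.1) * m (retr e p.1))) *
      (normc (v p.2) * m (retr e p.2)))).
  - move=> h h0; apply: cintegrable_normc.
    exact: (prod_density_integrable ru u0 rv v0 mW im in_ (wA h h0)).
  - exact: (rintegrable_weights ru u0 rv v0 mW im in_).
  - move=> h p h0; rewrite ger0_norm ?normc_ge0// /d /prod_density !Normc.normcM.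
    apply: (@le_trans _ _ (normc (u p.1) * normc (v p.2) *
       (C * (m (retr e p.1) * m (retr e p.2))))).
      by rewrite ler_wpM2l ?mulr_ge0 ?normc_ge0 ?wC.
    by rewrite le_eqVlt; apply/orP; left; apply/eqP; ring.
  - move=> p; rewrite /d /prod_density.
    under eq_fun do rewrite !Normc.normcM.
    suff: normc (u p.1) * normc (v p.2) * normc (w h (retr e p.1) (retr e p.2))
      @[h --> (0 : R)^'] --> (normc (u p.1) * normc (v p.2) * 0 : R) by rewrite mulr0.
    by apply: cvgM; [exact: cvg_cst|exact: w0].
apply: squeeze_dist H; near=> h.
rewrite subr0 ger0_norm ?tvnorm_ge0//.
apply: (tvnorm_crep (twisted_crep ru u0 rv v0 mW im in_ (wA h _))).
by near: h; exact: nbhs_dnbhs_neq.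
Unshelve. all: by end_near.
Qed.

Lemma von_neumann mu nu : ME mu -> ME nu ->
  tvnorm (star sigma h mu nu - star sigma 0 mu nu) @[h --> (0 : R)^'] --> (0 : R).
Proof.
move=> Mmu Mnu; have [e [H1 H2]] := ME_onW2 Mmu Mnu.
pose w h f g := -1 * K 0 f g + K h f g.
have wA h : adm2 e (fun=> 1) (w h) := adm2_lin (-1) w1 (KA e 0) (KA e h).
have -> : (fun h => tvnorm (star sigma h mu nu - star sigma 0 mu nu)) =
    (fun h => tvnorm (twisted_conv (w h) mu nu)).
  apply/funext => h; rewrite !starE// !star_finE.
  rewrite (twisted_kernel_lin (-1) H1 H2 w1 (i1 H1) (i1 H2) (KA e 0) (KA e h)).
  by rewrite scaleN1r addrC.
(* Two phases of modulus one differ by at most 2. *)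
apply: (tvnorm_twisted_dct (C := 2) H1 H2 w1 (i1 H1) (i1 H2)) => // [h f g _|f g].
  rewrite /w mulN1r; apply: le_trans (normcD _ _) _.
  by rewrite normcNN !normc_expi; lra.
have -> : (fun h => normc (w h f g)) = (fun h => normc (expi (- (h / 2 * sigma f g)) - 1)).
  apply/funext => h; rewrite /w mulN1r addrC; congr (normc (_ - _)).
  by rewrite /expi_sigma !mul0r oppr0 expi0.
exact: normc_expiB1_cvg.
Qed.

Let Kvs e h : adm2 e (vs_weight vs) (K h).
Proof.
apply: (adm2_weight w1 (vs_weightP vsP) _ (KA e h)) => x.
by case: (vs_weightP vsP).
Qed.

Let KC e : adm2 e (vs_weight vs) (csigma sigma).
Proof. exact: (adm2_csigma vsP c_gt0 sigma_bound). Qed.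

Lemma commutator_kernel h f g :
  ('i / h%:C) * (-1 * K h g f + K h f g) = (2 / h * sin (h / 2 * sigma f g))%:C.
Proof.
have [sC _] := sigmaP; rewrite /expi_sigma (sC g f) mulrN opprK.
have -> : (h%:C)^-1 = (h^-1)%:C by rewrite [RHS]fmorphV.
set t := h / 2 * sigma f g.
have -> : -1 * expi t + expi (- t) = 0 +i* (- (2 * sin t)).
  by apply: eq_ReIm; rewrite !reimE /= ?cosN ?sinN; ring.
by apply: eq_ReIm; rewrite !reimE /=; ring.
Qed.

Lemma sigma_bound_weight f g : `|sigma f g| <= c * (vs_weight vs f * vs_weight vs g).
Proof.
have [v0 _ _] := vsP; apply: le_trans (sigma_bound f g) _.
rewrite -mulrA; apply: ler_wpM2l; first exact: ltW.
by apply: ler_pM => //; rewrite lerDr.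
Qed.

Lemma twisted_kernelZ e a mu nu m w : onW e mu -> onW e nu -> weight m ->
  wint mu m -> wint nu m -> adm2 e m w ->
  twisted_conv (fun f g => a * w f g) mu nu = a *: twisted_conv w mu nu.
Proof.
move=> H1 H2 mW im in_ wA.
(* The splitting [a = (a - 1) + 1] reduces scaling to [twisted_kernel_lin]. *)
have -> : (fun f g => a * w f g) = (fun f g => (a - 1) * w f g + w f g).
  by apply/funext => f; apply/funext => g; rewrite mulrBl mul1r subrK.
exact: etrans (twisted_kernel_lin (a - 1) H1 H2 mW im in_ wA wA) (scale_sub1D _ _).
Qed.

Lemma dirac mu nu : ME mu -> ME nu -> wint mu (vs_weight vs) -> wint nu (vs_weight vs) ->
  tvnorm (scaled_commutator (measure_algebra sigma h) h mu nu - bracket0 sigma mu nu)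
    @[h --> (0 : R)^'] --> (0 : R).
Proof.
move=> Mmu Mnu im in_; have [e [H1 H2]] := ME_onW2 Mmu Mnu.
have mW := vs_weightP vsP.
pose D h f g := -1 * K h g f + K h f g.
have DA h : adm2 e (vs_weight vs) (D h) := adm2_lin (-1) mW (adm2_swap (Kvs e h)) (Kvs e h).
(* Commutator minus bracket is a single twisted convolution, in which the exchange of the factors
   has become an exchange of the arguments in [D]. *)
pose w h f g := -1 * csigma sigma f g + 'i / h%:C * D h f g.
have aDA h : adm2 e (vs_weight vs) (fun f g => 'i / h%:C * D h f g).
  have := adm2_lin ('i / h%:C - 1) mW (DA h) (DA h); congr adm2.
  by apply/funext => f; apply/funext => g; rewrite mulrBl mul1r subrK.
have wA h : adm2 e (vs_weight vs) (w h) := adm2_lin (-1) mW (KC e) (aDA h).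
have wE h f g : w h f g = (2 / h * sin (h / 2 * sigma f g) - sigma f g)%:C.
  by rewrite /w /D commutator_kernel mulN1r addrC /csigma rmorphB.
have -> : (fun h => tvnorm (scaled_commutator (measure_algebra sigma h) h mu nu
      - bracket0 sigma mu nu)) = (fun h => tvnorm (twisted_conv (w h) mu nu)).
  apply/funext => h; rewrite /scaled_commutator /= !starE// !star_finE.
  rewrite (twisted_kernel_lin (-1) H1 H2 mW im in_ (KC e) (aDA h)).
  rewrite (twisted_kernelZ _ H1 H2 mW im in_ (DA h)).
  rewrite (twisted_kernel_lin (-1) H1 H2 mW im in_ (adm2_swap (Kvs e h)) (Kvs e h)).
  rewrite (twisted_swap H2 H1 mW in_ im (Kvs e h)).
  congr tvnorm; exact: scale_subB.
(* One [c] bounds the kernel of the scaled commutator, the other bounds [sigma] itself, both in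
   terms of the weight [1 + vs]. *)
apply: (tvnorm_twisted_dct (C := 2 * c) H1 H2 mW im in_) => //.
- by rewrite mulr_ge0// ltW.
- move=> h f g h0; rewrite wE normcR; apply: le_trans (ler_normB _ _) _.
  apply: (@le_trans _ _ (`|sigma f g| + `|sigma f g|)).
    rewrite lerD2r normrM; apply: le_trans (ler_wpM2l (normr_ge0 _) (sin_le_norm _)) _.
    rewrite -normrM; have -> : 2 / h * (h / 2 * sigma f g) = sigma f g by field.
    exact: lexx.
  by have := sigma_bound_weight f g; lra.
- move=> f g; have H := @sinc_cvg R (sigma f g).
  have {}H : 2 / h * sin (h / 2 * sigma f g) - sigma f g @[h --> (0 : R)^'] --> (0 : R).
    by apply/subr_cvg0.
  have -> : (fun h => normc (w h f g)) = (fun h => `|2 / h * sin (h / 2 * sigma f g) - sigma f g|).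
    by apply/funext => h; rewrite wE normcR.
  by apply/norm_cvg0P.
Qed.

Lemma ME_bracket0 mu nu : ME mu -> ME nu -> wint mu (vs_weight vs) -> wint nu (vs_weight vs) ->
  ME (bracket0 sigma mu nu).
Proof.
move=> Mmu Mnu im in_; have [e [H1 H2]] := ME_onW2 Mmu Mnu.
exact: onW_ME (onW_twisted H1 H2 (vs_weightP vsP) im in_ (KC e)).
Qed.

Lemma M_moment_wint mu : M_moment vs 1 mu -> wint mu (vs_weight vs).
Proof.
move=> [[cmu _] H].
have hv : nonneg_meas vs by have [v0 _ _] := vsP; split => //; exact: seminorm_measurable.
exact: (wintD cmu (weight_nonneg w1) hv (wint_cst cmu) (H 1%N (leqnn _))).
Qed.

End StarProduct.

(** * Poisson algebras of measures *)

Section Moments.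
Context (R : realType) (E : lmodType R).
Implicit Types (mu nu : set E -> R[i]) (p q : E -> R).

(** Powers of [1 + q] are submultiplicative and at least 1, which powers of [q] need not be; as
    families, the two have the same integrability. *)
Definition moment_weight q N (x : E) : R := (1 + q x) ^+ N.
Definition moments mu q := forall N, wint mu (moment_weight q N).

Lemma moment_weightP q N : seminorm q -> weight (moment_weight q N).
Proof.
move=> qP; have [q0 _ qD] := qP; split => [x||x y].
- by rewrite exprn_ege1// lerDl.
- apply: measurable_funX; apply: measurable_funD => //; exact: seminorm_measurable.
- rewrite /moment_weight -exprMn; apply: lerXn2r.
  + by rewrite nnegrE addr_ge0.
  + by rewrite nnegrE mulr_ge0// addr_ge0.
  + have := qD x y; have := mulr_ge0 (q0 x) (q0 y); nra.
Qed.

Lemma moment_weight_even q N : seminorm q -> even_weight (moment_weight q N).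
Proof.
by move=> qP; split => [|x]; [exact: moment_weightP|rewrite /moment_weight seminormN].
Qed.

Lemma exprD_le (a b : R) N : 0 <= a -> 0 <= b -> (a + b) ^+ N <= 2 ^+ N * (a ^+ N + b ^+ N).
Proof.
move=> a0 b0; wlog ab : a b a0 b0 / a <= b.
  move=> H; have [/H->//|/ltW/H] := leP a b.
  by rewrite (addrC b) (addrC (b ^+ N)); apply.
apply: (@le_trans _ _ ((2 * b) ^+ N)).
  by apply: lerXn2r; rewrite ?nnegrE; lra.
by rewrite exprMn ler_wpM2l ?exprn_ge0// lerDr exprn_ge0.
Qed.

Lemma moments_le mu p q (k : R) : cmeasure mu -> seminorm p -> seminorm q -> 0 <= k ->
  (forall x, q x <= k * p x) -> moments mu p -> moments mu q.
Proof.
move=> cmu pP qP k0 qp mp N; have [p0 _ _] := pP; have [q0 _ _] := qP.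
apply: (wint_le cmu _ _ (C := (1 + k) ^+ N) _ (mp N)).
- exact: weight_nonneg (moment_weightP _ _).
- exact: weight_nonneg (moment_weightP _ _).
- move=> x; rewrite /moment_weight -exprMn; apply: lerXn2r.
  + by rewrite nnegrE addr_ge0.
  + by rewrite nnegrE mulr_ge0 ?addr_ge0.
  + by have := qp x; have := p0 x; nra.
Qed.

Lemma moments0 mu : cmeasure mu -> moments mu (fun=> 0).
Proof.
move=> cmu N; have := wint_cst cmu; congr wint; apply/funext => x.
by rewrite /moment_weight addr0 expr1n.
Qed.

Lemma momentsD mu p q : cmeasure mu -> seminorm p -> seminorm q ->
  moments mu p -> moments mu q -> moments mu (fun x => p x + q x).
Proof.
move=> cmu pP qP mp mq N; have [p0 _ _] := pP; have [q0 _ _] := qP.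
have wp := weight_nonneg (moment_weightP N pP); have wq := weight_nonneg (moment_weightP N qP).
have ipq := wintD cmu wp wq (mp N) (mq N).
have npq : nonneg_meas (fun x => moment_weight p N x + moment_weight q N x).
  have [p1 p2] := wp; have [q1 q2] := wq; split => [x|]; first by rewrite addr_ge0.
  exact: measurable_funD.
apply: (wint_le cmu _ npq (C := 2 ^+ N) _ ipq).
  exact: weight_nonneg (moment_weightP _ (seminormD pP qP)).
move=> x; apply: (@le_trans _ _ (((1 + p x) + (1 + q x)) ^+ N)).
  by apply: lerXn2r; rewrite ?nnegrE; have := p0 x; have := q0 x; lra.
by apply: exprD_le; rewrite addr_ge0.
Qed.

Lemma moments_sum mu (B : Type) (G : seq B) (c : B -> R) (kappa : B -> E -> R) :
  cmeasure mu -> (forall b, 0 <= c b) -> (forall b, seminorm (kappa b)) ->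
  (forall b, moments mu (kappa b)) -> moments mu (fun x => \sum_(b <- G) c b * kappa b x).
Proof.
move=> cmu c0 kP mk; elim: G => [|b G IH].
  by have := moments0 cmu; congr moments; apply/funext => x; rewrite big_nil.
have -> : (fun x => \sum_(j <- b :: G) c j * kappa j x) =
    (fun x => c b * kappa b x + \sum_(j <- G) c j * kappa j x).
  by apply/funext => x; rewrite big_cons.
have sb := seminormZl (c0 b) (kP b).
have sG : seminorm (fun x => \sum_(j <- G) c j * kappa j x).
  by apply: seminorm_sum => j; exact: seminormZl.
exact: (momentsD cmu sb sG (moments_le cmu (kP b) sb (c0 b) (fun x => lexx _) (mk b)) IH).
Qed.

Lemma M_moment_inftyP q mu : seminorm q -> M_moment_infty q mu <-> ME mu /\ moments mu q.
Proof.
move=> qP; have [q0 _ _] := qP.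
have qN m : nonneg_meas (fun x => q x ^+ m).
  split => [x|]; first by rewrite exprn_ge0.
  by apply: measurable_funX; exact: seminorm_measurable.
split=> -[Mmu H]; split => //; have cmu := ME_cmeasure Mmu => N.
- have w1 := weight_nonneg (weight1 E).
  have i1 := wintD cmu w1 (qN N) (wint_cst cmu) (H N).
  apply: (wint_le cmu _ _ (C := 2 ^+ N) _ i1).
  + exact: weight_nonneg (moment_weightP _ _).
  + have [a1 a2] := w1; have [b1 b2] := qN N.
    by split => [x|]; [rewrite addr_ge0|exact: measurable_funD].
  + move=> x; have := exprD_le N ler01 (q0 x); by rewrite expr1n.
- apply: (wint_le cmu (qN N) _ (C := 1) _ (H N)).
    exact: weight_nonneg (moment_weightP _ _).
  move=> x; rewrite mul1r; apply: lerXn2r; rewrite ?nnegrE ?addr_ge0//.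
  by rewrite lerDr.
Qed.

Lemma moments_lin a mu nu q : cmeasure mu -> cmeasure nu -> seminorm q ->
  moments mu q -> moments nu q -> moments (a *: mu + nu) q.
Proof.
move=> cmu cnu qP mm mn N; apply: wint_lin => //.
exact: weight_nonneg (moment_weightP _ _).
Qed.

(** On a finite carrier [m] is bounded by the sum [C] of its values there. *)
Lemma wint_finite mu (s : seq E) (m : E -> R) : cmeasure mu -> nonneg_meas m ->
  conc [set x | x \in s] mu -> wint mu m.
Proof.
move=> cmu mm cs; have [m0 mmeas] := mm.
have [lam [u [ru u0]]] := exists_crep_on cmu (seq_measurable s) cs.
have [_ iu _] := ru; have iN := cintegrable_normc iu.
apply: (wint_crep ru mm); pose C := \sum_(y <- s) m y.
apply: (rintegrable_le _ (rintegrableZ C iN)).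
  by apply: measurable_funM => //; exact: rintegrable_mf iN.
move=> x; rewrite ger0_norm ?mulr_ge0 ?normc_ge0//.
have [xs|xs] := pselect (x \in s); last first.
  by rewrite u0// normcR normr0 !mulr0.
rewrite ler_wpM2r ?normc_ge0// /C (big_rem x xs)/= lerDl.
by apply: sumr_ge0.
Qed.

Lemma moments_zero q : seminorm q -> moments (0 : set E -> R[i]) q.
Proof.
move=> qP N; apply: (wint_finite (s := [::])); first exact: cmeasure_zero.
  exact: weight_nonneg (moment_weightP _ _).
by move=> A mA.
Qed.

Lemma moments_star mu q : ME mu -> seminorm q -> moments mu q -> moments (measure_star mu) q.
Proof.
move=> /ME_onW[e H] qP mm N; apply: (wint_star H) => //; exact: moment_weight_even.
Qed.

(** The weight of the kernel is at most [1 + p] and costs one more power: the weight of order [N]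
    for [q] after convolution is paid for by the weight of order [N + 1] for [p + q] before it. *)
Lemma moments_twisted e mu nu m p q w : onW e mu -> onW e nu ->
  seminorm p -> seminorm q -> (forall x, m x <= 1 + p x) -> weight m ->
  adm2 e m w -> moments mu p -> moments nu p -> moments mu q -> moments nu q ->
  moments (twisted_conv w mu nu) q.
Proof.
move=> H1 H2 pP qP mp mW wA mp1 mp2 mq1 mq2 N.
have [c1 _] := H1; have [c2 _] := H2; have [p0 _ _] := pP; have [q0 _ _] := qP.
have qW := moment_weightP N qP.
have pq := momentsD c1 pP qP mp1 mq1; have pq2 := momentsD c2 pP qP mp2 mq2.
have le_pq x : m x * moment_weight q N x <= moment_weight (fun x => p x + q x) N.+1 x.
  rewrite /moment_weight exprS; apply: ler_pM; rewrite ?exprn_ge0 ?addr_ge0//.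
  - exact: weight_ge0.
  - by have := mp x; have := q0 x; lra.
  - by apply: lerXn2r; rewrite ?nnegrE; have := p0 x; have := q0 x; lra.
have pqW := moment_weightP N.+1 (seminormD pP qP).
have i1 := wint_mono c1 (weightM mW qW) pqW le_pq (pq N.+1).
have i2 := wint_mono c2 (weightM mW qW) pqW le_pq (pq2 N.+1).
have le_m x : m x <= m x * moment_weight q N x by exact: le_weightMl.
have j1 := wint_mono c1 mW (weightM mW qW) le_m i1.
have j2 := wint_mono c2 mW (weightM mW qW) le_m i2.
have [lam [u [ru u0]]] := onW_rep H1; have [kap [v [rv v0]]] := onW_rep H2.
exact: (wint_twisted ru u0 rv v0 mW j1 j2 wA qW i1 i2).
Qed.

End Moments.

(** * Carriers and null sets of twisted convolutions *)

Section Concentration.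
Context (R : realType) (E : lmodType R) (e : nat -> E).
Implicit Types (mu nu : set E -> R[i]) (D S : set E) (h k : E -> R[i]) (w : E -> E -> R[i]).

Lemma eq_cint_conc mu D m h k : onW e mu -> conc D mu -> il_measurable D -> weight m ->
  wint mu m -> adm e m h -> adm e m k -> (forall x, D x -> h x = k x) ->
  cint mu h = cint mu k.
Proof.
move=> [cmu cW] cD mD mW im hA kA hk.
have mWD := il_measurableI (cspan_measurable e) mD.
have cWD A : il_measurable A -> mu A = mu (A `&` (cspan e `&` D)).
  move=> mA; rewrite (cW _ mA) (cD _ (il_measurableI mA (cspan_measurable e))).
  by rewrite setIA.
have [lam [u [ru u0]]] := exists_crep_on cmu mWD cWD.
have u0' x : ~ cspan e x -> u x = 0 by move=> H; apply: u0 => -[].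
rewrite (cint_adm ru u0' mW im hA) (cint_adm ru u0' mW im kA).
apply: eq_Cint => x; have [[Wx Dx]|H] := pselect ((cspan e `&` D) x).
  by rewrite retr_id// hk.
by rewrite u0// !mul0r.
Qed.

Lemma conc_twisted mu nu D D' S m w : onW e mu -> onW e nu -> weight m ->
  wint mu m -> wint nu m -> adm2 e m w -> conc D mu -> conc D' nu ->
  il_measurable D -> il_measurable D' -> il_measurable S ->
  (forall f g, D f -> D' g -> S (f + g)) -> conc S (twisted_conv w mu nu).
Proof.
move=> H1 H2 mW im in_ wA cD cD' mD mD' mS DS A mA.
have mAS := il_measurableI mA mS.
rewrite (twisted_convE _ _ _ mA) (twisted_convE _ _ _ mAS).
have A1 := adm2_indic mW wA mA; have A2 := adm2_indic mW wA mAS.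
have B1 := adm_cint H2 mW in_ A1; have B2 := adm_cint H2 mW in_ A2.
have mWe := cspan_measurable e; have [cmu cW] := H1.
have cDW : conc (D `&` cspan e) mu.
  by move=> B mB; rewrite (cD _ mB) (cW _ (il_measurableI mB mD)) setIA.
apply: (eq_cint_conc H1 cDW (il_measurableI mD mWe) mW im B1 B2) => f [Df Wf].
apply: (eq_cint_conc H2 cD' mD' mW in_ (adm2_fst mW A1 Wf) (adm2_fst mW A2 Wf)) => g Dg.
congr (_ * _); rewrite /cindic !indicE in_setI; congr (_%:R%:C).
by rewrite (mem_set (DS _ _ Df Dg)) andbT.
Qed.

Lemma conc_star mu D : cmeasure mu -> il_measurable D -> conc D mu ->
  conc [set x | D (- x)] (measure_star mu).
Proof.
move=> cmu mD cD A mA; rewrite /measure_star (cD _ (opp_il_measurable mA)).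
congr ((mu _)^*); apply/seteqP; split=> x /=; by rewrite opprK.
Qed.

Lemma conc_null mu D : cmeasure mu -> il_measurable D ->
  (forall B, il_measurable B -> B `<=` D -> mu B = 0) -> conc (~` D) mu.
Proof.
move=> cmu mD D0 A mA; rewrite {1}(cmeasureD cmu mA mD) D0 ?add0r//.
exact: il_measurableI.
Qed.

(** For each [f] in the carrier of the first factor the inner integral only sees the translate of
    [A] by [-f], where [nu] vanishes. Translation by the carrier preserves singletons as well as
    Haar null sets, so this serves atomless and absolutely continuous measures alike. *)
Lemma twisted_null mu nu D A m w : onW e mu -> onW e nu -> weight m ->
  wint mu m -> wint nu m -> adm2 e m w -> conc D mu -> il_measurable D -> il_measurable A ->
  (forall f B, D f -> il_measurable B -> B `<=` [set g | A (f + g)] -> nu B = 0) ->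
  twisted_conv w mu nu A = 0.
Proof.
move=> H1 H2 mW im in_ wA cD mD mA nu0.
have A1 := adm2_indic mW wA mA; have B1 := adm_cint H2 mW in_ A1.
have mWe := cspan_measurable e; have [cmu cW] := H1; have [cnu _] := H2.
have cDW : conc (D `&` cspan e) mu.
  by move=> B mB; rewrite (cD _ mB) (cW _ (il_measurableI mB mD)) setIA.
rewrite (twisted_convE _ _ _ mA) -(cint0 H1 mW im).
apply: (eq_cint_conc H1 cDW (il_measurableI mD mWe) mW im B1 (adm0 e mW)) => f [Df Wf].
rewrite -(cint0 H2 mW in_).
have mfA : il_measurable [set g | A (f + g)].
  by have := translation_measurable f (il_measurableT (E := E)) mA; rewrite setTI.
have cN := conc_null cnu mfA (fun B mB BA => nu0 f B Df mB BA).
apply: (eq_cint_conc H2 cN (il_measurableC mfA) mW in_ (adm2_fst mW A1 Wf) (adm0 e mW)) => g Ng.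
by rewrite /cindic indicE memNset// mulr0.
Qed.
End Concentration.

Lemma countable_union T (A B : set T) : countable A -> countable B -> countable (A `|` B).
Proof.
move=> cA cB; have -> : A `|` B = \bigcup_(b in [set: bool]) (if b then A else B).
  apply/seteqP; split=> [x [Ax|Bx]|x [[] _ Ax]]; [by exists true|by exists false|by left|by right].
by apply: bigcup_countable => // -[].
Qed.

Section StableSpaces.
Context (R : realType) (E : lmodType R).
Implicit Types (mu nu : set E -> R[i]) (X : set (set E -> R[i])).

(** Stability under all admissible kernels covers the products for every [h] and the bracket at
    once. Moment conditions are kept apart and enter later by intersection. *)
Record stable X : Prop := Stable {
  stable_zero : X 0;
  stable_lin : forall a mu nu, X mu -> X nu -> X (a *: mu + nu);
  stable_star : forall mu, ME mu -> X mu -> X (measure_star mu);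
  stable_twisted : forall e m w mu nu, onW e mu -> onW e nu -> weight m ->
    wint mu m -> wint nu m -> adm2 e m w -> X mu -> X nu -> X (twisted_conv w mu nu) }.

Lemma stable_ME_d : stable (@ME_d R E).
Proof.
split.
- by apply/ME_dP; split; [exact: cmeasure_zero|exists set0].
- move=> a mu nu /ME_dP[cmu [D cD HD]] /ME_dP[cnu [D' cD' HD']]; apply/ME_dP.
  split; first exact: cmeasure_lin.
  have mD := countable_il_measurable cD; have mD' := countable_il_measurable cD'.
  exists (D `|` D'); first exact: countable_union.
  apply: conc_lin.
  + apply: (concS cmu _ _ HD); [exact: il_measurableU|exact: subsetUl].
  + apply: (concS cnu _ _ HD'); [exact: il_measurableU|exact: subsetUr].
- move=> mu /ME_onW[e H] /ME_dP[cmu [D cD HD]]; apply/ME_dP; split.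
    by case: (onW_star H).
  exists [set x | D (- x)]; last exact: (conc_star cmu (countable_il_measurable cD) HD).
  have -> : [set x | D (- x)] = (fun x => - x) @` D.
    apply/seteqP; split=> [x Dx|_ [y Dy <-]] /=; last by rewrite opprK.
    by exists (- x); rewrite ?opprK.
  exact: (sub_countable (card_image_le _ _) cD).
- move=> e m w mu nu H1 H2 mW im in_ wA /ME_dP[cmu [D cD HD]] /ME_dP[cnu [D' cD' HD']].
  have [ct _] := onW_twisted H1 H2 mW im in_ wA; apply/ME_dP; split => //.
  have cS : countable ((fun p : E * E => p.1 + p.2) @` (D `*` D')).
    exact: (sub_countable (card_image_le _ _) (countableX cD cD')).
  exists ((fun p : E * E => p.1 + p.2) @` (D `*` D')); first exact: cS.
  apply: (conc_twisted H1 H2 mW im in_ wA HD HD' (countable_il_measurable cD)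
    (countable_il_measurable cD') (countable_il_measurable cS)).
  by move=> f g Df Dg; exists (f, g).
Qed.

Lemma stable_ME_c : stable (@ME_c R E).
Proof.
split.
- by apply/ME_cP; split; first exact: ME_zero.
- move=> a mu nu /ME_cP[Mmu Amu] /ME_cP[Mnu Anu]; apply/ME_cP; split; first exact: ME_lin.
  by move=> f; rewrite -[LHS]/(a * mu [set f] + nu [set f]) Amu Anu mulr0 addr0.
- move=> mu _ /ME_cP[Mmu Amu]; apply/ME_cP; split; first exact: ME_measure_star.
  move=> f; rewrite /measure_star (_ : [set x | _] = [set - f]) ?Amu ?conjC0//.
  by apply/seteqP; split=> x /= => [<-|->]; rewrite opprK.
- move=> e m w mu nu H1 H2 mW im in_ wA /ME_cP[Mmu Amu] /ME_cP[Mnu Anu].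
  apply/ME_cP; split; first exact: onW_ME (onW_twisted H1 H2 mW im in_ wA).
  move=> f0; have [_ cW] := H1.
  apply: (twisted_null H1 H2 mW im in_ wA cW (cspan_measurable e) (set1_measurable _)).
  move=> f B _ mB Bf.
  have : B `<=` [set f0 - f] by move=> g /Bf /= <-; rewrite addrC addKr.
  move=> /subset_set1[]->; [exact: cmeasure0 (ME_cmeasure Mnu)|exact: Anu].
Qed.

(** Absolute continuity is tested against every Haar measure on [V]. The involution reflects sets,
    which amounts to testing against the reflected Haar measure. *)
Lemma opp_haar V (lam : {measure set (ilBorel E) -> \bar R}) : is_subspace V ->
  haar_on V lam -> haar_on V (image_measure lam (@opp_measurable R E)).
Proof.
move=> sV [l0 lV [U [oU U0 lU]] lt].
have VN x : V (- x) -> V x by move/(is_subspaceN sV); rewrite opprK.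
set im : {measure set (ilBorel E) -> \bar R} := image_measure lam (@opp_measurable R E).
have imE A : im A = lam [set x | A (- x)] by [].
split.
- rewrite imE (_ : [set x | _] = ~` V)//.
  by apply/seteqP; split=> x /= H Vx; apply: H; [exact: is_subspaceN|exact: VN].
- rewrite imE (_ : [set x | _] = V)//.
  by apply/seteqP; split=> x /= H; [exact: VN|exact: is_subspaceN].
- exists [set x | U (- x)]; split; last 1 first.
  + rewrite imE (_ : [set x | _] = U)//.
    by apply/seteqP; split=> x /=; rewrite opprK.
  + move=> x /oU[p pP HU]; exists p => // y py; apply: HU.
    by rewrite -opprD (seminormN _ pP).
  + by rewrite /= oppr0.
- move=> v A Vv mA; rewrite !imE.
  have := lt _ _ (is_subspaceN sV Vv) (opp_il_measurable mA).
  congr (lam _ = lam _); apply/seteqP; split=> x /=; by rewrite opprD opprK.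
Qed.

Lemma stable_M_a V : findim_subspace V -> stable (@M_a R E V).
Proof.
move=> fV; have sV := findim_is_subspace fV; have mV := findim_measurable fV.
split.
- by split=> //; split; first exact: cmeasure_zero.
- move=> a mu nu [[cmu Vmu] amu] [[cnu Vnu] anu]; split.
    by split; [exact: cmeasure_lin|exact: conc_lin].
  move=> lam hl A mA lA; rewrite -[LHS]/(a * mu A + nu A).
  by rewrite (amu lam)// (anu lam)// mulr0 addr0.
- move=> mu /ME_onW[e H] [[cmu Vmu] amu]; split.
    split; first by case: (onW_star H).
    have := conc_star cmu mV Vmu; congr conc; apply/seteqP; split=> x /=.
      by move/(is_subspaceN sV); rewrite opprK.
    exact: is_subspaceN.
  move=> lam hl A mA lA; rewrite /measure_star.
  rewrite (amu _ (opp_haar sV hl)) ?conjC0//; first exact: opp_il_measurable.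
  rewrite -lA /=; congr (lam _).
  by apply/seteqP; split=> x /=; rewrite opprK.
- move=> e m w mu nu H1 H2 mW im in_ wA [[cmu Vmu] amu] [[cnu Vnu] anu]; split.
    split; first by case: (onW_twisted H1 H2 mW im in_ wA).
    apply: (conc_twisted H1 H2 mW im in_ wA Vmu Vnu mV mV mV) => f g; exact: is_subspaceD.
  move=> lam hl A mA lA; have [_ _ _ lt] := hl.
  apply: (twisted_null H1 H2 mW im in_ wA Vmu mV mA) => f B Vf mB BA.
  apply: (anu _ hl) => //; apply/eqP; rewrite eq_le measure_ge0 andbT.
  (* [B] lies in a translate of [A] by a vector of [V], which has the same Haar measure as [A],
     namely 0. *)
  rewrite -lA -(lt _ _ Vf mA); apply: le_measure; rewrite ?inE//.
  by have := translation_measurable f (il_measurableT (E := E)) mA; rewrite setTI.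
Qed.

Lemma stable_ME_df : stable (@ME_df R E).
Proof.
split.
- by apply/ME_dfP; split; [exact: cmeasure_zero|exists [::]].
- move=> a mu nu /ME_dfP[cmu [s cs]] /ME_dfP[cnu [s' cs']]; apply/ME_dfP.
  split; first exact: cmeasure_lin.
  exists (s ++ s'); apply: conc_lin.
  + by apply: (concS cmu (seq_measurable _) _ cs) => x /= xs; rewrite mem_cat xs.
  + by apply: (concS cnu (seq_measurable _) _ cs') => x /= xs; rewrite mem_cat xs orbT.
- move=> mu /ME_onW[e H] /ME_dfP[cmu [s cs]]; apply/ME_dfP; split.
    by case: (onW_star H).
  exists [seq - x | x <- s]; have := conc_star cmu (seq_measurable s) cs.
  congr conc; apply/seteqP; split=> x /=.
    by move=> xs; apply/mapP; exists (- x); rewrite ?opprK.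
  by move=> /mapP[y ys ->]; rewrite opprK.
- move=> e m w mu nu H1 H2 mW im in_ wA /ME_dfP[cmu [s cs]] /ME_dfP[cnu [s' cs']].
  have [ct _] := onW_twisted H1 H2 mW im in_ wA; apply/ME_dfP; split => //.
  exists [seq x + y | x <- s, y <- s'].
  apply: (conc_twisted H1 H2 mW im in_ wA cs cs' (seq_measurable s) (seq_measurable s')
    (seq_measurable _)).
  by move=> f g /= fs gs; exact: allpairs_f.
Qed.

Lemma ME_df_sub mu : ME_df mu -> ME mu.
Proof.
move=> /ME_dfP[cmu [s cs]]; apply/MEP; split => //; exists (nth 0 s).
apply: (concS cmu (cspan_measurable _) _ cs) => x /= xs.
by rewrite -(nth_index 0 xs); exact: cspan_gen.
Qed.

Lemma ME_df_moments mu q : seminorm q -> ME_df mu -> moments mu q.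
Proof.
move=> qP /ME_dfP[cmu [s cs]] N; apply: (wint_finite cmu _ cs).
exact: weight_nonneg (moment_weightP _ _).
Qed.
End StableSpaces.

(** * The Poisson bracket and the listed Poisson algebras *)

Section PoissonIdentities.
Context (R : realType) (E : lmodType R) (sigma : {biscalar E}) (vs : E -> R) (c : R).
Hypotheses (sigmaP : presymplectic sigma) (vsP : seminorm vs) (c_gt0 : 0 < c).
Hypothesis (sigma_bound : forall f g, `|sigma f g| <= c * vs f * vs g).
Implicit Types (mu nu rho x y z : set E -> R[i]).

Local Notation K := (expi_sigma sigma).
Local Notation S := (csigma sigma).
Local Notation m := (vs_weight vs).
Local Notation sf := (star_fin sigma).
Local Notation br := (bracket0 sigma).

Let sC f g : sigma f g = - sigma g f. Proof. by case: sigmaP. Qed.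
Let mW : weight m. Proof. exact: vs_weightP. Qed.
Let SA e : adm2 e m S. Proof. exact: (adm2_csigma vsP c_gt0 sigma_bound). Qed.
Let w1 : @weight R E (fun=> 1). Proof. exact: weight1. Qed.
Let KA1 e h : adm2 e (fun=> 1) (K h).
Proof. exact: (adm2_expi_sigma vsP c_gt0 sigma_bound). Qed.
Let KA e h : adm2 e m (K h).
Proof. by apply: (adm2_weight w1 mW _ (KA1 e h)) => t; case: mW. Qed.
Let K0 f g : K 0 f g = 1.
Proof. by rewrite /expi_sigma mul0r mul0r oppr0 expi0. Qed.
Let M t := m t * m t.
Let iM mu : moments mu vs -> wint mu M.
Proof.
move=> /(_ 2%N); congr wint; apply/funext => t; by rewrite /moment_weight expr2.
Qed.
Let im mu : moments mu vs -> wint mu m.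
Proof. by move=> /(_ 1%N). Qed.
Let MW : weight M. Proof. exact: weightM. Qed.

Lemma star0C mu nu : ME mu -> ME nu -> sf 0 mu nu = sf 0 nu mu.
Proof.
move=> Mmu Mnu; have [e [H1 H2]] := ME_onW2 Mmu Mnu.
have [c1 _] := H1; have [c2 _] := H2.
rewrite !star_finE (twisted_swap H1 H2 w1 (wint_cst c1) (wint_cst c2) (KA1 e 0)).
by congr (twisted_conv _ nu mu); apply/funext => f; apply/funext => g; rewrite !K0.
Qed.

Lemma bracket0_lin a mu nu rho : ME mu -> ME nu -> ME rho ->
  moments mu vs -> moments nu vs -> moments rho vs ->
  br (a *: mu + nu) rho = a *: br mu rho + br nu rho.
Proof.
move=> Mmu Mnu Mrho i1 i2 i3; have [e [H1 H2 H3]] := ME_onW3 Mmu Mnu Mrho.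
exact: (twisted_linl a H1 H2 H3 mW (im i1) (im i2) (im i3) (SA e)).
Qed.

Lemma bracket0C mu nu : ME mu -> ME nu -> moments mu vs -> moments nu vs ->
  br mu nu = - br nu mu.
Proof.
move=> Mmu Mnu i1 i2; have [e [H1 H2]] := ME_onW2 Mmu Mnu.
apply: etrans (twisted_swap H1 H2 mW (im i1) (im i2) (SA e)) _.
have -> : (fun g f => S f g) = (fun g f => -1 * S g f).
  by apply/funext => g; apply/funext => f; rewrite /csigma sC rmorphN mulN1r.
apply: etrans (twisted_kernelZ (-1) H2 H1 mW (im i2) (im i1) (SA e)) _.
exact: scaleN1r.
Qed.

Lemma bracket0_star mu nu : ME mu -> ME nu -> moments mu vs -> moments nu vs ->
  measure_star (br mu nu) = br (measure_star mu) (measure_star nu).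
Proof.
move=> Mmu Mnu i1 i2; have [e [H1 H2]] := ME_onW2 Mmu Mnu.
apply: (twisted_star H1 H2 (moment_weight_even 1 vsP) (im i1) (im i2) (SA e) (SA e)).
by move=> f g; rewrite /csigma conjC_real linearNl linearNr /= opprK.
Qed.

Lemma bracket0_leibniz x y z : ME x -> ME y -> ME z ->
  moments x vs -> moments y vs -> moments z vs ->
  br x (sf 0 y z) = sf 0 (br x y) z + sf 0 y (br x z).
Proof.
move=> Mx My Mz ix iy iz; have [e [H1 H2 H3]] := ME_onW3 Mx My Mz.
have {}ix := iM ix; have {}iy := iM iy; have {}iz := iM iz.
apply/funext => A; have [mA|mA] := pselect (il_measurable A); last first.
  rewrite -[RHS]/(sf 0 (br x y) z A + sf 0 y (br x z) A) !star_finE /bracket0.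
  by rewrite !(twisted_conv_out _ _ _ mA) addr0.
rewrite -[RHS]/(sf 0 (br x y) z A + sf 0 y (br x z) A) !star_finE /bracket0.
rewrite (twisted_comp_r H1 H2 H3 mW ix iy iz (SA e) (KA e 0) mA).
rewrite (twisted_comp_l H1 H2 H3 mW ix iy iz (KA e 0) (SA e) mA).
rewrite (twisted_comp_r H2 H1 H3 mW iy ix iz (KA e 0) (SA e) mA).
have F1 := adm3_comp_l mW (KA e 0) (SA e) mA.
have F2 := adm3_comp_r mW (KA e 0) (SA e) mA.
(* The last term is a triple integral in the order [y], [x], [z]; once it is in the common order,
   what remains is additivity of [sigma] in its second argument. *)
rewrite (cint3_swap12 H2 H1 H3 MW iy ix iz F2).
rewrite -[X in X + _]mul1r -(cint3_lin 1 H1 H2 H3 MW ix iy iz F1 (adm3_swap12 F2)).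
congr cint3; apply/funext => f; apply/funext => g; apply/funext => k.
rewrite !K0 (addrCA g f k) /csigma linearDr rmorphD; ring.
Qed.

Lemma bracket0_jacobi x y z : ME x -> ME y -> ME z ->
  moments x vs -> moments y vs -> moments z vs ->
  br x (br y z) + br y (br z x) + br z (br x y) = 0.
Proof.
move=> Mx My Mz ix iy iz; have [e [H1 H2 H3]] := ME_onW3 Mx My Mz.
have {}ix := iM ix; have {}iy := iM iy; have {}iz := iM iz.
apply/funext => A.
rewrite -[LHS]/(br x (br y z) A + br y (br z x) A + br z (br x y) A) -[RHS]/0.
have [mA|mA] := pselect (il_measurable A); last first.
  by rewrite /bracket0 !(twisted_conv_out _ _ _ mA) !addr0.
rewrite /bracket0.
rewrite (twisted_comp_r H1 H2 H3 mW ix iy iz (SA e) (SA e) mA).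
rewrite (twisted_comp_r H2 H3 H1 mW iy iz ix (SA e) (SA e) mA).
rewrite (twisted_comp_r H3 H1 H2 mW iz ix iy (SA e) (SA e) mA).
have F := adm3_comp_r mW (SA e) (SA e) mA.
rewrite (cint3_swap23 H2 H3 H1 MW iy iz ix F).
have F2 := adm3_swap23 F.
rewrite (cint3_swap12 H2 H1 H3 MW iy ix iz F2).
have {}F2 := adm3_swap12 F2.
rewrite (cint3_swap12 H3 H1 H2 MW iz ix iy F).
have F3 := adm3_swap12 F.
rewrite (cint3_swap23 H1 H3 H2 MW ix iz iy F3).
have {}F3 := adm3_swap23 F3.
rewrite -[X in X + _ + _]mul1r -(cint3_lin 1 H1 H2 H3 MW ix iy iz F F2).
rewrite -[X in X + _]mul1r -(cint3_lin 1 H1 H2 H3 MW ix iy iz (adm3_lin 1 MW F F2) F3).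
(* All terms are now in the order [x], [y], [z]. The integrand is the cyclic sum of
   [sigma g k * sigma f (g + k)] times one indicator, and it vanishes by bilinearity and
   antisymmetry. *)
rewrite -[RHS](cint0 H1 MW ix); congr (cint x); apply/funext => f.
rewrite -[RHS](cint0 H2 MW iy); congr (cint y); apply/funext => g.
rewrite -[RHS](cint0 H3 MW iz); congr (cint z); apply/funext => k.
rewrite !mul1r (_ : g + (k + f) = f + (g + k)); last by rewrite addrA addrC.
rewrite (_ : k + (f + g) = f + (g + k)); last by rewrite addrC addrA.
rewrite -!mulrDl (_ : _ + _ = 0) ?mul0r// /csigma !linearDr !rmorphD /=.
rewrite (sC k f) (sC g f) (sC k g) !rmorphN; ring.
Qed.

(** Closure under the product for every [h], not only for [h = 0], makes the image a subalgebra at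
    each [h]; the moments of [vs] control iterated brackets. *)
Record poisson_closed (P : set (set E -> R[i])) : Prop := PoissonClosed {
  pc_ME : forall x, P x -> ME x;
  pc_moments : forall x, P x -> moments x vs;
  pc_zero : P 0;
  pc_lin : forall a x y, P x -> P y -> P (a *: x + y);
  pc_mul : forall h x y, P x -> P y -> P (sf h x y);
  pc_star : forall x, P x -> P (measure_star x);
  pc_bracket : forall x y, P x -> P y -> P (br x y) }.

Lemma poisson_closedI X P : stable X -> poisson_closed P -> poisson_closed (X `&` P).
Proof.
move=> SX PP; split.
- by move=> x [_ /(pc_ME PP)].
- by move=> x [_ /(pc_moments PP)].
- by split; [exact: stable_zero|exact: pc_zero].
- by move=> a x y [Xx Px] [Xy Py]; split; [exact: stable_lin|exact: pc_lin].
- move=> h x y [Xx Px] [Xy Py]; split; last exact: pc_mul.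
  have Mx := pc_ME PP Px; have My := pc_ME PP Py; have [e [H1 H2]] := ME_onW2 Mx My.
  have [c1 _] := H1; have [c2 _] := H2.
  exact: (stable_twisted SX H1 H2 w1 (wint_cst c1) (wint_cst c2) (KA1 e h) Xx Xy).
- by move=> x [Xx Px]; split; [apply: stable_star => //; exact: pc_ME Px|exact: pc_star].
- move=> x y [Xx Px] [Xy Py]; split; last exact: pc_bracket.
  have Mx := pc_ME PP Px; have My := pc_ME PP Py; have [e [H1 H2]] := ME_onW2 Mx My.
  exact: (stable_twisted SX H1 H2 mW (im (pc_moments PP Px)) (im (pc_moments PP Py)) (SA e) Xx Xy).
Qed.

(** The kernels of the products have modulus one, so the moments of each [kappa b] propagate by
    themselves. The bracket involves [vs], whose moments are supplied by the second hypothesis. *)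
Lemma poisson_closed_moments (B : Type) (kappa : B -> E -> R) :
  (forall b, seminorm (kappa b)) ->
  (forall x, ME x -> (forall b, moments x (kappa b)) -> moments x vs) ->
  poisson_closed [set x | ME x /\ forall b, moments x (kappa b)].
Proof.
move=> kP kvs; split.
- by move=> x [].
- by move=> x [Mx mx]; exact: kvs.
- by split=> [|b]; [exact: ME_zero|exact: moments_zero].
- move=> a x y [Mx mx] [My my]; split=> [|b]; first exact: ME_lin.
  by apply: moments_lin => //; exact: ME_cmeasure.
- move=> h x y [Mx mx] [My my].
  split=> [|b]; first exact: (ME_star_fin vsP c_gt0 sigma_bound).
  have [e [H1 H2]] := ME_onW2 Mx My.
  apply: (moments_twisted H1 H2 (kP b) (kP b) _ w1 (KA1 e h)) => // t.
  by rewrite lerDl; have [k0 _ _] := kP b.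
- move=> x [Mx mx]; split=> [|b]; first exact: ME_measure_star.
  exact: moments_star.
- move=> x y [Mx mx] [My my]; have vx := kvs x Mx mx; have vy := kvs y My my.
  split=> [|b]; first exact: (ME_bracket0 vsP c_gt0 sigma_bound Mx My (im vx) (im vy)).
  have [e [H1 H2]] := ME_onW2 Mx My.
  by apply: (moments_twisted H1 H2 vsP (kP b) _ mW (SA e)).
Qed.

(** An intersection over the empty family would contain all set functions. It is excluded because
    [sigma] is not zero: an empty sum would bound [vs] by 0, and then [sigma_bound] would make
    [sigma] vanish. *)
Lemma choice_inhabited s : choice_admissible vs s -> exists b : choice_index s, True.
Proof.
case: s => [kappa|B kappa] /=; first by exists tt.
move=> [_ [[|b G] [d [_ vk]]]]; last by exists b.
have [_ [f [g fg]]] := sigmaP; exfalso.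
have v0 t : vs t = 0.
  have [v0 _ _] := vsP; apply/eqP; rewrite eq_le v0 andbT.
  by have := vk t; rewrite big_nil.
by move: fg; have := sigma_bound f g; rewrite !v0 !mulr0 normr_le0 => ->.
Qed.

Lemma choice_seminorm s (b : choice_index s) : choice_admissible vs s ->
  seminorm (choice_family b).
Proof. by case: s b => [kappa|B kappa] b /= []. Qed.

Lemma choice_spaceE s : choice_admissible vs s ->
  choice_space s = [set x | ME x /\ forall b : choice_index s, moments x (choice_family b)].
Proof.
move=> sA; have [b0 _] := choice_inhabited sA.
have kP b := choice_seminorm b sA.
case: s sA b0 kP => [kappa|B kappa] sA b0 kP; apply/seteqP; split=> x /=.
- by move/(M_moment_inftyP _ (kP tt)) => [].
- by move=> [Mx mx]; apply/(M_moment_inftyP _ (kP tt)); split => //; exact: (mx tt).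
- move=> H; split; first by have /(M_moment_inftyP _ (kP b0)) [] := H b0 I.
  by move=> b; have /(M_moment_inftyP _ (kP b)) [] := H b I.
- by move=> [Mx mx] b _; apply/(M_moment_inftyP _ (kP b)).
Qed.

Lemma choice_bound s : choice_admissible vs s ->
  exists (G : seq (choice_index s)) (d : choice_index s -> R), (forall b, 0 <= d b) /\
    forall f, vs f <= \sum_(b <- G) d b * choice_family b f.
Proof.
case: s => [kappa|B kappa] /= [_ H].
  have [k k0 vk] : exists2 k : R, 0 <= k & forall f, vs f <= k * kappa f.
    case: H => [//|[k1 [k2 [k10 k12 H]]]].
    by exists k2 => [|f]; [exact: le_trans (ltW k10) k12|case: (H f)].
  by exists [:: tt], (fun=> k); split=> // f; rewrite big_seq1.
by have [G [d [d0 vk]]] := H; exists G, d; split=> // b; rewrite ltW.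
Qed.

Lemma choice_moments s x : choice_admissible vs s -> ME x ->
  (forall b : choice_index s, moments x (choice_family b)) -> moments x vs.
Proof.
move=> sA /ME_cmeasure cx mx; have kP b := choice_seminorm b sA.
have [G [d [d0 vk]]] := choice_bound sA.
have sG : seminorm (fun t : E => \sum_(j <- G) d j * choice_family j t).
  by apply: seminorm_sum => j; apply: seminormZl.
apply: (moments_le (k := 1) cx sG vsP) => //; first by move=> t; rewrite mul1r.
exact: (moments_sum G cx d0 kP mx).
Qed.

Lemma choice_space_ME s x : choice_admissible vs s -> choice_space s x -> ME x.
Proof. by move=> sA; rewrite (choice_spaceE sA) => -[]. Qed.

Lemma poisson_closed_choice s : choice_admissible vs s -> poisson_closed (choice_space s).
Proof.
move=> sA; rewrite (choice_spaceE sA); apply: poisson_closed_moments => [b|x Mx mx].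
  exact: choice_seminorm.
exact: (choice_moments sA).
Qed.

Lemma poisson_closed_type t : type_admissible vs t -> poisson_closed (poisson_space t).
Proof.
case: t => [s|s|s|V s|] /= tA.
- exact: poisson_closed_choice.
- by apply: poisson_closedI; [exact: stable_ME_d|exact: poisson_closed_choice].
- by apply: poisson_closedI; [exact: stable_ME_c|exact: poisson_closed_choice].
- by case: tA => fV sA; apply: poisson_closedI; [exact: stable_M_a|exact: poisson_closed_choice].
(* Finite combinations of point measures have all moments, so intersecting them with the moment
   space of [vs] changes nothing and reduces this type to the others. *)
- have PC : poisson_closed [set x | ME x /\ forall b : unit, moments x vs].
    by apply: poisson_closed_moments => // x _; apply; exact: tt.
  have -> : @ME_df R E = @ME_df R E `&` [set x | ME x /\ forall b : unit, moments x vs].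
    rewrite setIidl// => x Hx; split=> [|_]; first exact: ME_df_sub.
    exact: ME_df_moments.
  exact: poisson_closedI (@stable_ME_df R E) PC.
Qed.

Lemma measure_poisson_algebra P : poisson_closed P ->
  poisson_algebra (measure_poisson sigma P).
Proof.
move=> PC; have PM x := pc_ME PC (x := x); have Pm x := pc_moments PC (x := x).
have sE h x y : P x -> P y -> star sigma h x y = sf h x y.
  by move=> Px Py; apply: (starE vsP c_gt0 sigma_bound); exact: PM.
have Psf h x y : P x -> P y -> P (sf h x y) by move=> Px Py; exact: (pc_mul PC).
have Pst x : P x -> P (measure_star x) by move=> Px; exact: (pc_star PC).
have Pbr x y : P x -> P y -> P (br x y) by move=> Px Py; exact: (pc_bracket PC).
have Plin a x y : P x -> P y -> P (a *: x + y) by move=> Px Py; exact: (pc_lin PC).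
split => /=.
- split => /=.
  + by split; [exact: pc_zero PC|exact: pc_lin PC].
  + by move=> x y Px Py; rewrite sE//; exact: Psf.
  + exact: Pst.
  + move=> x y z Px Py Pz; rewrite (sE _ y z)// (sE _ x y)// !sE//; try exact: Psf.
    by apply: (star_finA vsP c_gt0 sigma_bound); exact: PM.
  + move=> a x y z Px Py Pz; rewrite !sE//; last exact: Plin.
    by apply: (star_fin_linl vsP c_gt0 sigma_bound); exact: PM.
  + move=> a x y z Px Py Pz; rewrite !sE//; last exact: Plin.
    by apply: (star_fin_linr vsP c_gt0 sigma_bound); exact: PM.
  + by move=> x _; exact: measure_starK.
  + by move=> a x y _ _; exact: measure_star_lin.
  + move=> x y Px Py; rewrite !sE//; try exact: Pst.
    by apply: (star_finM sigmaP vsP c_gt0 sigma_bound); exact: PM.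
- by move=> x y Px Py; rewrite !sE//; apply: star0C; exact: PM.
- exact: Pbr.
- by move=> a x y z Px Py Pz; apply: bracket0_lin; (exact: PM || exact: Pm).
- by move=> x y Px Py; apply: bracket0C; (exact: PM || exact: Pm).
- by move=> x y Px Py; apply: bracket0_star; (exact: PM || exact: Pm).
- by move=> x y z Px Py Pz; apply: bracket0_jacobi; (exact: PM || exact: Pm).
- move=> x y z Px Py Pz; rewrite (sE _ y z)// (sE _ (br x y) z)//; last exact: Pbr.
  rewrite (sE _ y (br x z))//; last exact: Pbr.
  by apply: bracket0_leibniz; (exact: PM || exact: Pm).
Qed.

Lemma measure_sub_star_algebra P h : poisson_closed P ->
  sub_star_algebra (measure_algebra sigma h) (QB h @` P).
Proof.
move=> PC; have -> : QB h @` P = P by rewrite /QB image_id.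
split => /=.
- exact: pc_ME PC.
- by split; [exact: pc_zero PC|exact: pc_lin PC].
- move=> x y Px Py.
  rewrite (starE vsP c_gt0 sigma_bound h (pc_ME PC Px) (pc_ME PC Py)); exact: (pc_mul PC).
- by move=> x Px; exact: (pc_star PC).
Qed.

Lemma measure_quantization P : poisson_closed P ->
  @strict_deformation_quantization R (fun _ => measure_space E)
    (measure_poisson sigma P) (measure_algebra sigma) (@QB R E).
Proof.
move=> PC; have PM x := pc_ME PC (x := x); have Pm x := pc_moments PC (x := x).
split => //.
- exact: measure_poisson_algebra.
- move=> h; exact: (measure_banach sigmaP vsP c_gt0 sigma_bound).
- move=> x y Px Py; apply: (dirac sigmaP vsP c_gt0 sigma_bound (PM _ Px) (PM _ Py)).
    exact: im (Pm _ Px).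
  exact: im (Pm _ Py).
- move=> x y Px Py; exact: (von_neumann vsP c_gt0 sigma_bound (PM _ Px) (PM _ Py)).
- by move=> x Px; exact: (@cst_continuous R R (tvnorm x)).
- by move=> h; exact: measure_sub_star_algebra.
Qed.

End PoissonIdentities.

(** * Lifting Haar measures along linear maps *)

Section LebesgueTranslation.
Context (R : realType).
Local Notation leb := (@lebesgue_measure R).

Let mt (t : R) : measurable_fun [set: measurableTypeR R] (fun s : R => t + s : measurableTypeR R).
Proof. by apply: measurable_funD. Qed.

(** Lebesgue measure is determined by the lengths of half-open intervals, which are invariant. *)
Lemma lebesgue_translation (t : R) (A : set R) : measurable A ->
  leb [set s | A (t + s)] = leb A.
Proof.
move=> mA; rewrite [RHS](@lebesgue_measure_unique R (image_measure leb (mt t)))//.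
move=> X /ocitvP[->|[[a b] /= ab ->]]; first by rewrite !measure0.
suff : leb `]a, b] = leb [set s | t + s \in `]a, b]] by [].
have -> : [set s | t + s \in `]a, b]] = `](a - t), (b - t)]%classic.
  by apply/seteqP; split=> s /=; rewrite !in_itv /=; lra.
rewrite !lebesgue_measure_itv /= !lte_fin ltrD2r; case: ifP => // _.
by rewrite -!EFinB; congr (_%:E); ring.
Qed.
End LebesgueTranslation.

Section AdjoinVector.
Context (R : realType) (E : lmodType R).
Implicit Types (V : set E) (k : E).

Definition adjoin V k : set E := [set x | exists y t, V y /\ x = y + t *: k].

Lemma adjoin_findim V k : findim_subspace V -> findim_subspace (adjoin V k).
Proof.
move=> [n [e ->]]; exists n.+1.
exists (fun i => if unlift ord_max i is Some j then e j else k).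
apply/seteqP; split=> [_ [_ [t [[s ->] ->]]]|_ [s ->]].
- exists (fun i => if unlift ord_max i is Some j then s j else t).
  rewrite big_ord_recr /= unlift_none; congr (_ + _); apply: eq_bigr => i _.
  by rewrite (_ : widen_ord _ i = lift ord_max i) ?liftK//; apply: val_inj; rewrite /= /bump leqNgt ltn_ord.
- exists (\sum_(i < n) s (widen_ord (leqnSn n) i) *: e i), (s ord_max); split.
    by exists (fun i => s (widen_ord (leqnSn n) i)).
  rewrite big_ord_recr /= unlift_none; congr (_ + _); apply: eq_bigr => i _.
  congr (_ *: _).
  by rewrite (_ : widen_ord _ i = lift ord_max i) ?liftK//; apply: val_inj; rewrite /= /bump leqNgt ltn_ord.
Qed.

Lemma line_measurable k :
  measurable_fun [set: measurableTypeR R] (fun s : R => s *: k : ilBorel E).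
Proof.
apply: il_measurable_fun => // U Uo; apply: open_measurable.
rewrite openE => s /= Us; have [p pP HU] := Uo _ Us; have [p0 pZ _] := pP.
apply/nbhs_ballP; exists ((1 + p k)^-1); first by rewrite /= invr_gt0 ltr_pwDl.
move=> s' /=; rewrite /ball /= => ss'; apply: HU.
rewrite -scalerBl pZ distrC.
apply: (@le_lt_trans _ _ (`|s - s'| * (1 + p k))); first by rewrite ler_wpM2l// lerDr.
by rewrite -ltr_pdivlMr ?mul1r// ltr_pwDl.
Qed.

Variables (V : set E) (k : E) (lam : {measure set (ilBorel E) -> \bar R}).
Hypotheses (fV : findim_subspace V) (kV : ~ V k) (hl : haar_on V lam).
Local Notation leb := (@lebesgue_measure R).

(** The measure is the image of [lam] times Lebesgue measure under [x + s *: k], with [retr]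
    inserted in [phi] to make the addition measurable. As [lam] is an arbitrary measure, only the
    integral against [lam] of the lengths of sections is used. The second conclusion is made for
    preimages under a linear map that kills [k]. *)
Lemma haar_adjoin : exists lam1 : {measure set (ilBorel E) -> \bar R},
  haar_on (adjoin V k) lam1 /\
  forall A, il_measurable A -> lam A = 0%E ->
    (forall x s, V x -> A (x + s *: k) -> A x) -> lam1 A = 0%E.
Proof.
have sV := findim_is_subspace fV; have mV := findim_measurable fV.
have fV' := adjoin_findim k fV; have mV' := findim_measurable fV'.
have [l0 lV [U [oU U0 lU]] lt] := hl.
have [e V'e] := findim_cspan fV'.
have VV' x : V x -> adjoin V k x by move=> Vx; exists x, 0; rewrite scale0r addr0.
have Ve x : V x -> cspan e x by move=> /VV'/V'e.
have ke s : cspan e (s *: k).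
  by apply: V'e; exists 0, s; rewrite add0r; split => //; case: sV.
pose r := retr e.
pose phi (p : ilBorel E * measurableTypeR R) : ilBorel E := r p.1 + r (p.2 *: k).
have mphi : measurable_fun setT phi.
  have m2 := measurableT_comp (line_measurable k)
    (@measurable_snd _ _ (ilBorel E) (measurableTypeR R)).
  exact: (measurableT_comp (retr2_add_measurable e) (measurable_fun_pair measurable_fst m2)).
pose lam1 : {measure set (ilBorel E) -> \bar R} :=
  image_measure (lam \x leb)%E mphi.
pose G (A : set E) (x : E) : \bar R := leb [set s | A (r x + r (s *: k))].
have lam1E A : lam1 A = (\int[lam]_x G A x)%E.
  apply: eq_integral => x _ /=; rewrite /G; congr (leb _).
  by apply/seteqP; split=> s; rewrite /xsection /= inE.
have GE A x : V x -> G A x = leb [set s | A (x + s *: k)].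
  by move=> Vx; rewrite /G /r (retr_id (Ve _ Vx)); congr (leb _); apply/seteqP;
    split=> s /=; rewrite (retr_id (ke s)).
have lam1V A (g : E -> \bar R) : (forall x, V x -> leb [set s | A (x + s *: k)] = g x) ->
    lam1 A = (\int[lam]_x g x)%E.
  move=> Ag; rewrite lam1E; apply: (integral_agree mV l0) => x Vx.
  by rewrite GE// Ag.
have null A : il_measurable A -> lam A = 0%E ->
    (forall x s, V x -> A (x + s *: k) -> A x) -> lam1 A = 0%E.
  move=> mA lA Ak; rewrite lam1E -(@integral0 _ _ _ lam setT).
  have mVA := il_measurableI mV (il_measurableC mA).
  apply: (integral_agree mVA) => [|x [Vx Ax]].
    apply/eqP; rewrite eq_le measure_ge0 andbT -[X in (_ <= X)%E]adde0 -{1}l0 -lA.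
    rewrite setCI setCK; apply: measureU2 => //; exact: il_measurableC.
  rewrite GE// (_ : [set s | _] = set0) ?measure0//.
  by apply/seteqP; split=> s //= /(Ak _ _ Vx).
exists lam1; split => //; split.
- rewrite (lam1V _ (fun=> 0%E)) ?integral0// => x Vx.
  rewrite (_ : [set s | _] = set0) ?measure0//.
  by apply/seteqP; split=> s //=; apply; exists x, s.
(* Every section over [V] is a whole line, of infinite length, and [lam] has positive mass. *)
- rewrite (lam1V _ (cst +oo%E)); last first.
    move=> x Vx; rewrite (_ : [set s | _] = setT).
      by rewrite -set_itvNyy lebesgue_measure_itv.
    by apply/seteqP; split=> s //= _; exists x, s.
  rewrite integral_cst// gt0_mulye//.
  by apply: lt_le_trans lV _; apply: le_measure; rewrite ?inE//; exact: mV.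
- have [psi [psiS psi0 psik]] := separating_functional sV kV.
  (* A box over [U] of length 2 in the direction of [k]: subtracting [psi y *: k] is the projection
     along [k], and the box has measure [2 lam U]. *)
  exists [set y | U (y - psi y *: k) /\ `|psi y| < 1]; split.
  + move=> x [Ux px].
    have [p pP HU] := oU _ Ux; have sp := seminorm_scalar psiS.
    have d0 : 0 < 1 - `|psi x| by rewrite subr_gt0.
    have K0 : 0 <= (1 - `|psi x|)^-1 by rewrite invr_ge0 ltW.
    have [p0 pZ pD] := pP.
    (* The terms [p z + p k |psi z|] bound [p] on the projected increment; the last coefficient
       forces [|psi (y - x)| < 1 - |psi x|]. *)
    exists (fun z => p z + (p k + (1 - `|psi x|)^-1) * `|psi z|).
      by apply: seminormD => //; apply: seminormZl => //; rewrite addr_ge0.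
    move=> y Hy; rewrite !mulrDl in Hy.
    have h1 : 0 <= p (y - x) := p0 _.
    have h2 : 0 <= p k * `|psi (y - x)| by rewrite mulr_ge0.
    have h3 : 0 <= (1 - `|psi x|)^-1 * `|psi (y - x)| by rewrite mulr_ge0.
    split.
      apply: HU; rewrite (_ : _ - _ = (y - x) + (- psi (y - x)) *: k).
        by apply: le_lt_trans (pD _ _) _; rewrite pZ normrN; lra.
      by rewrite is_scalarB// (opprB (psi y)) scalerBl opprB addrACA [RHS]addrACA (addrC (- (psi y *: k))).
    have : (1 - `|psi x|)^-1 * `|psi (y - x)| < 1 by lra.
    rewrite mulrC ltr_pdivrMr// mul1r is_scalarB// => h4.
    have := ler_normD (psi y - psi x) (psi x); rewrite subrK; lra.
  + by rewrite /= (is_scalar0 psiS) scale0r subr0 normr0.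
  + have mU := il_open_measurable oU.
    rewrite (lam1V _ (fun x => (2 * \1_U x)%:E)); last first.
      move=> x Vx; have E1 s : psi (x + s *: k) = s.
        by rewrite is_scalarD// is_scalarZ// psi0// psik add0r mulr1.
      rewrite indicE; have [xU|xU] := boolP (x \in U).
        rewrite (_ : [set s | _] = `](-1 : R), 1[%classic).
          rewrite lebesgue_measure_itv /= lte_fin ifT; last by lra.
          by rewrite -EFinB; congr (_%:E); ring.
        apply/seteqP; split=> s /=; rewrite in_itv /= E1 addrK.
          by move=> [_]; rewrite ltr_norml.
        by move=> ss; split; [exact: set_mem|rewrite ltr_norml].
      rewrite mulr0 (_ : [set s | _] = set0) ?measure0//.
      by apply/seteqP; split=> s //=; rewrite E1 addrK => -[/mem_set]; rewrite (negbTE xU).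
    under eq_integral do rewrite EFinM.
    rewrite ge0_integralZl//; last by apply/measurable_EFinP; exact: measurable_indic.
    by rewrite integral_indic// setIT lte_mul_pinfty.
- move=> _ A [v0 [t [Vv ->]]] mA.
  have mline y : measurable [set s : measurableTypeR R | A (y + s *: k)].
    have := measurableT_comp (translation_measurable y) (line_measurable k).
    by move=> /(_ measurableT _ mA); rewrite setTI.
  (* The shift by [t *: k] is absorbed by Lebesgue measure in each section, the shift by [v0] by
     [lam]. *)
  rewrite (lam1V _ (fun x => G A (v0 + x))); last first.
    move=> x Vx; rewrite GE; last exact: is_subspaceD.
    rewrite -[RHS](lebesgue_translation t (mline (v0 + x))); congr (leb _).
    by apply/seteqP; split=> s /=; rewrite scalerDl addrACA.
  have mG : measurable_fun setT (G A : ilBorel E -> \bar R).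
    have mpA : measurable (phi @^-1` A) by have := mphi measurableT _ mA; rewrite setTI.
    have := measurable_fun_xsection leb mpA.
    congr measurable_fun; apply/funext => x; rewrite /G /=; congr (leb _).
    by apply/seteqP; split=> s; rewrite /xsection /= inE.
  have mtr := @translation_measurable R E v0.
  have := ge0_integral_pushforward mtr lam measurableT mG.
  rewrite preimage_setT => /(_ _)/esym -> //.
  rewrite lam1E; apply: eq_set_integral => B mB.
  exact: lt.
Qed.

End AdjoinVector.

Section HaarLift.
Context (R : realType) (E E' : lmodType R) (T : {linear E -> E'}).
Implicit Types (V : set E).

Lemma findim_image (S : {linear E -> E'}) V : findim_subspace V -> findim_subspace (S @` V).
Proof.
move=> [n [e ->]]; exists n, (fun i => S (e i)); apply/seteqP; split.
  move=> _ [_ [t ->] <-]; exists t; rewrite linear_sum; apply: eq_bigr => i _.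
  by rewrite linearZ.
move=> _ [t ->]; exists (\sum_(i < n) t i *: e i); first by exists t.
by rewrite linear_sum; apply: eq_bigr => i _; rewrite linearZ.
Qed.
End HaarLift.

Section HaarLiftThm.
Context (R : realType) (E E' : lmodType R) (T : {linear E -> E'}).
Variables (V : set E) (lam' : {measure set (ilBorel E') -> \bar R}).
Hypotheses (fV : findim_subspace V) (hl : haar_on (T @` V) lam').

Let sV := findim_is_subspace fV.
Let fV' := findim_image T fV.
Let mV' := findim_measurable fV'.

(** Each member of a spanning family of the image is sent to a chosen preimage in [V]; as the
    coordinates are functionals on all of [E'], this defines a linear map there. *)
Lemma linear_section : exists S : {linear E' -> E},
  forall x, (T @` V) x -> V (S x) /\ T (S x) = x.
Proof.
have [n [e' [phi [e'V phiS phiE]]]] := findim_coord fV'.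
have H i : exists y, V y /\ T y = e' i by have [y Vy Ty] := e'V i; exists y.
have [e eP] := choice H.
have ePV i : V (e i) by have [] := eP i.
pose S0 (x : E') : E := \sum_(i < n) phi i x *: e i.
have S0l : linear S0.
  move=> a x y; rewrite /S0 scaler_sumr -big_split; apply: eq_bigr => i _ /=.
  by rewrite phiS scalerDl scalerA.
pose S : {linear E' -> E} := HB.pack S0 (GRing.isLinear.Build R E' E _ S0 S0l).
exists S => x Vx; split.
  by apply: is_subspace_sum => // i _; exact: is_subspaceZ.
rewrite [RHS](phiE x Vx) /= /S0 linear_sum; apply: eq_bigr => i _.
by rewrite linearZ /= (eP i).2.
Qed.

(** The condition on null sets has the direction that push-forward needs: for a [lam']-null set [A],
    a measure on [E] absolutely continuous on [W] vanishes at the preimage of [A]. *)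
Definition liftable (W : set E) := findim_subspace W /\
  exists lam : {measure set (ilBorel E) -> \bar R}, haar_on W lam /\
  forall A, il_measurable A -> lam' A = 0%E -> lam (T @^-1` A) = 0%E.

Lemma linear_preimage A : il_measurable A -> il_measurable (T @^-1` A).
Proof. by move=> mA; have := linear_measurable T (il_measurableT (E := E)) mA; rewrite setTI. Qed.

Lemma liftable_section (S : {linear E' -> E}) :
  (forall x, (T @` V) x -> V (S x) /\ T (S x) = x) -> liftable (S @` (T @` V)).
Proof.
move=> SV; have fW := findim_image S fV'; have mW := findim_measurable fW.
split=> //; have [l0 lV [U [oU U0 lU]] lt] := hl.
have mS := linear_measurable S.
pose lam : {measure set (ilBorel E) -> \bar R} := image_measure lam' mS.
have lamE A : lam A = lam' (S @^-1` A) by [].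
have mpre A : il_measurable A -> il_measurable (S @^-1` A).
  by move=> mA; have := mS measurableT _ mA; rewrite setTI.
(* As [lam'] lives on the image of [V], sets need to be compared only there, where [S] is a right
   inverse of [T]. *)
have le_on A B : il_measurable A -> il_measurable B -> A `&` (T @` V) `<=` B ->
    (lam' A <= lam' B)%E.
  move=> mA mB AB.
  apply: (@le_trans _ _ (lam' B + lam' (~` (T @` V)))%E); last by rewrite l0 adde0.
  apply: le_trans (measureU2 _ mB (il_measurableC mV')).
  apply: le_measure; rewrite ?inE//; first by apply: il_measurableU => //; exact: il_measurableC.
  by move=> x Ax; have [Vx|Vx] := pselect ((T @` V) x); [left; apply: AB|right].
exists lam; split; first split.
- apply/eqP; rewrite eq_le measure_ge0 andbT lamE -l0; apply: le_measure; rewrite ?inE//.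
  + exact: (mpre _ (il_measurableC mW)).
  + exact: (il_measurableC mV').
  + by move=> x /= H Vx; apply: H; exists x.
- apply: lt_le_trans lV _; rewrite lamE; apply: le_measure; rewrite ?inE//.
    exact: (mpre _ mW).
  by move=> x Vx; exists x.
- exists (T @^-1` U); split.
  + apply: il_open_preimage oU => p pP x; exists (fun z => p (T z)); first exact: seminorm_comp.
    by move=> y; rewrite linearB.
  + by rewrite /= linear0.
  + apply: le_lt_trans lU; rewrite lamE; apply: le_on => [|| x [/= Ux Vx]].
    * exact: (mpre _ (linear_preimage (il_open_measurable oU))).
    * exact: il_open_measurable.
    * by move: Ux; rewrite (SV _ Vx).2.
- move=> _ A [v Vv <-] mA; rewrite !lamE -(lt v _ Vv (mpre _ mA)).
  by congr (lam' _); apply/seteqP; split=> x /=; rewrite linearD.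
- move=> A mA lA; apply/eqP; rewrite eq_le measure_ge0 andbT lamE -lA.
  apply: le_on => [|//|x [/= Ax Vx]]; first exact: (mpre _ (linear_preimage mA)).
  by move: Ax; rewrite (SV _ Vx).2.
Qed.

Lemma liftable_adjoin W k : liftable W -> T k = 0 -> exists W', liftable W' /\
  [/\ W `<=` W', W' k & forall X, is_subspace X -> W `<=` X -> X k -> W' `<=` X].
Proof.
move=> [fW [lam [hW null]]] Tk; have [Wk|Wk] := pselect (W k).
  by exists W; split; [split => //; exists lam|split].
have [lam1 [h1 n1]] := haar_adjoin fW Wk hW.
have [W0 _] := findim_is_subspace fW.
exists (adjoin W k); split.
  split; first exact: adjoin_findim.
  exists lam1; split => // A mA lA; apply: n1 => //; first exact: linear_preimage.
    exact: null.
  by move=> x s _ /=; rewrite linearD linearZ /= Tk scaler0 addr0.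
split.
- by move=> x Wx; exists x, 0; rewrite scale0r addr0.
- by exists 0, 1; rewrite scale1r add0r.
- move=> X sX WX Xk _ [y [t [Wy ->]]].
  by apply: is_subspaceD => //; [exact: WX|exact: is_subspaceZ].
Qed.

(* [V] is obtained from the image of a linear section of [T] by adjoining
   finitely many vectors of the kernel of [T]. *)
Lemma haar_lift : exists lam : {measure set (ilBorel E) -> \bar R}, haar_on V lam /\
  forall A, il_measurable A -> lam' A = 0%E -> lam (T @^-1` A) = 0%E.
Proof.
have [S SP] := linear_section; have LS := liftable_section SP.
have [n [b bE]] := fV.
have bV i : V (b i) by rewrite bE; exact: lin_span_gen.
have SVV : S @` (T @` V) `<=` V by move=> _ [x Vx <-]; have [] := SP x Vx.
have key (s : seq 'I_n) : exists W, [/\ liftable W, S @` (T @` V) `<=` W, W `<=` V &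
    forall i, i \in s -> W (b i)].
  elim: s => [|i s [W [LW SW WV Wb]]]; first by exists (S @` (T @` V)); split => //; exact: LS.
  have TbV : (T @` V) (T (b i)) by exists (b i).
  (* This kernel vector is adjoined in place of [b i], since [S (T (b i))] already lies in [W]. *)
  have Tk : T (b i - S (T (b i))) = 0 by rewrite linearB /= (SP _ TbV).2 subrr.
  have [W' [LW' [WW' W'k W'X]]] := liftable_adjoin LW Tk.
  have sW' : is_subspace W' by case: LW' => fW' _; exact: findim_is_subspace.
  exists W'; split => //.
  - exact: subset_trans SW WW'.
  - apply: W'X => //; apply: is_subspaceB => //; exact: (SP _ TbV).1.
  - move=> j; rewrite inE => /orP[/eqP->|/Wb/WW']; last by [].
    rewrite -[b i](subrK (S (T (b i)))); apply: is_subspaceD => //.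
    by apply: WW'; apply: SW; exists (T (b i)).
have [W [[fW [lam [hW null]]] _ WV Wb]] := key (enum 'I_n).
suff <- : W = V by exists lam.
apply/seteqP; split => //; rewrite bE; apply: lin_span_sub; first exact: findim_is_subspace.
by move=> i; apply: Wb; rewrite mem_enum.
Qed.
End HaarLiftThm.

(** * Functoriality *)

Section Push.
Context (R : realType) (E E' : lmodType R) (T : {linear E -> E'}).
Implicit Types (mu nu : set E -> R[i]) (e : nat -> E) (m q : E' -> R).

Lemma pushE mu A : il_measurable A -> push T mu A = mu (T @^-1` A).
Proof. by move=> mA; rewrite /push; case: asboolP. Qed.

Lemma push_out mu A : ~ il_measurable A -> push T mu A = 0.
Proof. by move=> mA; rewrite /push; case: asboolP. Qed.

Lemma push_lin a mu nu : push T (a *: mu + nu) = a *: push T mu + push T nu.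
Proof.
apply/funext => A; rewrite -[RHS]/(a * push T mu A + push T nu A).
have [mA|mA] := pselect (il_measurable A); first by rewrite !(pushE _ mA).
by rewrite !(push_out _ mA) mulr0 addr0.
Qed.

Lemma push_star mu : push T (measure_star mu) = measure_star (push T mu).
Proof.
apply/funext => A; have [mA|mA] := pselect (il_measurable A).
  rewrite (pushE _ mA) /measure_star (pushE _ (opp_il_measurable mA)).
  by congr ((mu _)^*); apply/seteqP; split=> x /=; rewrite linearN.
rewrite (push_out _ mA) /measure_star push_out ?conjC0// => /opp_il_measurable H.
apply: mA; move: H; congr il_measurable.
by apply/seteqP; split=> x /=; rewrite opprK.
Qed.

Definition cspan_map e : nat -> E' := fun i => T (e i).

Lemma cspan_mapP e x : cspan e x -> cspan (cspan_map e) (T x).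
Proof.
move=> [n _ [t ->]]; exists n => //; exists t.
by rewrite linear_sum; apply: eq_bigr => i _; rewrite linearZ.
Qed.

Section Rep.
Variables (e : nat -> E) (lam : {finite_measure set (ilBorel E) -> \bar R})
  (u : ilBorel E -> R[i]) (mu : set E -> R[i]).
Hypotheses (muP : crep lam (fun x => x) u mu) (u0 : forall x, ~ cspan e x -> u x = 0).

Definition push_map (x : ilBorel E) : ilBorel E' := T (retr e x).

Lemma push_map_measurable : measurable_fun setT push_map.
Proof. exact: (measurableT_comp (linear_measurable T) (retr_measurable e)). Qed.

Lemma push_map_in x : cspan (cspan_map e) (push_map x).
Proof. by apply: cspan_mapP; exact: retr_in. Qed.

Lemma push_crep : crep lam push_map u (push T mu).
Proof.
have [_ iu _] := muP; split => //; first exact: push_map_measurable.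
apply/funext => A; case: asboolP => mA; last exact: push_out.
rewrite (pushE _ mA) (crepE muP (linear_preimage T mA)); apply: eq_Cint => x.
have [Wx|Wx] := pselect (cspan e x); last by rewrite u0// !mul0r.
by rewrite /push_map retr_id// !indicE.
Qed.
End Rep.

Lemma onW_push e mu : onW e mu -> onW (cspan_map e) (push T mu).
Proof.
move=> muW; have [lam [u [ru u0]]] := onW_rep muW.
have rp := push_crep ru u0; split; first exact: crep_cmeasure rp.
move=> A mA; have mI := il_measurableI mA (cspan_measurable (cspan_map e)).
rewrite (crepE rp mA) (crepE rp mI); apply: eq_Cint => x.
congr (_ * _%:C); rewrite !indicE; congr (_%:R).
by rewrite in_setI (mem_set (push_map_in e x)) andbT.
Qed.

Lemma tvnorm_push e mu : onW e mu -> tvnorm (push T mu) <= tvnorm mu.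
Proof.
move=> muW; have [lam [u [ru u0]]] := onW_rep muW.
by apply: le_trans (tvnorm_crep (push_crep ru u0)) _; rewrite (tvnorm_rep ru).
Qed.

Lemma weight_comp m : weight m -> weight (fun x => m (T x)).
Proof.
move=> [m1 mm mD]; split => // [|x y]; last by rewrite linearD.
exact: (measurableT_comp mm (linear_measurable T)).
Qed.

Lemma wint_push e mu m : onW e mu -> weight m -> wint mu (fun x => m (T x)) ->
  wint (push T mu) m.
Proof.
move=> muW mW im; have [lam [u [ru u0]]] := onW_rep muW.
apply: (wint_crep (push_crep ru u0)); first exact: weight_nonneg.
have := rintegrable_weight ru u0 (weight_comp mW) im.
by congr rintegrable; apply/funext => x; rewrite mulrC.
Qed.

Lemma adm_comp e m h : adm (cspan_map e) m h -> adm e (fun x => m (T x)) (fun x => h (T x)).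
Proof.
move=> hA; split.
  exact: (cmf_adm hA (push_map_measurable e) (push_map_in e)).
have [_ [C C0 hC]] := hA; exists C => // x Wx; apply: hC; exact: cspan_mapP.
Qed.

Lemma cint_push e mu m h : onW e mu -> weight m -> wint mu (fun x => m (T x)) ->
  adm (cspan_map e) m h -> cint (push T mu) h = cint mu (fun x => h (T x)).
Proof.
move=> muW mW im hA; have [lam [u [ru u0]]] := onW_rep muW.
have hA' := adm_comp hA.
rewrite (cint_adm ru u0 (weight_comp mW) im hA').
apply: (cint_rep (push_crep ru u0) (e := cspan_map e)).
- exact: push_map_in.
- by case: hA.
- have := cintegrable_normc (cintegrable_adm ru u0 (weight_comp mW) im hA').
  by congr rintegrable; apply/funext => x; rewrite Normc.normcM.
Qed.

(** The weight lives on [E'] and is pulled back along [T]. Since [w] is the pull-back of [w'] and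
    [T] is additive, both sides are the same double integral on [E]. *)
Lemma push_twisted e mu nu m w w' : onW e mu -> onW e nu -> weight m ->
  wint mu (fun x => m (T x)) -> wint nu (fun x => m (T x)) ->
  adm2 (cspan_map e) m w' -> (forall f g, w f g = w' (T f) (T g)) ->
  push T (twisted_conv w mu nu) = twisted_conv w' (push T mu) (push T nu).
Proof.
move=> H1 H2 mW i1 i2 wA ww; apply/funext => A.
have [mA|mA] := pselect (il_measurable A); last by rewrite push_out// twisted_conv_out.
have H2' := onW_push H2; have i2' := wint_push H2 mW i2.
have A1 := adm2_indic mW wA mA.
have B1 := adm_cint H2' mW i2' A1.
rewrite (pushE _ mA) (twisted_convE _ _ _ mA) (twisted_convE _ _ _ (linear_preimage T mA)).
rewrite (cint_push H1 mW i1 B1).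
symmetry; apply: (eq_cint H1 (weight_comp mW) i1 (adm_comp B1)) => f Wf.
rewrite (cint_push H2 mW i2 (adm2_fst mW A1 (cspan_mapP Wf))).
congr cint; apply/funext => g; rewrite ww /cindic !indicE; congr (_ * (_%:R)%:C).
by rewrite -linearD.
Qed.

Lemma ME_push mu : ME mu -> ME (push T mu).
Proof. by move=> /ME_onW[e H]; exact: onW_ME (onW_push H). Qed.

Lemma conc_push mu D S : conc D mu -> il_measurable S -> D `<=` T @^-1` S ->
  conc S (push T mu).
Proof.
move=> cD mS DS A mA; rewrite (pushE _ mA) (pushE _ (il_measurableI mA mS)).
rewrite (cD _ (linear_preimage T mA)) (cD _ (linear_preimage T (il_measurableI mA mS))).
congr mu; apply/seteqP; split=> x /= [Ax Dx]; split => //; last by case: Ax.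
by split => //; exact: DS.
Qed.

Lemma seminorm_pull q : seminorm q -> seminorm (fun x => q (T x)).
Proof. exact: seminorm_comp. Qed.

Lemma moments_push e mu q : onW e mu -> seminorm q -> moments mu (fun x => q (T x)) ->
  moments (push T mu) q.
Proof.
by move=> H qP im N; apply: (wint_push H) (im N); exact: moment_weightP.
Qed.

Lemma bounded_moments s s' mu : (forall b : choice_index s, seminorm (choice_family b)) ->
  (forall b : choice_index s', seminorm (choice_family b)) -> bounded_for T s s' ->
  ME mu -> (forall b : choice_index s, moments mu (choice_family b)) ->
  forall b : choice_index s', moments mu (fun x => choice_family b (T x)).
Proof.
move=> sP sP' Tb Mmu mmu b; have [G [c [c0 Hc]]] := Tb b.
have cmu := ME_cmeasure Mmu.
have sG : seminorm (fun x => \sum_(j <- G) c j * choice_family j x).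
  by apply: seminorm_sum => j; exact: seminormZl.
apply: (moments_le (k := 1) cmu sG (seminorm_pull (sP' b))) => //.
  by move=> x; rewrite mul1r.
exact: (moments_sum G cmu c0 sP mmu).
Qed.
End Push.

Lemma push_id (R : realType) (E : lmodType R) (mu : set E -> R[i]) :
  cmeasure mu -> push (@idfun E) mu = mu.
Proof.
move=> cmu; apply/funext => A; rewrite /push; case: asboolP => // mA.
by rewrite (cmeasure_out cmu mA).
Qed.

Lemma push_comp (R : realType) (E E' E'' : lmodType R) (T : {linear E -> E'})
    (T' : {linear E' -> E''}) mu : push (T' \o T) mu = push T' (push T mu).
Proof.
apply/funext => A; rewrite /push; case: asboolP => // mA.
by case: asboolP => // H; case: H; exact: (linear_preimage _ _).
Qed.

(** * Push-forward as a morphism of quantizations *)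

Section Functoriality.
Context (R : realType) (E : lmodType R) (sigma : {biscalar E}) (vs : E -> R) (c : R).
Hypotheses (sigmaP : presymplectic sigma) (vsP : seminorm vs) (c_gt0 : 0 < c).
Hypothesis (sigma_bound : forall f g, `|sigma f g| <= c * vs f * vs g).
Context (E' : lmodType R) (sigma' : {biscalar E'}) (vs' : E' -> R) (c' : R).
Hypotheses (sigmaP' : presymplectic sigma') (vsP' : seminorm vs') (c_gt0' : 0 < c').
Hypothesis (sigma_bound' : forall f g, `|sigma' f g| <= c' * vs' f * vs' g).
Variable T : {linear E -> E'}.
Hypothesis sigmaT : forall f g, sigma' (T f) (T g) = sigma f g.
Variables (t : poisson_type E) (t' : poisson_type E').
Hypotheses (tA : type_admissible vs t) (tA' : type_admissible vs' t') (tT : type_map T t t').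

Let PC := poisson_closed_type sigmaP vsP c_gt0 sigma_bound tA.

Lemma push_star_prod h mu nu : ME mu -> ME nu ->
  push T (star sigma h mu nu) = star sigma' h (push T mu) (push T nu).
Proof.
move=> Mmu Mnu; have [e [H1 H2]] := ME_onW2 Mmu Mnu.
rewrite (starE vsP c_gt0 sigma_bound)// (starE vsP' c_gt0' sigma_bound'); try exact: ME_push.
have [c1 _] := H1; have [c2 _] := H2.
apply: (push_twisted H1 H2 (weight1 E') (wint_cst c1) (wint_cst c2)
  (adm2_expi_sigma vsP' c_gt0' sigma_bound' _ h)) => f g.
by rewrite /expi_sigma sigmaT.
Qed.

(** Besides membership of the image, the moments of [vs'] composed with [T] are recorded: they
    control the kernel of [sigma'] along [T], as is needed for the push-forward to commute with the
    bracket. *)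
Lemma choice_moments_pull s s' mu : choice_admissible vs s -> choice_admissible vs' s' ->
  bounded_for T s s' -> choice_space s mu ->
  moments mu (fun x => vs' (T x)) /\ choice_space s' (push T mu).
Proof.
move=> sA sA' Tb; rewrite (choice_spaceE sigmaP vsP sigma_bound sA).
rewrite (choice_spaceE sigmaP' vsP' sigma_bound' sA') => -[Mmu mmu].
have sP b := choice_seminorm b sA; have sP' b := choice_seminorm b sA'.
have pm := bounded_moments sP sP' Tb Mmu mmu.
have [e H] := ME_onW Mmu; have cmu := ME_cmeasure Mmu; split.
  have [G [d [d0 vk]]] := choice_bound sA'.
  have sG : seminorm (fun x => \sum_(j <- G) d j * choice_family j (T x)).
    by apply: seminorm_sum => j; apply: seminormZl => //; exact: seminorm_pull.
  apply: (moments_le (k := 1) cmu sG (seminorm_pull T vsP')) => //.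
    by move=> x; rewrite mul1r.
  exact: (moments_sum G cmu d0 (fun b => seminorm_pull T (sP' b)) pm).
split; first exact: ME_push.
by move=> b; apply: (moments_push H).
Qed.

Lemma push_type mu : poisson_space t mu ->
  moments mu (fun x => vs' (T x)) /\ poisson_space t' (push T mu).
Proof.
case: t t' tA tA' tT => [s|s|s|V s|] [s'|s'|s'|V' s'|] //= sA sA' H.
- exact: choice_moments_pull.
- move=> [/ME_dP[cmu [D cD HD]] Hs]; have [h1 h2] := choice_moments_pull sA sA' H Hs.
  split => //; split => //; apply/ME_dP.
  have cS : countable (T @` D) := sub_countable (card_image_le _ _) cD.
  split; first by case: (choice_space_ME sigmaP' vsP' sigma_bound' sA' h2).
  exists (T @` D) => //; apply: (conc_push HD (countable_il_measurable cS)).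
  by move=> x Dx; exists x.
- case: H => Tinj H [/ME_cP[Mmu Amu] Hs]; have [h1 h2] := choice_moments_pull sA sA' H Hs.
  split => //; split => //; apply/ME_cP; split; first exact: ME_push.
  move=> f; rewrite (pushE _ _ (set1_measurable f)).
  have [[x Tx]|Tf] := pselect (exists x, T x = f).
    rewrite (_ : _ @^-1` _ = [set x]) ?Amu//.
    apply/seteqP; split=> [y /= Ty|y /= ->]; last exact: Tx.
    by apply: Tinj; rewrite Ty Tx.
  rewrite (_ : _ @^-1` _ = set0); first exact: cmeasure0 (ME_cmeasure Mmu).
  by apply/seteqP; split=> y //= Ty; apply: Tf; exists y.
- case: sA => fV sA; case: sA' => fV' sA'; case: H => TV H [[[cmu Vmu] amu] Hs].
  have [h1 h2] := choice_moments_pull sA sA' H Hs.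
  split => //; split => //; split.
    split; first by case: (choice_space_ME sigmaP' vsP' sigma_bound' sA' h2).
    by apply: (conc_push Vmu (findim_measurable fV')) => x Vx; rewrite /= -TV; exists x.
  (* The test against a Haar measure [lam'] on the image is carried back to its lift, a Haar measure
     on [V] for which the preimage of a [lam']-null set is null. *)
  move=> lam' hl A mA lA; rewrite -TV in hl; have [lam [hV null]] := haar_lift fV hl.
  by rewrite (pushE _ _ mA) (amu _ hV)//; [exact: (linear_preimage _ _)|exact: null].
- move=> Hmu; split; first exact: (ME_df_moments (seminorm_pull T vsP') Hmu).
  have Mmu := ME_df_sub Hmu; move/ME_dfP : Hmu => [cmu [l cl]]; apply/ME_dfP; split.
    exact: ME_cmeasure (ME_push T Mmu).
  exists [seq T x | x <- l]; apply: (conc_push cl (seq_measurable _)) => x /= xl.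
  exact: map_f.
Qed.

Lemma push_quantization_morphism :
  @quantization_morphism R (fun _ => measure_space E) (fun _ => measure_space E')
       (measure_poisson sigma (poisson_space t)) (measure_algebra sigma) (@QB R E)
       (measure_poisson sigma' (poisson_space t')) (measure_algebra sigma') (@QB R E')
       (fun _ => push T).
Proof.
split => //=.
- split => /=.
  + by move=> x /push_type[].
  + by move=> a x y _ _; exact: push_lin.
  + by move=> x _; exact: push_star.
  + by move=> x y Px Py; apply: push_star_prod; exact: (pc_ME PC).
  + move=> x y Px Py; have [e [H1 H2]] := ME_onW2 (pc_ME PC Px) (pc_ME PC Py).
    have [ix _] := push_type Px; have [iy _] := push_type Py.
    apply: (push_twisted H1 H2 (vs_weightP vsP') (ix 1%N) (iy 1%N)
      (adm2_csigma vsP' c_gt0' sigma_bound' _)) => f g.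
    by rewrite /csigma sigmaT.
- move=> h; split => /=.
  + exact: ME_push.
  + by move=> a x y _ _; exact: push_lin.
  + by move=> x _; exact: push_star.
  + exact: push_star_prod.
  + by move=> x /ME_onW[e H]; exact: tvnorm_push H.
Qed.

End Functoriality.
Theorem theorem4 (R : realType) (E : lmodType R) (sigma : {biscalar E})
    (vs : E -> R) (c : R)
    (Einf : infinite_dimensional E) (sigmaP : presymplectic sigma)
    (vsP : seminorm vs) (c_gt0 : 0 < c)
    (sigma_bound : forall f g, `|sigma f g| <= c * vs f * vs g) :
  (* (i) *)
  (forall mu nu, ME mu -> ME nu ->
     tvnorm (star sigma h mu nu - star sigma 0 mu nu) @[h --> 0^'] --> (0 : R))
  /\
  (* (ii) *)
  (forall mu nu, M_moment vs 1 mu -> M_moment vs 1 nu ->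
     ME (bracket0 sigma mu nu) /\
     tvnorm (scaled_commutator (measure_algebra sigma h) h mu nu
             - bracket0 sigma mu nu) @[h --> 0^'] --> (0 : R))
  /\
  (* (iii) *)
  ((forall h, ns_norm (measure_algebra sigma h) = @tvnorm R E) /\
   forall mu, ME mu ->
     continuous (fun h : R => ns_norm (measure_algebra sigma h) mu))
  /\
  (* (iv) *)
  (forall t : poisson_type E, type_admissible vs t ->
     forall h, sub_star_algebra (measure_algebra sigma h)
                 (QB h @` poisson_space t))
  /\
  (* strict deformation quantization *)
  (forall t : poisson_type E, type_admissible vs t ->
     @strict_deformation_quantization R (fun _ => measure_space E)
       (measure_poisson sigma (poisson_space t)) (measure_algebra sigma) (@QB R E))
  /\
  (* functoriality *)
  (forall t : poisson_type E, type_admissible vs t ->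
   forall (E' : lmodType R) (sigma' : {biscalar E'}) (vs' : E' -> R) (c' : R)
          (t' : poisson_type E') (T : {linear E -> E'}),
     infinite_dimensional E' -> presymplectic sigma' ->
     seminorm vs' -> 0 < c' ->
     (forall f g, `|sigma' f g| <= c' * vs' f * vs' g) ->
     type_admissible vs' t' ->
     (forall f g, sigma' (T f) (T g) = sigma f g) ->
     type_map T t t' ->
     @quantization_morphism R (fun _ => measure_space E) (fun _ => measure_space E')
       (measure_poisson sigma (poisson_space t)) (measure_algebra sigma) (@QB R E)
       (measure_poisson sigma' (poisson_space t')) (measure_algebra sigma') (@QB R E')
       (fun _ => push T))
  /\
  (forall mu, ME mu -> push (@idfun E) mu = mu)
  /\
  (forall (E' E'' : lmodType R) (T : {linear E -> E'}) (T' : {linear E' -> E''}) mu,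
     ME mu -> push (T' \o T) mu = push T' (push T mu)).
Proof.
split; first by move=> mu nu; exact: (von_neumann vsP c_gt0 sigma_bound).
split.
  move=> mu nu Mmu Mnu; have [Hmu _] := Mmu; have [Hnu _] := Mnu.
  have imu := M_moment_wint vsP Mmu; have inu := M_moment_wint vsP Mnu.
  split; first exact: (ME_bracket0 vsP c_gt0 sigma_bound).
  exact: (dirac sigmaP vsP c_gt0 sigma_bound).
split.
  by split => // mu _; exact: (@cst_continuous R R (tvnorm mu)).
split.
  move=> t tA h; apply: (measure_sub_star_algebra vsP c_gt0 sigma_bound).
  exact: (poisson_closed_type sigmaP vsP c_gt0 sigma_bound tA).
split.
  move=> t tA; apply: (measure_quantization sigmaP vsP c_gt0 sigma_bound).
  exact: (poisson_closed_type sigmaP vsP c_gt0 sigma_bound tA).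
split.
  move=> t tA E' sigma' vs' c' t' T _ sigmaP' vsP' c'_gt0 sigma_bound' tA' sigmaT tT.
  exact: (push_quantization_morphism sigmaP vsP c_gt0 sigma_bound
    sigmaP' vsP' c'_gt0 sigma_bound' sigmaT tA tA' tT).
split; first by move=> mu [cmu _]; exact: push_id.
by move=> E' E'' T T' mu _; exact: push_comp.
Qed.
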